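(* Let $(X_i)_{i\in\mathbb N}$ be a stationary $\mathbb R^d$-valued process with continuous multidimensional distribution function $F$. Assume there is a vector space $\mathcal G$ of measurable functions $\mathbb R^d\to\mathbb R$, containing the constants, with a seminorm $\|\cdot\|_{\mathcal G}$, such that: (i) for every $f\in\mathcal G$ with $\|f\|_\infty<\infty$ and ${\rm E}f(X_0)=0$ there is $\sigma_f^2<\infty$ with $\frac1{\sqrt n}\sum_{i=1}^n f(X_i)\to N(0,\sigma_f^2)$ in distribution; (ii) $(X_i)$ is $\Theta,r$-multiple mixing with respect to $\mathcal G$ for some $r\ge1$ and some nonincreasing $\Theta:\mathbb N\to\mathbb R_0^+$, and there is an integer $p>dr$ with $\sum_{i=0}^\infty i^{2p-2}\Theta(i)<\infty$; (iii) $\mathcal G$ approximates the indicator functions with a $(\mathcal G,F)$-control function $\Psi$ satisfying $\Psi(z)=\mathcal O(z^{1/\gamma})$ as $z\to\infty$ for some $\gamma>\frac{rp}{p-rd}$. Then there is a centered Gaussian process $(W(t))_{t\in[-\infty,\infty]^d}$ with almost surely continuous sample paths such that $U_n\to W$ in distribution in $\mathbb D([-\infty,\infty]^d)$.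
   Context: Inequalities between vectors are componentwise. $F(t)=P(X_0\le t)$, marginals $F_1,\dots,F_d$. Empirical process $U_n(t)=\frac1{\sqrt n}\sum_{i=1}^n(\mathbf 1\{X_i\le t\}-F(t))$, $t\in[-\infty,\infty]^d$, a random element of $\mathbb D([-\infty,\infty]^d)$ (multidimensional càdlàg functions with the multidimensional Skorokhod metric). Modulus of continuity: $w_g(\delta)=\sup\{|g(t)-g(s)|:\|t-s\|\le\delta\}$. $(\mathcal G,F)$-control function: a nondecreasing $\Psi:\mathbb R_0^+\to\mathbb R_0^+$ such that for every $a<b$ in $[-\infty,\infty]^d$ there is $\phi_{(a,b)}\in\mathcal G$ with $\mathbf 1\{x\le a\}\le\phi_{(a,b)}(x)\le\mathbf 1\{x\le b\}$ for all $x\in\mathbb R^d$ and $\|\phi_{(a,b)}\|_{\mathcal G}\le\Psi\big(1/\min_{i}w_{F_i}(b_i-a_i)\big)$. Multiple mixing: for integers $i_1,\dots,i_j$ write $i_j^*=i_1+\dots+i_j$. $(X_i)$ is $\Theta,r$-multiple mixing with respect to $\mathcal G$ if $r\in[1,\infty)$, $\Theta:\mathbb N\to\mathbb R_0^+$ is nonincreasing, and for every $p\in\mathbb N^*$ there is $K_p<\infty$ such that $$\big|{\rm Cov}\big(f(X_0)f(X_{i_1^*})\cdots f(X_{i_{q-1}^*}),\,f(X_{i_q^*})f(X_{i_{q+1}^*})\cdots f(X_{i_p^*})\big)\big|\le K_p\|f(X_0)\|_r\|f\|_{\mathcal G}\Theta(i_q)$$ for all $f\in\mathcal G$ with $\|f\|_\infty\le1$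 and ${\rm E}f(X_0)=0$, all $i_1,\dots,i_p\in\mathbb N$ and all $q\in\{1,\dots,p\}$. *)

(* Defs.v *)
From HB Require Import structures.
From mathcomp Require Import all_boot all_order all_algebra.
From mathcomp Require Import all_classical all_reals all_analysis.
Set Implicit Arguments. Unset Strict Implicit. Unset Printing Implicit Defensive.
Import Order.TTheory GRing.Theory Num.Theory.
Import numFieldNormedType.Exports.
Local Open Scope classical_set_scope.
Local Open Scope ring_scope.

Section Defs.
Context {R : realType}.

Definition Rd_cyl (d : nat) : set (set ('I_d -> R)) :=
  [set A | exists (j : 'I_d) (B : set R), measurable B /\ A = (fun x => x j) @^-1` B].

(* Borel measurability of f : R^d -> R (Borel sets of R^d = sigma-algebra
   generated by the coordinate projections) *)
Definition Rd_measurable (d : nat) (f : ('I_d -> R) -> R) : Prop :=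
  forall B : set R, measurable B -> smallest (sigma_algebra setT) (Rd_cyl (d:=d)) (f @^-1` B).

Definition leRd (d : nat) (x : 'I_d -> R) (t : 'I_d -> \bar R) : Prop :=
  forall j, ((x j)%:E <= t j)%E.

Definition cov {dT} {T : measurableType dT} (P : probability T R) (Y Z : T -> R) : R :=
  fine (\int[P]_w (Y w * Z w)%:E)%E
  - fine (\int[P]_w (Y w)%:E)%E * fine (\int[P]_w (Z w)%:E)%E.

(* ---------- normal law N(0, s^2) (s >= 0; s = 0 gives Dirac at 0) ---------- *)
Definition std_gauss_density (x : R) : R := expR (- (x ^+ 2) / 2) / Num.sqrt (2 * pi).

(* E h(s Z) with Z standard normal, i.e. integral of h against N(0, s^2) *)
Definition gauss_expect (s : R) (h : R -> R) : \bar R :=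
  (\int[lebesgue_measure]_x (h (s * x) * std_gauss_density x)%:E)%E.

Definition phiE (a : \bar R) : R :=
  match a with
  | r%:E => r / (1 + `|r|)
  | +oo%E => 1
  | -oo%E => -1
  end.
Definition rhoE (a b : \bar R) : R := `|phiE a - phiE b|.

Section Process.
Context {dT} {T : measurableType dT} (P : probability T R) (d : nat)
  (X : nat -> T -> 'I_d -> R).

Definition distF (t : 'I_d -> \bar R) : R :=
  fine (P [set w | leRd (X 0 w) t]).

Definition margF (j : 'I_d) (x : R) : R := fine (P [set w | X 0 w j <= x]).

(* strict stationarity: the finite-dimensional laws are shift invariant
   (stated on the generating rectangles of (R^d)^m) *)
Definition stationary : Prop :=
  forall (m k : nat) (B : nat -> 'I_d -> set R),
    (forall i j, measurable (B i j)) ->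
    P [set w | forall i, (i < m)%N -> forall j, B i j (X (i + k) w j)]
    = P [set w | forall i, (i < m)%N -> forall j, B i j (X i w j)].

Definition distF_continuous : Prop :=
  forall (t : 'I_d -> R) (e : R), 0 < e -> exists2 delta : R, 0 < delta &
    forall s : 'I_d -> R, (forall j, `|s j - t j| < delta) ->
      `|distF (fun j => (s j)%:E) - distF (fun j => (t j)%:E)| < e.

Definition Un (n : nat) (w : T) (t : 'I_d -> \bar R) : R :=
  (Num.sqrt n%:R)^-1 *
  \sum_(1 <= i < n.+1) ((\1_[set x | leRd x t] (X i w) : R) - distF t).

Definition function_space (G : set (('I_d -> R) -> R))
  (nG : (('I_d -> R) -> R) -> R) : Prop :=
  [/\ forall f, G f -> Rd_measurable f,
      forall c : R, G (fun _ => c),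
      forall f g, G f -> G g -> G (fun x => f x + g x),
      forall (a : R) f, G f -> G (fun x => a * f x) &
      [/\ forall f, G f -> 0 <= nG f,
          forall f g, G f -> G g -> nG (fun x => f x + g x) <= nG f + nG g &
          forall (a : R) f, G f -> nG (fun x => a * f x) = `|a| * nG f]].

Definition istar (i : nat -> nat) (j : nat) : nat := (\sum_(1 <= k < j.+1) i k)%N.

Definition multiple_mixing (G : set (('I_d -> R) -> R))
  (nG : (('I_d -> R) -> R) -> R) (Theta : nat -> R) (r : R) : Prop :=
  [/\ 1 <= r,
      (forall n, 0 <= Theta n),
      (forall m n, (m <= n)%N -> Theta n <= Theta m) &
      forall p : nat, (0 < p)%N -> exists K : R,
        forall f, G f -> (forall x, `|f x| <= 1) ->
          (\int[P]_w (f (X 0 w))%:E = 0)%E ->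
          forall (i : nat -> nat) (q : nat), (1 <= q <= p)%N ->
            (`|cov P (fun w => \prod_(0 <= j < q) f (X (istar i j) w))
                     (fun w => \prod_(q <= j < p.+1) f (X (istar i j) w))|%:E
             <= K%:E * Lnorm P r%:E (fun w => (f (X 0 w))%:E)
                     * (nG f * Theta (i q))%:E)%E].

Definition modulus (g : R -> R) (delta : \bar R) : R :=
  fine (ereal_sup [set e | exists t s : R,
          (`|t - s|%:E <= delta)%E /\ e = (`|g t - g s|)%:E]).

Definition control_function (G : set (('I_d -> R) -> R))
  (nG : (('I_d -> R) -> R) -> R) (Psi : R -> R) : Prop :=
  [/\ (forall z, 0 <= z -> 0 <= Psi z),
      (forall z1 z2, 0 <= z1 -> z1 <= z2 -> Psi z1 <= Psi z2) &
      forall a b : 'I_d -> \bar R, (forall j, (a j < b j)%E) ->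
        exists phi, [/\ G phi,
          (forall x, (\1_[set y | leRd y a] x : R) <= phi x),
          (forall x, phi x <= (\1_[set y | leRd y b] x : R)) &
          let m := \big[Order.min/1]_(j < d) modulus (margF j) (b j - a j)%E in
          0 < m -> nG phi <= Psi m^-1]].

End Process.

Section Skorokhod.
Variable d : nat.
Local Notation pt := ('I_d -> \bar R).

Definition quadrant (Rel : 'I_d -> bool) (t : pt) : set pt :=
  [set s | forall j, if Rel j then (t j <= s j)%E else (s j < t j)%E].

Definition quad_lim (x : pt -> R) (Rel : 'I_d -> bool) (t : pt) (l : R) : Prop :=
  forall e : R, 0 < e -> exists2 delta : R, 0 < delta &
    forall s, quadrant Rel t s -> (forall j, rhoE (s j) (t j) < delta) ->
      `|x s - l| < e.

Definition cadlag (x : pt -> R) : Prop :=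
  forall t : pt,
    (forall Rel, exists l, quad_lim x Rel t l) /\ quad_lim x (fun _ => true) t (x t).

Definition time_change (lam : 'I_d -> \bar R -> \bar R) : Prop :=
  forall j, (forall u v, (u < v)%E -> (lam j u < lam j v)%E) /\
            (forall v, exists u, lam j u = v).

Definition skod (x y : pt -> R) : \bar R :=
  ereal_inf [set e | exists lam, time_change lam /\
    e = maxe (ereal_sup [set c | exists j u, c = (rhoE (lam j u) u)%:E])
             (ereal_sup [set c | exists t : pt,
                 c = (`|x t - y (fun j => lam j (t j))|)%:E])].

Definition D_test_function (h : (pt -> R) -> R) : Prop :=
  (exists M : R, forall x, `|h x| <= M) /\
  forall x, cadlag x -> forall e : R, 0 < e -> exists2 delta : R, 0 < delta &
    forall y, cadlag y -> (skod x y < delta%:E)%E -> `|h y - h x| < e.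

End Skorokhod.

Definition path_continuous (d : nat) (x : ('I_d -> \bar R) -> R) : Prop :=
  forall t e, 0 < e -> exists2 delta : R, 0 < delta &
    forall s, (forall j, rhoE (s j) (t j) < delta) -> `|x s - x t| < e.

Definition centered_gaussian_process {dT} {T : measurableType dT}
  (Q : probability T R) (d : nat) (W : ('I_d -> \bar R) -> T -> R) : Prop :=
  (forall t, measurable_fun setT (W t)) /\
  forall (k : nat) (t : 'I_k -> ('I_d -> \bar R)) (a : 'I_k -> R),
    exists2 s : R, 0 <= s &
      forall A : set R, measurable A ->
        Q ((fun w => \sum_(j < k) a j * W (t j) w) @^-1` A)
        = gauss_expect s (\1_A).

End Defs.

(* Main.v *)
(* Moment bounds of order 2p, obtained from multiple mixing by always splitting at
   the largest gap, feed a chaining argument along dyadic partitions in the scale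
   of the marginal quantiles, with the bracketing functions of the control
   function in place of indicators.  It yields events of large probability,
   uniformly in n, on which U_n is bounded and equicontinuous across adjacent
   cells, up to an error 1 / sqrt n.  Together with the central limit theorem on G
   it also yields Gaussian limits for all linear combinations of values of U_n.

   The limit process is the ultralimit of the paths U_n(w_n) on the Loeb
   probability space of an ultraproduct of (T, P), which avoids Kolmogorov's
   extension theorem and Prokhorov's theorem.  On the equicontinuous paths, a
   continuous bounded functional is uniformly approximated by Bernstein
   polynomials in the variables (1 + sin (a x(t_i))) / 2, which are linear combinations of
   cosines of linear forms in the path, and for these the expectations converge. *)

Require Import Defs.
From HB Require Import structures.
From mathcomp Require Import all_boot all_order all_algebra.
From mathcomp Require Import all_classical all_reals all_analysis.
From mathcomp Require Import measurable_realfun.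
From mathcomp Require Import ring lra zify.
Import Order.TTheory GRing.Theory Num.Theory.
Import numFieldNormedType.Exports.
Set Implicit Arguments. Unset Strict Implicit. Unset Printing Implicit Defensive.
Local Open Scope classical_set_scope.
Local Open Scope ring_scope.

(** * Expectations of bounded functions *)

(** The mixing bound and the central limit theorem hold on G only, never for indicators. At
    generation k the approximants have G-seminorm of order a^k, with a = 2^(1/gamma). A difference
    of neighbouring approximants has mean absolute value of order 2^-k, hence L^r norm of order b^k
    with b = 2^(-1/r), and its 2p-th moment under the empirical process is of order (a b)^(k p).
    There are about 2^(k d) such differences. A union bound with thresholds x^k, x < 1, is summable
    when 2^d (a b)^p < x^(2 p); such an x exists because d + p (1/gamma - 1/r) < 0, which is the
    lower bound assumed on gamma. This form of the moment bound needs n (a b)^k >= 1, which 2^k <= n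
    ensures. Chaining therefore stops near log_2 n, and the remaining step to the indicator uses
    only monotonicity and the difference of means. The test functionals carry no measurability along
    the paths, so their integrals are compared through monotonicity alone. *)

Section Expectation.
Context {dT} {T : measurableType dT} {R : realType} (P : probability T R).
Implicit Types f g : T -> R.

(** Boundedness stands in for integrability: the variables handled with [Ex] are bounded, and on
    them [Ex] is a real-valued linear functional. *)
Definition bmeas f := measurable_fun setT f /\ exists M, forall w, `|f w| <= M.

Definition Ex f : R := fine (\int[P]_w (f w)%:E)%E.

Lemma bmeas_integrable f : bmeas f -> P.-integrable setT (EFin \o f).
Proof.
move=> [mf [M fM]]; apply: measurable_bounded_integrable => //.
  by apply: fin_num_fun_lty; exact: fin_num_measure.
by exists M; split; rewrite ?num_real// => x Mx w _ /=; exact: le_trans (ltW Mx).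
Qed.

Lemma ExE f : bmeas f -> (\int[P]_w (f w)%:E)%E = (Ex f)%:E.
Proof. by move=> bf; rewrite /Ex fineK// (integrable_fin_num _ (bmeas_integrable bf)). Qed.

Lemma bmeas_cst c : bmeas (fun=> c).
Proof. by split; [exact: measurable_cst|exists `|c|]. Qed.

Lemma bmeasD f g : bmeas f -> bmeas g -> bmeas (fun w => f w + g w).
Proof.
move=> [mf [M fM]] [mg [N gN]]; split; first exact: measurable_funD.
by exists (M + N) => w; rewrite (le_trans (ler_normD _ _))// lerD.
Qed.

Lemma bmeasM f g : bmeas f -> bmeas g -> bmeas (fun w => f w * g w).
Proof.
move=> [mf [M fM]] [mg [N gN]]; split; first exact: measurable_funM.
by exists (M * N) => w; rewrite normrM ler_pM.
Qed.

Lemma bmeasZ c f : bmeas f -> bmeas (fun w => c * f w).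
Proof. by move=> bf; apply: bmeasM => //; exact: bmeas_cst. Qed.

Lemma bmeasN f : bmeas f -> bmeas (fun w => - f w).
Proof.
by move=> [mf [M fM]]; split; [exact: measurableT_comp|exists M => w; rewrite normrN].
Qed.

Lemma bmeasB f g : bmeas f -> bmeas g -> bmeas (fun w => f w - g w).
Proof. by move=> bf bg; apply: bmeasD => //; exact: bmeasN. Qed.

Lemma bmeas_norm f : bmeas f -> bmeas (fun w => `|f w|).
Proof.
by move=> [mf [M fM]]; split; [exact: measurableT_comp|exists M => w; rewrite normr_id].
Qed.

Lemma bmeasX f n : bmeas f -> bmeas (fun w => f w ^+ n).
Proof.
move=> bf; elim: n => [|n IH].
  by under eq_fun do rewrite expr0; exact: bmeas_cst.
by under eq_fun do rewrite exprS; exact: bmeasM.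
Qed.

Lemma bmeas_sum (I : Type) (s : seq I) (Q : pred I) (F : I -> T -> R) :
  (forall i, Q i -> bmeas (F i)) -> bmeas (fun w => \sum_(i <- s | Q i) F i w).
Proof.
move=> bF; elim: s => [|i s IH].
  by under eq_fun do rewrite big_nil; exact: bmeas_cst.
under eq_fun do rewrite big_cons.
by case: (boolP (Q i)) => // Qi; apply: bmeasD => //; exact: bF.
Qed.

Lemma bmeas_prod (I : Type) (s : seq I) (Q : pred I) (F : I -> T -> R) :
  (forall i, Q i -> bmeas (F i)) -> bmeas (fun w => \prod_(i <- s | Q i) F i w).
Proof.
move=> bF; elim: s => [|i s IH].
  by under eq_fun do rewrite big_nil; exact: bmeas_cst.
under eq_fun do rewrite big_cons.
by case: (boolP (Q i)) => // Qi; apply: bmeasM => //; exact: bF.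
Qed.

Lemma bmeas_indic A : measurable A -> bmeas (\1_A).
Proof.
move=> mA; split; first exact: measurable_indic.
by exists 1 => w; rewrite indicE; case: (w \in A); rewrite ?normr1 ?normr0.
Qed.

Lemma Ex_cst c : Ex (fun=> c) = c.
Proof.
by rewrite /Ex integral_cst//= [X in (_ * X)%E](probability_setT P) mule1.
Qed.

Lemma ExD f g : bmeas f -> bmeas g -> Ex (fun w => f w + g w) = Ex f + Ex g.
Proof.
move=> bf bg; rewrite /Ex -fineD; first last.
- exact: integrable_fin_num (bmeas_integrable bg).
- exact: integrable_fin_num (bmeas_integrable bf).
congr fine; under eq_integral do rewrite EFinD.
by rewrite integralD//; exact: bmeas_integrable.
Qed.

Lemma ExZ c f : bmeas f -> Ex (fun w => c * f w) = c * Ex f.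
Proof.
move=> bf; rewrite /Ex; under eq_integral do rewrite EFinM.
rewrite integralZl//; last exact: bmeas_integrable.
by rewrite fineM// (integrable_fin_num _ (bmeas_integrable bf)).
Qed.

Lemma ExN f : bmeas f -> Ex (fun w => - f w) = - Ex f.
Proof.
move=> bf; rewrite -mulN1r -ExZ//; congr Ex.
by apply/funext => w; rewrite mulN1r.
Qed.

Lemma ExB f g : bmeas f -> bmeas g -> Ex (fun w => f w - g w) = Ex f - Ex g.
Proof. by move=> bf bg; rewrite ExD ?ExN//; exact: bmeasN. Qed.

Lemma Ex_sum (I : Type) (s : seq I) (Q : pred I) (F : I -> T -> R) :
  (forall i, bmeas (F i)) ->
  Ex (fun w => \sum_(i <- s | Q i) F i w) = \sum_(i <- s | Q i) Ex (F i).
Proof.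
move=> bF; elim: s => [|i s IH].
  by under eq_fun do rewrite big_nil; rewrite Ex_cst big_nil.
under eq_fun do rewrite big_cons; rewrite big_cons.
case: (boolP (Q i)) => // Qi; rewrite ExD ?IH//.
by apply: bmeas_sum => j _; exact: bF.
Qed.

Lemma Ex_ge0 f : (forall w, 0 <= f w) -> 0 <= Ex f.
Proof.
by move=> f0; rewrite /Ex fine_ge0// integral_ge0// => w _; rewrite lee_fin.
Qed.

Lemma le_Ex f g : bmeas f -> bmeas g -> (forall w, f w <= g w) -> Ex f <= Ex g.
Proof.
move=> bf bg fg; rewrite -subr_ge0 -ExB//; apply: Ex_ge0 => w.
by rewrite subr_ge0.
Qed.

Lemma le_norm_Ex f : bmeas f -> `|Ex f| <= Ex (fun w => `|f w|).
Proof.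
move=> bf; have bn := bmeas_norm bf.
rewrite ler_norml -ExN//; apply/andP; split.
  apply: le_Ex => //; first exact: bmeasN.
  by move=> w; rewrite lerNl -normrN ler_norm.
by apply: le_Ex => // w; exact: ler_norm.
Qed.

Lemma Ex_le_cst f c : bmeas f -> (forall w, f w <= c) -> Ex f <= c.
Proof. by move=> bf fc; rewrite -[leRHS]Ex_cst; apply: le_Ex => //; exact: bmeas_cst. Qed.

Lemma norm_Ex_le f c : bmeas f -> (forall w, `|f w| <= c) -> `|Ex f| <= c.
Proof.
move=> bf fc; apply: (le_trans (le_norm_Ex bf)).
by apply: Ex_le_cst => //; exact: bmeas_norm.
Qed.

Lemma Ex_indic A : measurable A -> Ex (\1_A) = fine (P A).
Proof. by move=> mA; rewrite /Ex integral_indic// setIT. Qed.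

Lemma Ex_dominated (f_ : nat -> T -> R) f M :
  (forall n, measurable_fun setT (f_ n)) -> (forall n w, `|f_ n w| <= M) ->
  (forall w, f_ n w @[n --> \oo] --> f w) -> bmeas f /\ Ex (f_ n) @[n --> \oo] --> Ex f.
Proof.
move=> mf fM ff.
have mflim : measurable_fun setT f by apply: (measurable_fun_cvg mf) => w _; exact: ff.
have fM' w : `|f w| <= M.
  have cn : `|f_ n w| @[n --> \oo] --> `|f w| by apply: cvg_norm; exact: ff.
  rewrite -(cvg_lim _ cn)//; apply: limr_le; last by near=> n; exact: fM.
  by apply/cvg_ex; exists `|f w|.
have bf : bmeas f by split => //; exists M.
have bfn n : bmeas (f_ n) by split => //; exists M.
split=> //.
have K : (\int[P]_w (f_ n w)%:E)%E @[n --> \oo] --> (Ex f)%:E.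
  rewrite -ExE//; apply: (@dominated_cvg _ _ _ P setT measurableT _ _ (fun=> M%:E)) => //.
  - by move=> n; exact/measurable_EFinP.
  - by move=> w _; apply: cvg_EFin; [exact: nearW|exact: ff].
  - exact: bmeas_integrable (bmeas_cst M).
  - by move=> n w _; rewrite lee_fin.
exact: (fine_cvg K).
Unshelve. all: by end_near. Qed.

Lemma Ex_markov f c : bmeas f -> (forall w, 0 <= f w) -> 0 < c ->
  fine (P [set w | c <= f w]) <= Ex f / c.
Proof.
move=> bf f0 c0.
have mA : measurable [set w | c <= f w].
  rewrite -[X in measurable X]setTI; apply: (measurable_fun_le _ _) => //.
  exact: bf.1.
rewrite ler_pdivlMr// -Ex_indic// mulrC -ExZ; last exact: bmeas_indic.
apply: le_Ex => //; first by apply: bmeasZ; exact: bmeas_indic.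
move=> w; rewrite indicE; case: (boolP (w \in _)) => [|_].
  by rewrite inE mulr1.
by rewrite mulr0.
Qed.

End Expectation.

Section Law.
Context {dT dT'} {T : measurableType dT} {T' : measurableType dT'} {R : realType}.
Variables (P : probability T R) (f : T -> T').
Hypothesis mf : measurable_fun setT f.

Definition law : probability T' R := distribution P
  (MeasurableFun.Pack (MeasurableFun.Class (isMeasurableFun.Build _ _ _ _ _ mf))).

Lemma lawE A : law A = P (f @^-1` A).
Proof. by []. Qed.

Lemma bmeas_comp (g : T' -> R) : bmeas g -> bmeas (fun w => g (f w)).
Proof.
by move=> [mg [M gM]]; split; [exact: measurableT_comp mg mf|exists M].
Qed.

Lemma Ex_law (g : T' -> R) : bmeas g -> Ex law g = Ex P (fun w => g (f w)).
Proof.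
move=> bg; rewrite /Ex integral_distribution//.
- by apply/measurable_EFinP; exact: bg.1.
- exact: bmeas_integrable (bmeas_comp bg).
Qed.

End Law.

Lemma Ex_eq_measure {dT} {T : measurableType dT} {R : realType} (P Q : probability T R)
    (G : set (set T)) (g : T -> R) :
  measurable = <<s G >> -> setI_closed G -> G setT ->
  (forall A, G A -> P A = Q A) -> Ex P g = Ex Q g.
Proof.
move=> mG GI GT PQ; rewrite /Ex; congr fine; apply: eq_measure_integral => A mA _.
apply: (@measure_unique _ R T G (fun=> setT)) => //.
- by rewrite bigcup_const//; exists 0%N.
- by move=> _; rewrite (le_lt_trans (probability_le1 P measurableT))// ltry.
Qed.

Section Prob.
Context {dT} {T : measurableType dT} {R : realType} (P : probability T R).

Definition prob (A : set T) : R := fine (P A).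

Lemma prob_itv A : measurable A -> 0 <= prob A <= 1.
Proof.
move=> mA; rewrite /prob -Ex_indic//; apply/andP; split.
  by apply: Ex_ge0 => w; rewrite indicE.
apply: Ex_le_cst; first exact: bmeas_indic.
by move=> w; rewrite indicE; case: (w \in A).
Qed.

Lemma probE A : measurable A -> P A = (prob A)%:E.
Proof. by move=> mA; rewrite fineK// fin_num_measure. Qed.

Lemma prob_Ex A : measurable A -> prob A = Ex P (\1_A).
Proof. by move=> mA; rewrite Ex_indic. Qed.

Lemma le_prob A B : measurable A -> measurable B -> A `<=` B -> prob A <= prob B.
Proof.
move=> mA mB AB; rewrite !prob_Ex//; apply: le_Ex; try exact: bmeas_indic.
move=> w; rewrite !indicE; case: (boolP (w \in A)) => //; rewrite !inE => /AB Bw.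
by rewrite mem_set.
Qed.

Lemma probC A : measurable A -> prob (~` A) = 1 - prob A.
Proof.
move=> mA; rewrite !prob_Ex//; last exact: measurableC.
rewrite -[X in X - _](Ex_cst P 1) -ExB; [|exact: bmeas_cst|exact: bmeas_indic].
congr Ex; apply/funext => w; rewrite !indicE in_setC.
by case: (w \in A); rewrite ?subrr ?subr0.
Qed.

Lemma probU_le A B : measurable A -> measurable B -> prob (A `|` B) <= prob A + prob B.
Proof.
move=> mA mB; rewrite !prob_Ex//; last exact: measurableU.
rewrite -ExD; try exact: bmeas_indic.
apply: le_Ex; [|apply: bmeasD|]; try by apply: bmeas_indic => //; exact: measurableU.
move=> w; rewrite !indicE in_setU; case: (w \in A); case: (w \in B) => /=;
  by rewrite ?addr0 ?add0r ?lerDl.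
Qed.

Lemma prob_bigsetU_le (I : Type) (s : seq I) (A : I -> set T) :
  (forall i, measurable (A i)) ->
  prob (\big[setU/set0]_(i <- s) A i) <= \sum_(i <- s) prob (A i).
Proof.
move=> mA; elim: s => [|i s IH]; first by rewrite !big_nil /prob measure0.
rewrite !big_cons (le_trans (probU_le _ _))// ?lerD2l//.
exact: bigsetU_measurable.
Qed.

(** Dominated convergence of the indicators gives continuity from below, stated as smallness of the
    complements. *)
Lemma prob_exhaust (A : nat -> set T) : (forall n, measurable (A n)) ->
  (forall n, A n `<=` A n.+1) -> (forall w, exists n, A n w) ->
  forall e, 0 < e -> exists n, prob (~` A n) < e.
Proof.
move=> mA ndA exA e e0.
have monoA n m : (n <= m)%N -> A n `<=` A m.
  by move=> /subnK <-; elim: (m - n)%N => // k IH w /IH; rewrite addSn => /ndA.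
have [_ cv] : bmeas ((fun=> 1) : T -> R) /\ Ex P (\1_(A n)) @[n --> \oo] --> Ex P (fun=> 1).
  apply: (@Ex_dominated _ _ _ P _ _ 1).
  - by move=> n; exact: measurable_indic.
  - by move=> n w; rewrite indicE; case: (w \in A n); rewrite ?normr1 ?normr0.
  - move=> w; have [n An] := exA w; apply: cvg_near_cst; near=> m.
    rewrite indicE mem_set//; apply: (monoA n) => //.
    by near: m; exact: nbhs_infty_ge.
rewrite Ex_cst in cv.
have e1 : 1 - e < 1 by lra.
have [n _ /(_ n (leqnn n)) /=] := cvgr_gt _ cv _ e1.
rewrite -prob_Ex// => h; exists n; rewrite probC//; lra.
Unshelve. all: by end_near. Qed.

End Prob.

(** * Loeb measure *)

Section Ultralimit.
Context {R : realType} (V : set_system nat) {UV : UltraFilter V}.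

Definition ulim (u : nat -> R) : R := lim (u n @[n --> V]).

Lemma ultraC A : ~ V A -> V (~` A).
Proof. by move=> nA; have [] := in_ultra_setVsetC A UV. Qed.

Lemma ultra_false A B : V A -> V B -> A `&` B = set0 -> False.
Proof.
move=> VA VB AB; have : V (A `&` B) by exact: filterI.
by rewrite AB => /filter_not_empty.
Qed.

Lemma ulimE (u : nat -> R) l : u n @[n --> V] --> l -> ulim u = l.
Proof. by move=> ul; exact: (cvg_lim _ ul). Qed.

(** The image of an ultrafilter is an ultrafilter, and an ultrafilter on a compact interval
    converges. *)
Lemma ulim_cvg (u : nat -> R) M : V [set n | `|u n| <= M] -> u n @[n --> V] --> ulim u.
Proof.
move=> uM.
have U' : UltraFilter (u n @[n --> V]).
  have PF : ProperFilter (u n @[n --> V]) by exact: fmap_proper_filter.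
  split=> // G PG FG; rewrite eqEsubset; split=> // A GA.
  have [//|VnA] := in_ultra_setVsetC (u @^-1` A) UV.
  have GnA : G (~` A) by apply: FG.
  have : G (A `&` ~` A) by exact: filterI.
  by rewrite setICr => /filter_not_empty.
have := @segment_compact R (- M) M; rewrite compact_ultra => /(_ _ U') [|l [_ ul]].
  rewrite /fmap /=; apply: filterS uM => n /=.
  by rewrite ler_norml in_itv.
by rewrite (ulimE ul).
Qed.

Lemma ulim_near (u v : nat -> R) : V [set n | u n = v n] -> ulim u = ulim v.
Proof.
move=> uv; congr lim; rewrite eqEsubset; split=> A; rewrite /fmap /= => VA.
  by apply: filterS (filterI uv VA) => n [/= ->].
by apply: filterS (filterI uv VA) => n [/= <-].
Qed.

Lemma ulim_ge (u : nat -> R) l c :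
  u n @[n --> V] --> l -> V [set n | c <= u n] -> c <= l.
Proof. by move=> ul h; exact: (@closed_cvg _ R V _ u (fun x => c <= x) (@closed_ge R c) h l ul). Qed.

Lemma ulim_le (u : nat -> R) l c :
  u n @[n --> V] --> l -> V [set n | u n <= c] -> l <= c.
Proof. by move=> ul h; exact: (@closed_cvg _ R V _ u (fun x => x <= c) (@closed_le R c) h l ul). Qed.

End Ultralimit.

(** Sequences that agree on a set of [V] are not identified: internal sets do not separate them. The
    argument [UV] is a phantom that lets the algebra of sets attached to this type depend on the
    ultrafilter. *)
Definition loeb (dT : measure_display) (T : measurableType dT) (V : set_system nat)
  (UV : UltraFilter V) : Type := nat -> T.

Section LoebAlgebra.
Context {dT} {T : measurableType dT} (V : set_system nat) (UV : UltraFilter V).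
Local Notation L := (loeb T UV).

HB.instance Definition _ := gen_eqMixin L.
HB.instance Definition _ := gen_choiceMixin L.
HB.instance Definition _ := isPointed.Build L (fun=> point).

Definition internal (A : nat -> set T) : set L := [set w | V [set n | A n (w n)]].

Definition loeb_alg : set (set L) :=
  [set S | exists A, (forall n, measurable (A n)) /\ S = internal A].

Lemma internal0 : internal (fun=> set0) = set0.
Proof. by rewrite -subset0 => w /=; rewrite /internal/= => /filter_not_empty. Qed.

Lemma internalU A B : internal A `|` internal B = internal (fun n => A n `|` B n).
Proof.
rewrite eqEsubset; split=> w.
  by case; rewrite /internal /=; apply: filterS => n /=; [left|right].
move=> /= VAB; apply: contrapT => /not_orP [nA nB].
apply: (ultra_false (V := V) (A := [set n | (A n `|` B n) (w n)])
  (B := [set n | ~ A n (w n)] `&` [set n | ~ B n (w n)])) => //.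
- by apply: filterI; exact: ultraC.
- by rewrite -subset0 => n [/= [|] h []].
Qed.

Lemma internalC A : ~` internal A = internal (fun n => ~` A n).
Proof.
rewrite eqEsubset; split=> w.
  by move=> nA; exact: ultraC nA.
move=> /= VnA VA; apply: (ultra_false VA VnA).
by rewrite -subset0 => n [].
Qed.

Lemma internalI A B : internal A `&` internal B = internal (fun n => A n `&` B n).
Proof.
rewrite eqEsubset; split=> w; first by case=> VA VB; exact: filterI VA VB.
by move=> h; split; apply: filterS h => n [].
Qed.

(** Choosing in each factor a point of [A n] outside [B n], where there is one, yields a single
    sequence that refutes the inclusion if it fails on a set of [V]. *)
Lemma internalS A B : internal A `<=` internal B ->
  V [set n | A n `<=` B n].
Proof.
move=> AB; apply: contrapT => /ultraC VAB.
have ch n : exists x, ~ A n `<=` B n -> A n x /\ ~ B n x.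
  have [h|/existsNP[x /not_implyP[Ax Bx]]] := pselect (A n `<=` B n).
    by exists point.
  by exists x.
have [w wP] := choice ch.
have /AB VB : internal A w by apply: filterS VAB => n /= /wP[].
apply: (ultra_false VB VAB); rewrite -subset0 => n [/= Bw].
by move=> /wP[].
Qed.

Lemma internal_inj A B : internal A = internal B -> V [set n | A n = B n].
Proof.
move=> AB.
have AB1 : V [set n | A n `<=` B n] by apply: internalS => //; rewrite AB.
have AB2 : V [set n | B n `<=` A n] by apply: internalS => //; rewrite AB.
by apply: filterS (filterI AB1 AB2) => n [/= ? ?]; rewrite eqEsubset.
Qed.

Lemma loeb_alg0 : loeb_alg set0.
Proof. by exists (fun=> set0); split=> //; rewrite internal0. Qed.

Lemma loeb_algU : setU_closed loeb_alg.
Proof.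
move=> _ _ [A [mA ->]] [B [mB ->]]; exists (fun n => A n `|` B n); split.
  by move=> n; exact: measurableU.
by rewrite internalU.
Qed.

Lemma loeb_algC : setC_closed loeb_alg.
Proof.
move=> _ [A [mA ->]]; exists (fun n => ~` A n); split.
  by move=> n; exact: measurableC.
by rewrite internalC.
Qed.

HB.instance Definition _ := isAlgebraOfSets.Build dT L
  loeb_alg0 loeb_algU loeb_algC.

(* Countable saturation: it makes the finitely additive Loeb content sigma-additive. *)
Lemma internal_saturated (D : nat -> set L) :
  \oo `<=` V -> (forall k, loeb_alg (D k)) ->
  (forall k, D k.+1 `<=` D k) -> (forall k, D k !=set0) -> \bigcap_k D k !=set0.
Proof.
move=> oV mD ndD D0.
have [B BP] := choice mD.
pose B' k n := \bigcap_(i in [set i | (i <= k)%N]) B i n.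
have B'0 k : V [set n | B' k n !=set0].
  have [w Dw] := D0 k.
  have Dik i : (i <= k)%N -> D i w.
    move=> ik; rewrite -(subnK ik) in Dw; move: (k - i)%N Dw => j.
    by elim: j => // j IH; rewrite addSn => /ndD/IH.
  have : V [set n | forall i, (i <= k)%N -> B i n (w n)].
    elim: k Dik {Dw} => [|k IH] Dik.
      have := Dik 0%N (leqnn _); rewrite (BP 0%N).2; apply: filterS => n /= h i.
      by rewrite leqn0 => /eqP ->.
    have h1 := IH (fun i ik => Dik i (leqW ik)).
    have := Dik k.+1 (leqnn _); rewrite (BP k.+1).2 => h2.
    apply: filterS (filterI h1 h2) => n [/= g1 g2] i.
    by rewrite leq_eqVlt => /predU1P[->//|]; rewrite ltnS; exact: g1.
  by apply: filterS => n /= h; exists (w n) => i /=; exact: h.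
(* Diagonal choice: the [n]-th coordinate is taken in the deepest nonempty set [B' k n] with
   [k <= n]. For fixed [k], both [k <= n] and nonemptiness hold on a set of [V]. *)
have ch n : exists x, forall k, (k <= n)%N -> B' k n !=set0 -> B' k n x.
  suff h j : exists x, forall k, (k <= j)%N -> B' k n !=set0 -> B' k n x by exact: h.
  elim: j => [|j [x IH]].
    have [[x Bx]|h] := pselect (B' 0%N n !=set0); last first.
      by exists point => k; rewrite leqn0 => /eqP -> /h.
    by exists x => k; rewrite leqn0 => /eqP -> _.
  have [[y By]|h] := pselect (B' j.+1 n !=set0); last first.
    by exists x => k; rewrite leq_eqVlt => /predU1P[-> /h//|]; rewrite ltnS; exact: IH.
  exists y => k kj _ i /= ik; apply: By => /=.
  exact: leq_trans kj.
have [w wP] := choice ch.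
exists w => k _; rewrite (BP k).2.
have kV : V [set n | (k <= n)%N] by apply: oV; exact: nbhs_infty_ge.
apply: filterS (filterI (B'0 k) kV) => n [/= Bn kn].
exact: (wP n k kn Bn k (leqnn k)).
Qed.

End LoebAlgebra.

Section LoebMeasure.
Context {dT} {T : measurableType dT} {R : realType} (P : probability T R).
Context (V : set_system nat) (UV : UltraFilter V) (oV : \oo `<=` V).
Local Notation L := (loeb T UV).

Definition loeb_rep (S : set L) : nat -> set T :=
  xget (fun=> set0) [set A | (forall n, measurable (A n)) /\ S = internal A].

Lemma loeb_repP S : loeb_alg S ->
  (forall n, measurable (loeb_rep S n)) /\ S = internal (loeb_rep S).
Proof.
move=> [A AP].
exact: (@xgetPex _ (fun=> set0) [set A | (forall n, measurable (A n)) /\ S = internal A]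
  (ex_intro _ A AP)).
Qed.

Definition loeb_content (S : set L) : \bar R :=
  (ulim V (fun n => prob P (loeb_rep S n)))%:E.

Lemma prob_ulim_cvg (A : nat -> set T) : (forall n, measurable (A n)) ->
  prob P (A n) @[n --> V] --> ulim V (fun n => prob P (A n)).
Proof.
move=> mA; apply: (ulim_cvg (M := 1)); apply: filterS (@filterT _ V _) => n _ /=.
by have /andP[p0 p1] := prob_itv P (mA n); rewrite ger0_norm.
Qed.

(** Two presentations of the same internal set agree on a set of [V], so the choice made by
    [loeb_rep] is immaterial. *)
Lemma loeb_contentE (A : nat -> set T) :
  (forall n, measurable (A n)) -> loeb_content (internal A) = (ulim V (fun n => prob P (A n)))%:E.
Proof.
move=> mA; have [] := @loeb_repP (internal A); first by exists A.
move=> mB AB; congr (_%:E); apply: ulim_near.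
by apply: filterS (internal_inj AB) => n /= ->.
Qed.

Lemma loeb_content0 : loeb_content set0 = 0%E.
Proof.
rewrite -internal0 loeb_contentE//; congr (_%:E).
by apply: ulimE; rewrite /prob measure0; exact: cvg_cst.
Qed.

Lemma loeb_content_ge0 S : (0 <= loeb_content S)%E.
Proof.
rewrite /loeb_content lee_fin.
have [mS|nS] := pselect (loeb_alg S).
  have [mB SB] := loeb_repP mS.
  apply: ulim_ge (prob_ulim_cvg mB) _; apply: filterS (@filterT _ V _) => n _ /=.
  by have /andP[] := prob_itv P (mB n).
rewrite /loeb_rep xgetPN; last first.
  by move=> A AP; apply: nS; exists A.
by rewrite (@ulimE _ _ _ _ 0)// /prob measure0; exact: cvg_cst.
Qed.

Lemma loeb_content_additive (A B : set L) : loeb_alg A -> loeb_alg B ->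
  A `&` B = set0 -> loeb_content (A `|` B) = (loeb_content A + loeb_content B)%E.
Proof.
move=> [a [ma ->]] [b [mb ->]] ab; rewrite internalU !loeb_contentE//; last first.
  by move=> n; exact: measurableU.
rewrite -EFinD; congr (_%:E); apply: ulimE.
have ab0 : V [set n | a n `&` b n = set0].
  by apply: internal_inj; rewrite -internalI ab internal0.
have Vcvg : prob P (a n) + prob P (b n) @[n --> V] -->
    ulim V (fun n => prob P (a n)) + ulim V (fun n => prob P (b n)).
  by apply: cvgD; exact: prob_ulim_cvg.
apply: cvg_trans Vcvg; apply: near_eq_cvg.
apply: filterS ab0 => n /= abn.
by rewrite /prob -fineD ?fin_num_measure// measureU.
Qed.

(** By saturation, a countable union of internal sets that is itself internal is already a finite
    union, so finite additivity is enough. *)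
Lemma loeb_content_sigma_additive : semi_sigma_additive loeb_content.
Proof.
move=> F mF tF mUF.
have mU k : loeb_alg (\big[setU/set0]_(i < k) F i).
  elim: k => [|k IH]; first by rewrite big_ord0; exact: loeb_alg0.
  by rewrite big_ord_recr/=; apply: loeb_algU => //; exact: mF.
have addk k : loeb_content (\big[setU/set0]_(i < k) F i) = (\sum_(0 <= i < k) loeb_content (F i))%E.
  elim: k => [|k IH]; first by rewrite big_ord0 big_geq// loeb_content0.
  rewrite big_ord_recr big_nat_recr//= loeb_content_additive ?IH//; [exact: mU|exact: mF|].
  rewrite -bigcup_mkord setI_bigcupl bigcup0// => i /= ik.
  move/trivIsetP : tF => /(_ i k Logic.I Logic.I); apply.
  by rewrite neq_ltn ik.
have [N UN] : exists N, \bigcup_i F i = \big[setU/set0]_(i < N) F i.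
  apply: contrapT => /forallNP nN.
  have [||k|w Dw] := @internal_saturated _ _ _ UV
      (fun k => (\bigcup_i F i) `&` ~` (\big[setU/set0]_(i < k) F i)) oV.
  - move=> k; rewrite -[X in X `&` _]setCK -setCU; apply: loeb_algC.
    by apply: loeb_algU => //; exact: loeb_algC.
  - by move=> k w [Fw nFw]; split=> // h; apply: nFw; rewrite big_ord_recr/=; left.
  - apply: contrapT => /set0P/negP/negPn/eqP h; apply: (nN k).
    rewrite eqEsubset; split; last first.
      by rewrite -bigcup_mkord => w [i _ Fi]; exists i.
    move=> w Fw; apply: contrapT => nw.
    by have : set0 w by rewrite -h.
  - have [[i _ Fi] _] := Dw 0%N Logic.I.
    have [_] := Dw i.+1 Logic.I; apply.
    by rewrite big_ord_recr/=; right.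
apply: cvg_near_cst; near=> k.
have Nk : (N <= k)%N by near: k; exact: nbhs_infty_ge.
rewrite /= -addk UN; congr loeb_content; rewrite eqEsubset; split.
  rewrite -UN -bigcup_mkord => w [i _ Fi]; by exists i.
rewrite -!bigcup_mkord => w [i /= iN Fi]; exists i => //=.
exact: leq_trans Nk.
Unshelve. all: by end_near. Qed.

HB.instance Definition _ := isMeasure.Build dT L R loeb_content
  loeb_content0 loeb_content_ge0 loeb_content_sigma_additive.

Definition loebT := g_sigma_algebraType (@measurable _ L).
HB.instance Definition _ := Measurable.on loebT.

Definition loeb_measure : set loebT -> \bar R := measure_extension loeb_content.
HB.instance Definition _ := Measure.on loeb_measure.

Lemma loeb_measure_internal (A : nat -> set T) : (forall n, measurable (A n)) ->
  loeb_measure (internal (UV := UV) A) = (ulim V (fun n => prob P (A n)))%:E.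
Proof.
move=> mA; rewrite /loeb_measure /measure_extension measurable_mu_extE/=.
  exact: loeb_contentE.
by exists A.
Qed.

Lemma measurable_internal (A : nat -> set T) : (forall n, measurable (A n)) ->
  measurable (internal (UV := UV) A : set loebT).
Proof. by move=> mA; apply: sub_sigma_algebra; exists A. Qed.

Lemma loeb_measure_setT : loeb_measure setT = 1%E.
Proof.
have -> : setT = internal (UV := UV) (fun=> setT) :> set L.
  by rewrite eqEsubset; split=> // w _; rewrite /internal/=; exact: filterT.
rewrite loeb_measure_internal//; congr (_%:E); apply: ulimE.
by rewrite /prob (probability_setT P); exact: cvg_cst.
Qed.

HB.instance Definition _ := Measure_isProbability.Build _ _ _ loeb_measure loeb_measure_setT.

End LoebMeasure.

Section LoebIntegral.
Context {dT} {T : measurableType dT} {R : realType} (P : probability T R).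
Context (V : set_system nat) (UV : UltraFilter V) (oV : \oo `<=` V).
Local Notation L := (@loebT _ T V UV).

Definition loeb_prob : probability L R := loeb_measure P oV.
Local Notation Q := loeb_prob.

(** The standard part of the internal function with components [f n]. *)
Definition st (f : nat -> T -> R) (w : L) : R := ulim V (fun n => f n (w n)).

Section Bounded.
Variables (f : nat -> T -> R) (M : R).
Hypotheses (mf : forall n, measurable_fun setT (f n)) (fM : forall n w, `|f n w| <= M).

Lemma st_cvg w : f n (w n) @[n --> V] --> st f w.
Proof. by apply: (ulim_cvg (M := M)); apply: filterS (@filterT _ V _) => n _ /=. Qed.

Lemma st_bound w : `|st f w| <= M.
Proof.
rewrite ler_norml; apply/andP; split.
  apply: (ulim_ge (@st_cvg w)); apply: filterS (@filterT _ V _) => n _ /=.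
  by have := fM n (w n); rewrite ler_norml => /andP[].
apply: (ulim_le (@st_cvg w)); apply: filterS (@filterT _ V _) => n _ /=.
by have := fM n (w n); rewrite ler_norml => /andP[].
Qed.

(** The set where [st f] is at least [c] is the countable intersection of the internal sets where
    [f n] is at least c - 1/(k+1). *)
Lemma st_measurable : measurable_fun setT (st f).
Proof.
apply: (measurability _ (RGenCInfty.measurableE R)) => //.
move=> /= _ [_ [c ->] <-]; rewrite setTI.
have -> : st f @^-1` `[c, +oo[%classic =
   \bigcap_k internal (UV := UV) (fun n => [set w | c - k.+1%:R^-1 <= f n w]).
  rewrite eqEsubset; split => w /=; rewrite in_itv/= andbT.
    move=> cw k _; have : c - k.+1%:R^-1 < st f w.
      by apply: lt_le_trans cw; rewrite ltrBlDr ltrDl invr_gt0.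
    by move=> ck; apply: filterS (cvgr_gt _ (@st_cvg w) _ ck) => n /ltW.
  move=> h; apply/ler_addgt0Pr => e e0; rewrite -lerBlDr.
  have [k ke] : exists k : nat, k.+1%:R^-1 < e.
    exists (Num.truncn e^-1).+1; rewrite invf_plt ?posrE//.
    by rewrite (lt_trans (truncnS_gt _))// ltr_nat.
  apply: (ulim_ge (@st_cvg w)); apply: filterS (h k Logic.I) => n /= cf.
  by apply: le_trans cf; rewrite lerB// ltW.
apply: bigcapT_measurable => k; apply: measurable_internal => n.
rewrite -[X in measurable X]setTI.
by apply: measurable_fun_le.
Qed.

Lemma st_bmeas : bmeas (st f).
Proof. by split; [exact: st_measurable|exists M => w; exact: st_bound]. Qed.

End Bounded.

Lemma Ex_ulim_cvg (f : nat -> T -> R) M :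
  (forall n, measurable_fun setT (f n)) -> (forall n w, `|f n w| <= M) ->
  Ex P (f n) @[n --> V] --> ulim V (fun n => Ex P (f n)).
Proof.
move=> mf fM; apply: (ulim_cvg (M := M)); apply: filterS (@filterT _ V _) => n _ /=.
by apply: norm_Ex_le => //; split=> //; exists M.
Qed.

Lemma sum_leq_count m N : (m <= N)%N -> \sum_(1 <= k < N.+1) (k <= m)%N%:R = m%:R :> R.
Proof.
move=> mN; rewrite -[in RHS](minn_idPl mN) {mN}; elim: N => [|N IH].
  by rewrite big_geq// minn0.
rewrite big_nat_recr//= IH -natrD; congr (_%:R).
by case: (leqP N.+1 m) => h; rewrite /= ?addn0 ?addn1 /minn; do 2 case: ltnP => //; lia.
Qed.

(** A discrete layer-cake formula: a number in [0, 1] is, up to 1/N, an average of N indicators of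
    threshold events. It reduces expectations on the Loeb space to probabilities of internal
    sets. *)
Lemma quantize (x : R) N : (0 < N)%N -> 0 <= x <= 1 ->
  `|x - N%:R^-1 * \sum_(1 <= k < N.+1) (k%:R <= x * N%:R)%R%:R| <= N%:R^-1.
Proof.
move=> N0 /andP[x0 x1].
have N0' : 0 < N%:R :> R by rewrite ltr0n.
have xN0 : 0 <= x * N%:R by rewrite mulr_ge0// ltW.
have mN : (Num.truncn (x * N%:R) <= N)%N.
  by rewrite -(ler_nat R) (@le_trans _ _ (x * N%:R))// ?truncn_le// ler_piMl// ltW.
rewrite (eq_bigr (fun k : nat => (k <= Num.truncn (x * N%:R)%R)%N%:R)); last first.
  by move=> k _; rewrite truncn_ge_nat.
rewrite sum_leq_count//.
have /andP[h1 h2] := truncn_itv xN0.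
have -> : x - N%:R^-1 * (Num.truncn (x * N%:R))%:R =
    N%:R^-1 * (x * N%:R - (Num.truncn (x * N%:R))%:R).
  by rewrite mulrBr mulrCA mulVf ?mulr1// gt_eqF.
rewrite normrM ger0_norm ?invr_ge0 ?ler0n// ler_piMr ?invr_ge0 ?ler0n//.
rewrite ger0_norm ?subr_ge0// lerBlDl; apply/ltW.
by rewrite -natr1 in h2.
Qed.

Lemma Ex_st01 (f : nat -> T -> R) :
  (forall n, measurable_fun setT (f n)) -> (forall n w, 0 <= f n w <= 1) ->
  Ex Q (st f) = ulim V (fun n => Ex P (f n)).
Proof.
move=> mf f01.
have fM n w : `|f n w| <= 1 by have /andP[? ?] := f01 n w; rewrite ger0_norm.
apply/eqP; rewrite -subr_eq0 -normr_le0; apply/ler_addgt0Pl => e e0; rewrite addr0.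
have [N N0 Ne] : exists2 N, (0 < N)%N & N%:R^-1 <= e / 2 :> R.
  exists (Num.truncn (e / 2)^-1).+1 => //; rewrite invf_ple ?posrE// ?divr_gt0//.
  by apply/ltW/truncnS_gt.
pose A k n := [set w | k%:R <= f n w * N%:R].
have mA k n : measurable (A k n).
  rewrite -[X in measurable X]setTI; apply: measurable_fun_le => //.
  exact: measurable_funM.
pose g n w : R := N%:R^-1 * \sum_(1 <= k < N.+1) \1_(A k n) w.
pose h (w : L) : R := N%:R^-1 * \sum_(1 <= k < N.+1) \1_(internal (UV := UV) (A k)) w.
have gE n w : g n w = N%:R^-1 * \sum_(1 <= k < N.+1) (k%:R <= f n w * N%:R)%R%:R.
  by congr (_ * _); apply: eq_bigr => k _; rewrite indicE /A mem_setE.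
have fg n w : `|f n w - g n w| <= N%:R^-1 by rewrite gE; exact: quantize.
have mI k : measurable (internal (UV := UV) (A k) : set L).
  exact: measurable_internal.
have bh : bmeas h by apply: bmeasZ; apply: bmeas_sum => k _; exact: bmeas_indic.
have bg n : bmeas (g n) by apply: bmeasZ; apply: bmeas_sum => k _; exact: bmeas_indic.
(* Only finitely many events enter, and membership in each internal set is decided on a set of [V];
   hence the discretised functions agree exactly, not just in the limit. *)
have gh w : V [set n | g n (w n) = h w].
  have : V [set n | forall k, (k < N.+1)%N -> \1_(A k n) (w n) = \1_(internal (UV := UV) (A k)) w :> R].
    elim: N.+1 => [|K IH]; first by apply: filterS (@filterT _ V _).
    have hK : V [set n | \1_(A K n) (w n) = \1_(internal (UV := UV) (A K)) w :> R].
      have [iw|iw] := pselect (internal (UV := UV) (A K) w).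
        apply: filterS (iw) => n /= Aw.
        by rewrite !indicE !mem_set.
      apply: filterS (ultraC iw) => n /= Aw.
      by rewrite !indicE !memNset.
    apply: filterS (filterI IH hK) => n [/= h1 h2] k.
    by rewrite ltnS leq_eqVlt => /predU1P[->//|]; exact: h1.
  apply: filterS => n /= H; congr (_ * _).
  by apply: eq_big_nat => k /andP[_ kN]; exact: H.
have sth w : `|st f w - h w| <= N%:R^-1.
  have c : `|f n (w n) - h w| @[n --> V] --> `|st f w - h w|.
    by apply: cvg_norm; apply: cvgB; [exact: st_cvg|exact: cvg_cst].
  by apply: (ulim_le c); apply: filterS (gh w) => n /= <-; exact: fg.
have bst := st_bmeas mf fM.
have E1 : `|Ex Q (st f) - Ex Q h| <= N%:R^-1.
  by rewrite -ExB//; apply: norm_Ex_le => //; exact: bmeasB.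
have Eh : Ex P (g n) @[n --> V] --> Ex Q h.
  have -> : Ex Q h = N%:R^-1 * \sum_(1 <= k < N.+1) ulim V (fun n => prob P (A k n)).
    rewrite ExZ; last by apply: bmeas_sum => k _; exact: bmeas_indic.
    rewrite Ex_sum; last by move=> k; exact: bmeas_indic.
    congr (_ * _); apply: eq_bigr => k _; rewrite Ex_indic//.
    by rewrite [X in fine X](loeb_measure_internal P UV oV).
  have -> : (fun n => Ex P (g n)) = (fun n => N%:R^-1 * \sum_(1 <= k < N.+1) prob P (A k n)).
    apply/funext => n; rewrite ExZ; last by apply: bmeas_sum => k _; exact: bmeas_indic.
    rewrite Ex_sum; last by move=> k; exact: bmeas_indic.
    by congr (_ * _); apply: eq_bigr => k _; rewrite Ex_indic.
  apply: cvgM; first exact: cvg_cst.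
  elim: N.+1 => [|K IH].
    by under eq_fun do rewrite big_geq//; rewrite big_geq//; exact: cvg_cst.
  have [K0|K1] := leqP 1 K; last first.
    by under eq_fun do rewrite big_geq//; rewrite big_geq//; exact: cvg_cst.
  under eq_fun do rewrite big_nat_recr//=; rewrite big_nat_recr//=.
  by apply: cvgD => //; exact: prob_ulim_cvg.
have E2 : `|Ex Q h - ulim V (fun n => Ex P (f n))| <= N%:R^-1.
  have c : `|Ex P (g n) - Ex P (f n)| @[n --> V] --> `|Ex Q h - ulim V (fun n => Ex P (f n))|.
    by apply: cvg_norm; apply: cvgB => //; exact: Ex_ulim_cvg fM.
  apply: (ulim_le c); apply: filterS (@filterT _ V _) => n _ /=.
  have bf : bmeas (f n) by split=> //; exists 1.
  rewrite -ExB//; apply: norm_Ex_le; first exact: bmeasB.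
  by move=> w; rewrite distrC.
rewrite (le_trans (ler_distD (Ex Q h) _ _))// (splitr e).
by rewrite lerD ?(le_trans E1)// (le_trans E2).
Qed.

Theorem Ex_st (f : nat -> T -> R) M :
  (forall n, measurable_fun setT (f n)) -> (forall n w, `|f n w| <= M) ->
  Ex P (f n) @[n --> V] --> Ex Q (st f).
Proof.
move=> mf fM.
pose M' := `|M| + 1.
have M0 : 0 < M' by rewrite ltr_wpDl.
have fM' n w : `|f n w| <= M' by rewrite (le_trans (fM n w))// (le_trans (ler_norm M))// lerDl.
pose g n w := (f n w + M') / (M' *+ 2).
have mg n : measurable_fun setT (g n).
  by apply: measurable_funM => //; exact: measurable_funD.
have g01 n w : 0 <= g n w <= 1.
  have := fM' n w; rewrite ler_norml => /andP[h1 h2].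
  have M2 : 0 < M' *+ 2 by rewrite pmulrn_rgt0.
  apply/andP; split; first by apply: divr_ge0; [lra|exact: ltW].
  by rewrite ler_pdivrMr// mul1r mulr2n lerD2r.
have gM n w : `|g n w| <= 1 by have /andP[? ?] := g01 n w; rewrite ger0_norm.
have M2 : M' *+ 2 != 0 by rewrite lt0r_neq0// pmulrn_rgt0.
have fE n w : f n w = (M' *+ 2) * g n w - M'.
  by rewrite /g mulrCA mulfV// mulr1 addrK.
have bg n : bmeas (g n) by split=> //; exists 1.
have bst := st_bmeas mg gM.
have -> : st f = (fun w => (M' *+ 2) * st g w - M').
  apply/funext => w; apply: ulimE; under eq_fun do rewrite fE.
  apply: cvgB; last exact: cvg_cst.
  by apply: cvgM; [exact: cvg_cst|exact: st_cvg].
rewrite ExB; [|exact: bmeasZ|exact: bmeas_cst].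
rewrite ExZ// Ex_cst Ex_st01//.
have -> : (fun n => Ex P (f n)) = (fun n => (M' *+ 2) * Ex P (g n) - M').
  apply/funext => n; rewrite (_ : f n = fun w => (M' *+ 2) * g n w - M').
    by rewrite ExB; [rewrite ExZ// Ex_cst|exact: bmeasZ|exact: bmeas_cst].
  by apply/funext => w.
apply: cvgB; last exact: cvg_cst.
by apply: cvgM; [exact: cvg_cst|exact: Ex_ulim_cvg gM].
Qed.

End LoebIntegral.

(** * Moment bounds *)

Section GapSums.
Context {R : realType}.
Implicit Types (F H : seq nat -> R) (g s : seq nat).

(** Summation over all words of length [m] with letters below [n]. Words serve both as multi-indices
    of an expanded power and as sequences of gaps. *)
Fixpoint sumG (n m : nat) F : R :=
  if m is m'.+1 then \sum_(v < n) sumG n m' (fun g => F (val v :: g)) else F [::].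

Lemma le_sumG n m F H : (forall g, size g = m -> F g <= H g) -> sumG n m F <= sumG n m H.
Proof.
elim: m F H => [|m IH] F H FH /=; first exact: FH.
by apply: ler_sum => v _; apply: IH => g gm; apply: FH; rewrite /= gm.
Qed.

Lemma eq_sumG n m F H : (forall g, size g = m -> F g = H g) -> sumG n m F = sumG n m H.
Proof. by move=> FH; apply/eqP; rewrite eq_le !le_sumG// => g /FH ->. Qed.

Lemma sumG_ge0 n m F : (forall g, 0 <= F g) -> 0 <= sumG n m F.
Proof.
by elim: m F => [|m IH] F F0 //=; apply: sumr_ge0 => v _; exact: IH.
Qed.

Lemma sumG_sum n m (I : Type) (r : seq I) (Q : pred I) (F : I -> seq nat -> R) :
  sumG n m (fun g => \sum_(i <- r | Q i) F i g) = \sum_(i <- r | Q i) sumG n m (F i).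
Proof.
elim: m F => [|m IH] F //=; rewrite exchange_big/=.
by apply: eq_bigr => v _; rewrite IH.
Qed.

Lemma sumGD n m F H : sumG n m (fun g => F g + H g) = sumG n m F + sumG n m H.
Proof.
elim: m F H => [|m IH] F H //=; rewrite -big_split/=.
by apply: eq_bigr => v _; rewrite IH.
Qed.

Lemma sumGZ n m c F : sumG n m (fun g => c * F g) = c * sumG n m F.
Proof.
elim: m F => [|m IH] F //=; rewrite mulr_sumr.
by apply: eq_bigr => v _; rewrite IH.
Qed.

Lemma sumGZr n m c F : sumG n m (fun g => F g * c) = sumG n m F * c.
Proof. by rewrite mulrC -sumGZ; apply: eq_sumG => g _; rewrite mulrC. Qed.

Lemma sumG_cat n m1 m2 F :
  sumG n (m1 + m2) F = sumG n m1 (fun g1 => sumG n m2 (fun g2 => F (g1 ++ g2))).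
Proof. by elim: m1 F => [|m1 IH] F //=; apply: eq_bigr => v _; rewrite IH. Qed.

Lemma sumG_split n m q F : (q <= m)%N ->
  sumG n m.+1 F = sumG n q (fun g1 => \sum_(v < n) sumG n (m - q) (fun g2 => F (g1 ++ val v :: g2))).
Proof.
move=> qm; have -> : (m.+1 = q + (m - q).+1)%N by rewrite addnS subnKC.
by rewrite sumG_cat.
Qed.

Lemma sumG_exch n m m' (F : seq nat -> seq nat -> R) :
  sumG n m (fun g => sumG n m' (F g)) = sumG n m' (fun g' => sumG n m (F^~ g')).
Proof.
elim: m F => [|m IH] F //=.
rewrite (eq_bigr (fun v : 'I_n => sumG n m' (fun g' => sumG n m (fun g => F (val v :: g) g')))); last first.
  by move=> v _; exact: (IH (fun g => F (val v :: g))).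
elim: m' F {IH} => [|m' IH] F //=.
rewrite exchange_big/=; apply: eq_bigr => u _.
exact: (IH (fun g g' => F g (val u :: g'))).
Qed.

Lemma sumG_all_le n m (v : nat) :
  sumG n m (fun g => (all (fun u => u <= v)%N g)%:R) <= v.+1%:R ^+ m.
Proof.
elim: m => [|m IH] /=; first by rewrite expr0.
rewrite exprS (le_trans (y := \sum_(u < n) (u <= v)%N%:R * v.+1%:R ^+ m))//.
  apply: ler_sum => u _.
  rewrite (@eq_sumG _ _ _ (fun g => (u <= v)%N%:R * (all (fun u => u <= v)%N g)%:R)); last first.
    by move=> g _; rewrite /= -natrM mulnb.
  by rewrite sumGZ ler_wpM2l.
rewrite -mulr_suml ler_wpM2r ?exprn_ge0// -(big_mkord xpredT (fun u => (u <= v)%N%:R)).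
rewrite -natr_sum ler_nat.
have [nv|vn] := leqP n v.+1.
  rewrite (leq_trans (n := \sum_(0 <= i < n) 1))//.
    by apply: leq_sum => i _; exact: leq_b1.
  by rewrite sum_nat_const_nat muln1 subn0.
rewrite (@big_cat_nat _ _ _ v.+1)//=; last exact: ltnW.
rewrite [X in (_ + X)%N]big_nat_cond [X in (_ + X)%N]big1 ?addn0; last first.
  by move=> k /andP[/andP[mk _] _]; rewrite leqNgt mk.
rewrite (leq_trans (n := \sum_(0 <= i < v.+1) 1))//.
  by apply: leq_sum => i _; exact: leq_b1.
by rewrite sum_nat_const_nat muln1 subn0.
Qed.

Lemma sumG_pow n m (y : nat -> R) :
  (\sum_(v < n) y v) ^+ m = sumG n m (fun s => \prod_(i <- s) y i).
Proof.
elim: m => [|m IH] /=; first by rewrite expr0 big_nil.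
rewrite exprS IH mulr_suml; apply: eq_bigr => v _.
by rewrite -sumGZ; apply: eq_sumG => g _; rewrite big_cons.
Qed.

Definition insert_at (q v : nat) s := take q s ++ v :: drop q s.

Lemma sorted_insert v s : sorted leq s ->
  exists2 q, (q <= size s)%N & sorted leq (insert_at q v s).
Proof.
elim: s => [|u s IH] us; first by exists 0%N.
have [vu|uv] := leqP v u; first by exists 0%N => //=; rewrite vu.
have [q qs sq] := IH (path_sorted us).
exists q.+1 => //; move: sq; rewrite /insert_at /=.
case: q qs => [|q] qs.
  by rewrite take0 drop0 /= => ->; rewrite ltnW.
case: s us qs {IH} => [|u' s] //= /andP[uu' _] _ ->.
by rewrite uu'.
Qed.

Lemma sumG_insert n m q F : (q <= m)%N ->
  sumG n 1 (fun w => sumG n m (fun s => F (insert_at q (head 0%N w) s))) = sumG n m.+1 F.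
Proof.
move=> qm; rewrite -{1}(subnKC qm).
rewrite (@eq_sumG _ _ _ (fun w => sumG n q (fun s1 => sumG n (m - q) (fun s2 =>
    F (s1 ++ (head 0%N w) :: s2))))); last first.
  move=> w _; rewrite sumG_cat; apply: eq_sumG => s1 s1q; apply: eq_sumG => s2 _.
  by rewrite /insert_at take_size_cat// drop_size_cat.
have -> : (m.+1 = q + (m - q).+1)%N by rewrite addnS subnKC.
by rewrite sumG_exch sumG_cat.
Qed.

(** Insertion sort: the tail is sorted by induction, and the head goes to one of m + 1 places, so
    each letter costs a factor m + 1. Words with repeated letters are overcounted, which an upper
    bound allows. *)
Lemma sumG_sort n m F : (forall s, 0 <= F s) -> (forall s t, perm_eq s t -> F s = F t) ->
  sumG n m F <= m`!%:R * sumG n m (fun s => (sorted leq s)%:R * F s).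
Proof.
elim: m F => [|m IH] F F0 Fsym; first by rewrite /= fact0 !mul1r.
have -> : sumG n m.+1 F =
  sumG n 1 (fun w => sumG n m (fun s => F (head 0%N w :: s))) by [].
have step : sumG n 1 (fun w => sumG n m (fun s => F (head 0%N w :: s))) <=
    m`!%:R * sumG n 1 (fun w => sumG n m (fun s => (sorted leq s)%:R * F (head 0%N w :: s))).
  rewrite -sumGZ; apply: le_sumG => w _; apply: IH => // s t st.
  by apply: Fsym; rewrite perm_cons.
apply: (le_trans step); rewrite factS mulnC natrM -mulrA ler_wpM2l//.
pose H s := (sorted leq s)%:R * F s.
have -> : m.+1%:R * sumG n m.+1 H = \sum_(q < m.+1) sumG n m.+1 H.
  by rewrite sumr_const card_ord mulr_natl.
rewrite (eq_bigr (fun q : 'I_m.+1 => sumG n 1 (fun w => sumG n m (fun s => H (insert_at q (head 0%N w) s))))); last first.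
  by move=> q _; rewrite sumG_insert// -ltnS.
rewrite -sumG_sum; apply: le_sumG => w _.
rewrite -sumG_sum; apply: le_sumG => s sm.
have [so|] := boolP (sorted leq s); last first.
  by rewrite mul0r => _; apply: sumr_ge0 => q _; rewrite mulr_ge0.
have [q qs sq] := sorted_insert (head 0%N w) so.
have qm : (q < m.+1)%N by rewrite ltnS -sm.
rewrite (bigD1 (Ordinal qm))//= /H sq !mul1r.
rewrite (Fsym (insert_at q (head 0%N w) s) (head 0%N w :: s)).
  by rewrite lerDl; apply: sumr_ge0 => i _; rewrite mulr_ge0.
rewrite /insert_at -cat1s perm_catCA /= -[X in perm_eq _ (_ :: X)](cat_take_drop q s).
by rewrite perm_refl.
Qed.

(* The increasing word starting at v whose successive gaps are g. *)
Fixpoint pos (v : nat) g : seq nat :=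
  v :: (if g is w :: g' then pos (v + w) g' else [::]).

(** A nondecreasing word starting at [v] is determined by its gaps. Letting the gaps range freely
    below [n] also admits positions beyond [n], which adds nonnegative terms only. *)
Lemma sumG_pos n m v F : (forall s, 0 <= F s) ->
  sumG n m (fun s => (path leq v s)%:R * F (v :: s)) <= sumG n m (fun g => F (pos v g)).
Proof.
elim: m v F => [|m IH] v F F0 /=; first by rewrite mul1r.
rewrite (le_trans (y := \sum_(u < n) (v <= u)%N%:R * sumG n m (fun g => F (v :: pos u g))))//.
  apply: ler_sum => u _.
  rewrite (@eq_sumG _ _ _ (fun g => (v <= u)%N%:R * ((path leq u g)%:R * F (v :: val u :: g)))); last first.
    by move=> g _; rewrite mulrA -natrM mulnb.
  by rewrite sumGZ ler_wpM2l//; exact: (IH u (fun s => F (v :: s))).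
pose K u := sumG n m (fun g => F (v :: pos u g)).
have K0 u : 0 <= K u by exact: sumG_ge0.
rewrite -(big_mkord xpredT (fun u => (v <= u)%N%:R * K u)).
rewrite -(big_mkord xpredT (fun w => K (v + w)%N)).
have [nv|vn] := leqP n v.
  rewrite big_nat_cond big1; first exact: sumr_ge0.
  by move=> u /andP[/andP[_ un] _]; rewrite leqNgt (leq_trans un nv) mul0r.
rewrite (@big_cat_nat _ _ _ v)//=; last exact: ltnW.
rewrite [X in X + _]big_nat_cond big1 ?add0r; last first.
  by move=> u /andP[/andP[_ uv] _]; rewrite leqNgt uv mul0r.
rewrite -{1}(add0n v) big_addn [leRHS](@big_cat_nat _ _ _ (n - v))//=; last exact: leq_subr.
rewrite -[leLHS]addr0 lerD//; last exact: sumr_ge0.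
by apply: ler_sum => u _; rewrite addnC leq_addr mul1r.
Qed.

(** Under stationarity the summand depends on the gaps alone, and the choice of the starting point
    contributes the factor [n]. *)
Lemma sumG_sorted_gaps n m F (a : seq nat -> R) :
  (forall s, 0 <= F s) -> (forall v g, F (pos v g) = a g) ->
  sumG n m.+1 (fun s => (sorted leq s)%:R * F s) <= n%:R * sumG n m a.
Proof.
move=> F0 Fa /=.
rewrite (le_trans (y := \sum_(v < n) sumG n m a))//; last first.
  by rewrite sumr_const card_ord mulr_natl.
apply: ler_sum => v _; rewrite (le_trans (sumG_pos n m v F0))//.
by apply: le_sumG => g _; rewrite Fa.
Qed.

Lemma max_gap g : g != [::] -> exists g1 v g2,
  g = g1 ++ v :: g2 /\ all (fun u => u <= v)%N (g1 ++ g2).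
Proof.
elim: g => [//|u g IH] _.
have [->|/IH [g1 [v [g2 [-> h]]]]] := eqVneq g [::]; first by exists [::], u, [::].
have [uv|vu] := leqP u v; first by exists (u :: g1), v, g2; rewrite /= uv.
exists [::], u, (g1 ++ v :: g2); split=> //=.
move: h; rewrite !all_cat /= => /andP[h1 h2].
rewrite (ltnW vu); apply/and3P; split=> //.
  by apply: sub_all h1 => x /leq_trans; apply; exact: ltnW.
by apply: sub_all h2 => x /leq_trans; apply; exact: ltnW.
Qed.

Section GapRecursion.
Variables (a : seq nat -> R) (Theta : nat -> R) (kap S : R) (M : nat).
Hypotheses (a0 : forall g, 0 <= a g) (anil : a [::] = 0)
  (Th0 : forall v, 0 <= Theta v) (kap0 : 0 <= kap)
  (ThS : forall n, \sum_(v < n) Theta v * v.+1%:R ^+ M <= S)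
  (amix : forall g1 v g2, (size g1 + size g2 <= M)%N ->
     a (g1 ++ v :: g2) <= kap * Theta v + a g1 * a g2).

(* Splitting at a largest gap v pays kap * Theta v, and only (v + 1)^M gap
   sequences have all their other gaps bounded by v. *)
Lemma gap_recursion n m : (m <= M)%N ->
  sumG n m.+1 a <= m.+1%:R * (kap * S) + \sum_(q < m.+1) n%:R * (sumG n q a * sumG n (m - q) a).
Proof.
move=> mM.
(* [B q] dominates [a] on the words with a largest gap at place [q]. All [B q] are nonnegative, so
   their sum dominates [a] on every word. *)
pose B (q : nat) g : R := (all (fun u => u <= nth 0%N g q)%N (take q g ++ drop q.+1 g))%:R *
    (kap * Theta (nth 0%N g q)) + a (take q g) * a (drop q.+1 g).
have B0 q g : 0 <= B q g by rewrite addr_ge0// !mulr_ge0.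
rewrite (le_trans (y := sumG n m.+1 (fun g => \sum_(q < m.+1) B q g)))//.
  apply: le_sumG => g gm.
  have [|g1 [v [g2 [gE vmax]]]] := @max_gap g; first by rewrite -size_eq0 gm.
  have s12 : (size g1 + size g2 = m)%N.
    by move: gm; rewrite gE size_cat /= addnS => -[].
  have q1 : (size g1 < m.+1)%N by rewrite ltnS -s12 leq_addr.
  rewrite (bigD1 (Ordinal q1))//= (le_trans (y := B (size g1) g))//; last first.
    by rewrite lerDl sumr_ge0.
  rewrite /B gE take_size_cat// nth_cat ltnn subnn /=.
  rewrite -cat_rcons drop_size_cat ?size_rcons// cat_rcons vmax mul1r.
  by apply: amix; rewrite s12.
rewrite sumG_sum (eq_bigr (fun q : 'I_m.+1 =>
   sumG n q (fun g1 => \sum_(v < n) sumG n (m - q) (fun g2 => B q (g1 ++ val v :: g2))))); last first.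
  by move=> q _; apply: sumG_split; rewrite -ltnS.
rewrite mulr_natl (_ : kap * S *+ m.+1 = \sum_(q < m.+1) kap * S); last first.
  by rewrite sumr_const card_ord.
rewrite -big_split/=.
apply: ler_sum => q _.
have qm : (q <= m)%N by rewrite -ltnS.
rewrite (@eq_sumG _ _ _ (fun g1 => \sum_(v < n) (sumG n (m - q) (fun g2 =>
    (kap * Theta v) * (all (fun u => u <= v)%N (g1 ++ g2))%:R)
    + a g1 * sumG n (m - q) a))); last first.
  move=> g1 g1q; apply: eq_bigr => v _; rewrite -sumGZ -sumGD; apply: eq_sumG => g2 _.
  rewrite /B take_size_cat// nth_cat g1q ltnn subnn /=.
  by rewrite -cat_rcons drop_size_cat ?size_rcons ?g1q// mulrC.
rewrite (@eq_sumG _ _ _ (fun g1 => (\sum_(v < n) sumG n (m - q) (fun g2 =>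
    (kap * Theta v) * (all (fun u => u <= v)%N (g1 ++ g2))%:R))
    + n%:R * (a g1 * sumG n (m - q) a))); last first.
  by move=> g1 _; rewrite big_split/= sumr_const card_ord mulr_natl.
rewrite sumGD sumGZ sumGZr lerD2r.
rewrite sumG_sum (le_trans (y := \sum_(v < n) kap * (Theta v * v.+1%:R ^+ M)))//; last first.
  by rewrite -mulr_sumr ler_wpM2l.
apply: ler_sum => v _.
rewrite -(sumG_cat n q (m - q) (fun g => (kap * Theta v) * (all (fun u => u <= v)%N g)%:R)).
rewrite sumGZ -mulrA ler_wpM2l// ler_wpM2l// subnKC//.
by rewrite (le_trans (sumG_all_le _ _ _))// ler_weXn2l// ler1n.
Qed.

End GapRecursion.

Lemma pow_sandwich (x : R) i h : 0 <= x -> (1 <= i <= h)%N -> x ^+ i <= x + x ^+ h.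
Proof.
move=> x0 /andP[i1 ih]; have [x1|x1] := lerP x 1.
  by rewrite -[leLHS]addr0 lerD ?exprn_ge0// -[leRHS]expr1 ler_wiXn2l.
by rewrite -[leLHS]add0r lerD// ler_weXn2l// ltW.
Qed.

(** Write x for n kap. Induction turns each split of [gap_recursion] into a product of two sums x +
    x^i, whose terms [pow_sandwich] interpolates. The top exponent counts blocks: m gaps join m + 1
    points, and since [a [::] = 0] every contributing block has at least two points, so there are at
    most (m + 1)/2 blocks, each worth a factor x. *)
Lemma gap_sum_bound (M : nat) (Theta : nat -> R) (S : R) :
  (forall v, 0 <= Theta v) -> (forall n, \sum_(v < n) Theta v * v.+1%:R ^+ M <= S) ->
  exists2 C : R, 0 <= C & forall (a : seq nat -> R) kap n m,
  (forall g, 0 <= a g) -> a [::] = 0 -> 0 <= kap ->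
  (forall g1 v g2, (size g1 + size g2 <= M)%N ->
     a (g1 ++ v :: g2) <= kap * Theta v + a g1 * a g2) ->
  (m <= M.+1)%N -> n%:R * sumG n m a <= C * (n%:R * kap + (n%:R * kap) ^+ uphalf m).
Proof.
move=> Th0 ThS.
have S0 : 0 <= S by have := ThS 0%N; rewrite big_ord0.
suff H : forall k, exists2 C : R, 0 <= C & forall (a : seq nat -> R) kap n m,
  (forall g, 0 <= a g) -> a [::] = 0 -> 0 <= kap ->
  (forall g1 v g2, (size g1 + size g2 <= M)%N ->
     a (g1 ++ v :: g2) <= kap * Theta v + a g1 * a g2) ->
  (m <= k)%N -> (m <= M.+1)%N -> n%:R * sumG n m a <= C * (n%:R * kap + (n%:R * kap) ^+ uphalf m).
  have [C C0 HC] := H M.+1; exists C => // a kap n m h1 h2 h3 h4 h5; exact: HC.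
elim=> [|k [C C0 IH]].
  exists 0 => // a kap n m a0 anil _ _; rewrite leqn0 => /eqP -> _ /=.
  by rewrite anil mulr0 mul0r.
(* The summand with [S] pays for the mixing terms of the k + 1 places, the last one for the k + 1
   splits; 4 is the number of terms in the expanded product of two induction bounds. *)
exists (C + k.+1%:R * S + k.+1%:R * (C * C * 4)).
  by rewrite !addr_ge0// !mulr_ge0.
move=> a kap n m a0 anil kap0 amix mk mM.
set x := n%:R * kap; have x0 : 0 <= x by rewrite mulr_ge0.
have [mk'|km] := leqP m k.
  apply: (le_trans (IH a kap n m a0 anil kap0 amix mk' mM)).
  rewrite ler_wpM2r ?addr_ge0 ?exprn_ge0// -addrA lerDl addr_ge0// !mulr_ge0//.
have mE : m = k.+1 by apply/eqP; rewrite eqn_leq mk.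
subst m; have kM : (k <= M)%N by [].
have := gap_recursion a0 Th0 kap0 ThS amix n kM.
move=> /(ler_wpM2l (ler0n R n)) /le_trans; apply.
set h := uphalf k.+1.
rewrite mulrDr [X in X + _](_ : _ = k.+1%:R * S * x); last by rewrite /x; ring.
have prodle q : (q < k.+1)%N ->
    n%:R * (n%:R * (sumG n q a * sumG n (k - q) a)) <= (C * C * 4) * (x + x ^+ h).
  move=> qk.
  rewrite (_ : _ * _ = (n%:R * sumG n q a) * (n%:R * sumG n (k - q) a)); last by ring.
  have R0 : 0 <= C * C * 4 * (x + x ^+ h) by rewrite !mulr_ge0// addr_ge0// exprn_ge0.
  have [q0|q1] := posnP q; first by rewrite q0 /= anil mulr0 mul0r.
  have [q0|q2] := posnP (k - q); first by rewrite q0 /= anil mulr0 mulr0.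
  have := IH a kap n q a0 anil kap0 amix; rewrite -ltnS => /(_ qk) h1.
  have h1' := h1 (leq_trans (ltnW qk) mM).
  have h2 := IH a kap n (k - q)%N a0 anil kap0 amix (leq_subr _ _) (leq_trans (leq_subr _ _) (leqW kM)).
  apply: (le_trans (ler_pM _ _ h1' h2)); try by rewrite mulr_ge0// sumG_ge0.
  rewrite -/x mulrACA.
  rewrite -[leRHS]mulrA ler_wpM2l ?mulr_ge0//.
  have u1 : (1 <= uphalf q)%N by rewrite uphalf_gt0.
  have u2 : (1 <= uphalf (k - q))%N by rewrite uphalf_gt0.
  have uh : (uphalf q + uphalf (k - q) <= h)%N.
    by rewrite /h !uphalfE; clear -qk; lia.
  have e i : (1 <= i)%N -> (i <= uphalf q + uphalf (k - q))%N -> x ^+ i <= x + x ^+ h.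
    by move=> i1 ih; apply: pow_sandwich; rewrite // i1 (leq_trans ih).
  rewrite mulrDl !mulrDr -!exprD.
  have e1 : x * x <= x + x ^+ h by rewrite -expr2; apply: e => //; exact: leq_add u1 u2.
  have e2 : x * x ^+ uphalf (k - q) <= x + x ^+ h.
    by rewrite -exprS; apply: e => //; rewrite -add1n leq_add2r.
  have e3 : x ^+ uphalf q * x <= x + x ^+ h.
    by rewrite -exprSr; apply: e => //; rewrite -addn1 leq_add2l.
  have e4 : x ^+ (uphalf q + uphalf (k - q)) <= x + x ^+ h.
    by apply: e => //; exact: leq_trans u1 (leq_addr _ _).
  clear -e1 e2 e3 e4; lra.
rewrite mulr_sumr.
apply: (le_trans (y := k.+1%:R * S * (x + x ^+ h) + k.+1%:R * (C * C * 4 * (x + x ^+ h)))).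
  apply: lerD; first by rewrite ler_wpM2l ?mulr_ge0// lerDl exprn_ge0.
  rewrite mulr_natl (_ : _ *+ k.+1 = \sum_(q < k.+1) C * C * 4 * (x + x ^+ h)); last first.
    by rewrite sumr_const card_ord.
  by apply: ler_sum => q _; exact: prodle.
rewrite [k.+1%:R * (_ * _)]mulrA -mulrDl ler_wpM2r ?addr_ge0 ?exprn_ge0//.
by rewrite -addrA lerDr.
Qed.

End GapSums.

(** * Measurability and stationarity on the space of paths *)

Section RdMeasurable.
Context {R : realType} (d : nat).

Lemma Rd_measurable_preimage {dT} {T : measurableType dT} (f : ('I_d -> R) -> R)
    (Y : T -> 'I_d -> R) : Rd_measurable f ->
  (forall j, measurable_fun setT (fun w => Y w j)) -> measurable_fun setT (fun w => f (Y w)).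
Proof.
move=> mf mY _ B mB; rewrite setTI.
pose S := [set C : set ('I_d -> R) | measurable (Y @^-1` C)].
have : smallest (sigma_algebra setT) (Rd_cyl (d:=d)) `<=` S.
  apply: smallest_sub; first split.
  - by rewrite /S/= preimage_set0.
  - by move=> A SA; rewrite /S /= setTD preimage_setC; exact: measurableC.
  - by move=> A SA; rewrite /S /= preimage_bigcup; exact: bigcupT_measurable.
  move=> _ [j [C [mC ->]]]; rewrite /S/=.
  by have := mY j measurableT C mC; rewrite setTI.
by move=> /(_ _ (mf B mB)).
Qed.

End RdMeasurable.

Section PathSpace.
Context {R : realType} (d : nat).

Definition path_rect : set (set (nat -> 'I_d -> R)) :=
  [set A | exists m (B : nat -> 'I_d -> set R), (forall i j, measurable (B i j)) /\
     A = [set x | forall i, (i < m)%N -> forall j, B i j (x i j)]].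

Definition path_space := g_sigma_algebraType path_rect.
HB.instance Definition _ := Measurable.on path_space.

Lemma path_rectT : path_rect setT.
Proof.
exists 0%N, (fun _ _ => setT); split=> //.
by rewrite eqEsubset; split.
Qed.

Lemma path_rectI : setI_closed path_rect.
Proof.
move=> _ _ [m [B [mB ->]]] [m' [B' [mB' ->]]].
exists (maxn m m'), (fun i j => (if (i < m)%N then B i j else setT) `&`
   (if (i < m')%N then B' i j else setT)); split.
  by move=> i j; apply: measurableI; case: ifP.
rewrite eqEsubset; split=> x /=.
  by move=> [h h'] i im j; split; case: ifP => // ?; [exact: h|exact: h'].
move=> h; split=> i im j.
  by have [] := h i (leq_trans im (leq_maxl _ _)) j; rewrite im.
by have [_] := h i (leq_trans im (leq_maxr _ _)) j; rewrite im.
Qed.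

Lemma measurable_coord i j : measurable_fun setT (fun x : path_space => x i j).
Proof.
move=> _ B mB; rewrite setTI; apply: sub_sigma_algebra.
exists i.+1, (fun i' j' => if (i' == i) && (j' == j) then B else setT); split.
  by move=> i' j'; case: ifP.
rewrite eqEsubset; split=> x /=.
  by move=> Bx i' _ j'; case: ifP => // /andP[/eqP -> /eqP ->].
by move=> /(_ i (ltnSn i) j); rewrite !eqxx.
Qed.

Context {dT} {T : measurableType dT} (P : probability T R) (X : nat -> T -> 'I_d -> R).
Hypothesis mX : forall i j, measurable_fun setT (fun w => X i w j).
Hypothesis sX : stationary P X.

Definition shift_path (k : nat) (w : T) : path_space := fun i => X (i + k) w.

Lemma measurable_shift_path k : measurable_fun setT (shift_path k).
Proof.
apply: (@measurability _ _ T path_space setT (shift_path k) path_rect erefl).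
move=> _ [A [m [B [mB ->]]] <-].
rewrite setTI.
rewrite (_ : _ @^-1` _ = \bigcap_(i in [set i | (i < m)%N]) \bigcap_(j in [set: 'I_d])
    ((fun w => X (i + k) w j) @^-1` B i j)); last first.
  rewrite eqEsubset; split=> w /= h i im j; first by move=> _; exact: h.
  exact: h.
apply: fin_bigcap_measurable; first exact: finite_II.
move=> i _; apply: fin_bigcap_measurable => // j _.
by have := mX (i + k) j measurableT (mB i j); rewrite setTI.
Qed.

(** Rectangles, on which stationarity is assumed, are stable under intersection and generate the
    path sigma-algebra; uniqueness of measures extends shift invariance to every bounded path
    functional. *)
Lemma stationary_Ex (g : path_space -> R) k : bmeas g ->
  Ex P (fun w => g (shift_path k w)) = Ex P (fun w => g (shift_path 0 w)).
Proof.
move=> bg.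
rewrite -!(Ex_law P (measurable_shift_path _) bg).
apply: (@Ex_eq_measure _ path_space R _ _ path_rect) => //.
- exact: path_rectI.
- exact: path_rectT.
- move=> _ [m [B [mB ->]]].
  rewrite (lawE P (measurable_shift_path k)) (lawE P (measurable_shift_path 0)).
  apply: (eq_trans (@sX m k B mB)); congr (P _); rewrite eqEsubset; split=> w /= h i im j.
    by rewrite /shift_path ?addr0 ?addn0; exact: h.
  by have := h i im j; rewrite /shift_path ?addr0 ?addn0.
Qed.

End PathSpace.

Lemma pos_cat v g1 w g2 : pos v (g1 ++ w :: g2) = pos v g1 ++ pos (v + sumn g1 + w)%N g2.
Proof.
elim: g1 v => [|u g1 IH] v /=; first by rewrite addn0.
by rewrite IH !addnA.
Qed.

Lemma pos_shift k v g : pos (k + v)%N g = map (addn k) (pos v g).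
Proof.
elim: g v => [|w g IH] v //=; rewrite -IH; congr (_ :: _).
by case: g {IH} => [|w' g] /=; rewrite addnA.
Qed.

Lemma size_pos v g : size (pos v g) = (size g).+1.
Proof. by elim: g v => [|w g IH] v //=; rewrite IH. Qed.

(** The link between gap words and the partial sums of the mixing condition. The list starts with a
    dummy 0 because [istar] sums from index 1 on. *)
Lemma pos_istar v g :
  pos v g = [seq (v + istar (nth 0 (0 :: g)) j)%N | j <- iota 0 (size g).+1].
Proof.
elim: g v => [|w g IH] v; first by rewrite /= /istar big_geq// addn0.
have -> : iota 0 (size (w :: g)).+1 = 0%N :: map (addn 1) (iota 0 (size g).+1).
  by rewrite -iotaDl.
rewrite map_cons -map_comp [LHS]/=; congr (_ :: _); first by rewrite /istar big_geq// addn0.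
rewrite IH; apply: eq_map => j /=.
rewrite -addnA; congr (_ + _)%N; rewrite add1n /istar [in RHS]big_ltn//= big_add1/=.
by congr (_ + _)%N; rewrite !big_add1.
Qed.

Lemma pos_istar_split g1 v g2 (i := nth 0%N (0%N :: g1 ++ v :: g2)) (q := (size g1).+1) :
  pos 0 g1 = [seq istar i j | j <- index_iota 0 q] /\
  pos (sumn g1 + v)%N g2 = [seq istar i j | j <- index_iota q (q + (size g2).+1)].
Proof.
have := pos_istar 0 (g1 ++ v :: g2); rewrite pos_cat -/i add0n.
have -> : (size (g1 ++ v :: g2)).+1 = (q + (size g2).+1)%N.
  by rewrite size_cat /= /q; lia.
rewrite iotaD map_cat => /eqP.
rewrite eqseq_cat; last by rewrite size_map size_iota size_pos.
move=> /andP[/eqP -> /eqP ->]; rewrite /index_iota subn0 addKn add0n.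
by split; apply: eq_map.
Qed.

(** * Moments of order 2p from multiple mixing *)

Section MomentBound.
Context {R : realType} {dT} {T : measurableType dT} (P : probability T R) (d : nat).
Context (X : nat -> T -> 'I_d -> R) (G : set (('I_d -> R) -> R)) (nG : (('I_d -> R) -> R) -> R).
Context (r : R) (Theta : nat -> R) (p : nat).
Hypothesis mX : forall i j, measurable_fun setT (fun w => X i w j).
Hypothesis sX : stationary P X.
Hypothesis hG : function_space G nG.
Hypothesis hmix : multiple_mixing P X G nG Theta r.
Hypothesis p0 : (0 < p)%N.
Hypothesis hsum : (\sum_(0 <= i <oo) (((i ^ (2 * p - 2))%N)%:R * Theta i)%:E < +oo)%E.

Lemma G_measurable f i : G f -> measurable_fun setT (fun w => f (X i w)).
Proof. by case: hG => mG _ _ _ _ Gf; apply: Rd_measurable_preimage => //; exact: mG. Qed.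

Lemma G_bmeas f i M : G f -> (forall x, `|f x| <= M) -> bmeas (fun w => f (X i w)).
Proof. by move=> Gf fM; split; [exact: G_measurable|exists M]. Qed.

Lemma Ex_prod_shift f M s k : G f -> (forall x, `|f x| <= M) ->
  Ex P (fun w => \prod_(i <- s) f (X (i + k)%N w)) = Ex P (fun w => \prod_(i <- s) f (X i w)).
Proof.
move=> Gf fM.
have b : bmeas (fun x : path_space d => \prod_(i <- s) f (x i) : R).
  apply: bmeas_prod => i _; split; last by exists M.
  apply: (@Rd_measurable_preimage _ _ _ (path_space d)).
    by case: hG => mG _ _ _ _; exact: mG.
  by move=> j; exact: measurable_coord.
have := stationary_Ex mX sX k b; rewrite /shift_path => E.
rewrite [LHS]E; congr Ex; apply/funext => w.
by apply: eq_bigr => i _; rewrite ?addr0 ?addn0.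
Qed.

(** Passing from v to v + 1 costs the factor 2^(2p-2), as v + 1 <= 2 v for v >= 1. The term v = 0,
    which the weight v^(2p-2) may annihilate, is added separately. *)
Lemma mixing_sum : exists S, forall n, \sum_(v < n) Theta v * v.+1%:R ^+ (2 * p - 2) <= S.
Proof.
set M := (2 * p - 2)%N; case: hmix => _ Th0 _ _.
pose u i := ((i ^ M)%N)%:R * Theta i.
have u0 i : 0 <= u i by rewrite mulr_ge0.
have [tot totE] : exists tot, (\sum_(0 <= i <oo) (u i)%:E = tot%:E)%E.
  exists (fine (\sum_(0 <= i <oo) (u i)%:E)%E); rewrite fineK// ge0_fin_numE//.
  by apply: nneseries_ge0 => i _ _; rewrite lee_fin.
exists (Theta 0%N + 2 ^+ M * tot) => n.
have part : \sum_(v < n) u v <= tot.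
  rewrite -lee_fin -totE -sumEFin -(big_mkord xpredT (fun v => (u v)%:E)).
  by apply: (@nneseries_lim_ge _ (fun i => (u i)%:E) xpredT) => i _ _; rewrite lee_fin.
apply: (@le_trans _ _ (\sum_(v < n) ((v == 0%N :> nat)%:R * Theta 0%N + 2 ^+ M * u v))).
  apply: ler_sum => -[v /= _] _; case: v => [|v] /=.
    by rewrite expr1n mulr1 mul1r lerDl mulr_ge0// exprn_ge0.
  rewrite mul0r add0r /u natrX mulrA -exprMn mulrC ler_wpM2r//.
  rewrite lerXn2r ?nnegrE ?mulr_ge0// -natrM ler_nat; lia.
rewrite big_split/= -mulr_sumr lerD//; last by rewrite ler_wpM2l// exprn_ge0.
rewrite -mulr_suml ler_piMl//.
case: n {part} => [|n]; first by rewrite big_ord0.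
by rewrite big_ord_recl/= big1 ?addr0.
Qed.

Definition gap_corr (f : ('I_d -> R) -> R) (g : seq nat) : R :=
  `|Ex P (fun w => \prod_(i <- pos 0 g) f (X i w))|.

Lemma covE (Y Z : T -> R) : cov P Y Z = Ex P (fun w => Y w * Z w) - Ex P Y * Ex P Z.
Proof. by []. Qed.

(** The mixing condition, read at the gap [v], is the hypothesis [amix] of the gap recursion:
    stationarity moves the right-hand block back to 0, and one constant [K] replaces those of the
    finitely many orders below 2p. *)
Lemma mixing_gaps : exists2 K, 1 <= K & forall f l, G f -> (forall x, `|f x| <= 1) ->
  (\int[P]_w (f (X 0%N w))%:E = 0)%E ->
  Lnorm P r%:E (fun w => (f (X 0%N w))%:E) = l%:E ->
  forall g1 v g2, (size g1 + size g2 <= 2 * p - 2)%N ->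
  gap_corr f (g1 ++ v :: g2) <= (K * (l * nG f)) * Theta v + gap_corr f g1 * gap_corr f g2.
Proof.
case: hmix => _ Th0 _ hm.
have hm' : forall q, exists K : R, (0 < q)%N -> forall f, G f -> (forall x, `|f x| <= 1) ->
          (\int[P]_w (f (X 0 w))%:E = 0)%E ->
          forall (i : nat -> nat) (q' : nat), (1 <= q' <= q)%N ->
            (`|cov P (fun w => \prod_(0 <= j < q') f (X (istar i j) w))
                     (fun w => \prod_(q' <= j < q.+1) f (X (istar i j) w))|%:E
             <= K%:E * Lnorm P r%:E (fun w => (f (X 0 w))%:E)
                     * (nG f * Theta (i q'))%:E)%E.
  move=> [|q]; first by exists 0.
  by have [K KP] := hm q.+1 isT; exists K.
have [K KP] := choice hm'.
(* The summand 1 makes [K >= 1], so that K <= K^p in [moment_bound]. *)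
exists (1 + \sum_(q < 2 * p) `|K q|); first by rewrite lerDl sumr_ge0.
move=> f l Gf f1 Ef lE g1 v g2 s12.
have l0 : 0 <= l by rewrite -lee_fin -lE Lnorm_ge0.
have nG0 : 0 <= nG f by case: hG => _ _ _ _ [+ _ _]; apply.
set q := (size g1 + size g2).+1.
set i := nth 0%N (0%N :: g1 ++ v :: g2).
have qq : (1 <= (size g1).+1 <= q)%N by rewrite /q /= ltnS leq_addr.
have := KP q isT f Gf f1 Ef i (size g1).+1 qq; rewrite lE -!EFinM lee_fin.
have -> : i (size g1).+1 = v by rewrite /i /= nth_cat ltnn subnn.
have [E1 E2] := pos_istar_split g1 v g2.
have -> : (fun w => \prod_(0 <= j < (size g1).+1) f (X (istar i j) w)) =
    (fun w => \prod_(j <- pos 0 g1) f (X j w)).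
  by apply/funext => w; rewrite E1 big_map.
have -> : (fun w => \prod_((size g1).+1 <= j < q.+1) f (X (istar i j) w)) =
    (fun w => \prod_(j <- pos (sumn g1 + v)%N g2) f (X j w)).
  apply/funext => w; rewrite E2 big_map; congr bigop.
  by congr (index_iota _ _); rewrite /q; lia.
rewrite covE.
have -> : (fun w => (\prod_(j <- pos 0 g1) f (X j w)) * (\prod_(j <- pos (sumn g1 + v)%N g2) f (X j w)))
   = (fun w => \prod_(j <- pos 0 (g1 ++ v :: g2)) f (X j w)).
  by apply/funext => w; rewrite pos_cat add0n big_cat.
have -> : Ex P (fun w => \prod_(j <- pos (sumn g1 + v)%N g2) f (X j w)) =
   Ex P (fun w => \prod_(j <- pos 0 g2) f (X j w)).
  rewrite -(Ex_prod_shift (pos 0 g2) (sumn g1 + v)%N Gf f1); congr Ex; apply/funext => w.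
  rewrite -{1}(addn0 (sumn g1 + v)%N) pos_shift big_map.
  by apply: eq_bigr => j _; rewrite addnC.
rewrite /gap_corr => H.
set A := Ex P _ in H *; set B := Ex P _ in H *; set C := Ex P _ in H *.
have HK : K q <= 1 + \sum_(q < 2 * p) `|K q|.
  have qp : (q < 2 * p)%N by rewrite /q; lia.
  rewrite (bigD1 (Ordinal qp))//= addrCA (le_trans (ler_norm _))// lerDl.
  by rewrite addr_ge0// sumr_ge0.
have : `|A| <= `|A - B * C| + `|B| * `|C|.
  by rewrite -normrM -[X in `|X| <= _](subrK (B * C)) ler_normD.
move=> /le_trans; apply; rewrite lerD2r (le_trans H)//.
rewrite -!mulrA ler_wpM2r//.
by rewrite !mulr_ge0.
Qed.

Lemma Ex_sumG n m (F : seq nat -> T -> R) : (forall s, bmeas (F s)) ->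
  bmeas (fun w => sumG n m (fun s => F s w)) /\
  Ex P (fun w => sumG n m (fun s => F s w)) = sumG n m (fun s => Ex P (F s)).
Proof.
elim: m F => [|m IH] F bF //=.
have IHv (v : 'I_n) := IH (fun g => F (val v :: g)) (fun g => bF _).
split; first by apply: bmeas_sum => v _; exact: (IHv v).1.
rewrite Ex_sum; last by move=> v; exact: (IHv v).1.
by apply: eq_bigr => v _; exact: (IHv v).2.
Qed.

(** The expanded power is a sum over words of 2p indices. Sorting costs (2p)!, the free starting
    point gives the factor n, and the remaining 2p - 1 gaps give the exponent p in
    [gap_sum_bound]. *)
Lemma moment_bound : exists2 C, 0 <= C & forall f l n, G f -> (forall x, `|f x| <= 1) ->
  (\int[P]_w (f (X 0%N w))%:E = 0)%E ->
  Lnorm P r%:E (fun w => (f (X 0%N w))%:E) = l%:E ->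
  Ex P (fun w => (\sum_(1 <= i < n.+1) f (X i w)) ^+ (2 * p)) <=
    C * (n%:R * (l * nG f) + (n%:R * (l * nG f)) ^+ p).
Proof.
have [S HS] := mixing_sum; have [K K1 HK] := mixing_gaps.
case: hmix => _ Th0 _ _.
have [C C0 HC] := gap_sum_bound Th0 HS.
have K0 : 0 <= K by rewrite (le_trans ler01).
exists ((2 * p)`!%:R * C * K ^+ p); first by rewrite !mulr_ge0// exprn_ge0.
move=> f l n Gf f1 Ef lE.
have l0 : 0 <= l by rewrite -lee_fin -lE Lnorm_ge0.
have nG0 : 0 <= nG f by case: hG => _ _ _ _ [+ _ _]; apply.
have rho0 : 0 <= l * nG f by rewrite mulr_ge0.
set x := n%:R * (l * nG f); have x0 : 0 <= x by rewrite mulr_ge0.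
have bprod (s : seq nat) (k : nat) : bmeas (fun w => \prod_(i <- s) f (X (i + k)%N w)).
  by apply: bmeas_prod => i _; exact: G_bmeas Gf f1.
pose F (s : seq nat) := `|Ex P (fun w => \prod_(i <- s) f (X i.+1 w))|.
have F1 : Ex P (fun w => (\sum_(1 <= i < n.+1) f (X i w)) ^+ (2 * p)) <= sumG n (2 * p) F.
  have -> : (fun w => (\sum_(1 <= i < n.+1) f (X i w)) ^+ (2 * p)) =
     (fun w => sumG n (2 * p) (fun s => \prod_(i <- s) f (X i.+1 w))).
    by apply/funext => w; rewrite big_add1/= big_mkord (sumG_pow n (2 * p) (fun i => f (X i.+1 w))).
  have -> := (@Ex_sumG n (2 * p) (fun s w => \prod_(i <- s) f (X i.+1 w)) _).2; last first.
    by move=> s; under eq_fun do under eq_bigr do rewrite -addn1.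
  by apply: le_sumG => s _; exact: ler_norm.
have F0 s : 0 <= F s by rewrite /F.
have Fpos v g : F (pos v g) = gap_corr f g.
  rewrite /F /gap_corr -(Ex_prod_shift (pos 0 g) v.+1 Gf f1); congr (`|Ex P _|).
  apply/funext => w; rewrite -{1}(addn0 v) pos_shift big_map.
  by apply: eq_bigr => j _; rewrite addnC addnS.
have Fsym s t : perm_eq s t -> F s = F t.
  move=> st; rewrite /F; congr (`|Ex P _|); apply/funext => w.
  exact: perm_big.
apply: (le_trans F1); apply: (le_trans (sumG_sort n (2 * p) F0 Fsym)).
rewrite -!mulrA ler_wpM2l//.
have p2 : (2 * p = (2 * p - 1).+1)%N by clear -p0; lia.
rewrite {1}p2; apply: (le_trans (sumG_sorted_gaps n _ F0 Fpos)).
have anil : gap_corr f [::] = 0.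
  rewrite /gap_corr (_ : Ex P _ = 0) ?normr0// /Ex.
  by under eq_integral do rewrite big_seq1; rewrite Ef.
have up : uphalf (2 * p - 1) = p by rewrite uphalfE; clear -p0; lia.
have := HC (gap_corr f) (K * (l * nG f)) n (2 * p - 1)%N (fun g => normr_ge0 _) anil
  (mulr_ge0 K0 rho0) (HK f l Gf f1 Ef lE).
move=> /(_ _)/le_trans -> //; first by clear -p0; lia.
rewrite up ler_wpM2l// mulrCA -/x exprMn mulrDr lerD//.
by rewrite ler_wpM2r// -[leLHS]expr1 ler_weXn2l.
Qed.

End MomentBound.

(** * Quantile grid *)

Section Quantiles.
Context {R : realType} {dT} {T : measurableType dT} (P : probability T R) (d : nat).
Context (X : nat -> T -> 'I_d -> R).
Hypothesis mX : forall i j, measurable_fun setT (fun w => X i w j).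
Hypothesis cF : distF_continuous P X.

Lemma measurable_le_coord i j (x : R) : measurable [set w | X i w j <= x].
Proof. by rewrite -[X in measurable X]setTI; apply: measurable_fun_le. Qed.

Lemma measurable_ele_coord i j (t : \bar R) : measurable [set w | ((X i w j)%:E <= t)%E].
Proof.
case: t => [x||].
- under eq_set do rewrite lee_fin; exact: measurable_le_coord.
- by rewrite (_ : [set _ | _] = setT)//; apply/seteqP; split=> // w _ /=; exact: leey.
- rewrite (_ : [set _ | _] = set0)//; apply/seteqP; split=> // w /=.
Qed.

Lemma measurable_leRd i t : measurable [set w | leRd (X i w) t].
Proof.
rewrite (_ : [set w | _] = \bigcap_(j in [set: 'I_d]) [set w | ((X i w j)%:E <= t j)%E]).
  by apply: fin_bigcap_measurable => // j _; exact: measurable_ele_coord.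
by apply/seteqP; split=> w h j; [move=> _; exact: h|exact: h].
Qed.

Lemma margFE j x : margF P X j x = prob P [set w | X 0%N w j <= x].
Proof. by []. Qed.

Lemma margF_itv j x : 0 <= margF P X j x <= 1.
Proof. by rewrite margFE prob_itv//; exact: measurable_le_coord. Qed.

Lemma le_margF j x y : x <= y -> margF P X j x <= margF P X j y.
Proof.
move=> xy; rewrite !margFE; apply: le_prob; try exact: measurable_le_coord.
by move=> w /= h; exact: le_trans xy.
Qed.

Lemma margF_near0 j e : 0 < e -> exists x, margF P X j x < e.
Proof.
move=> e0; have [|||n hn] := @prob_exhaust _ _ _ P (fun n => ~` [set w | X 0%N w j <= - n%:R]) _ _ _ e e0.
- by move=> n; apply: measurableC; exact: measurable_le_coord.
- move=> n w /= h h'; apply: h; rewrite (le_trans h')// lerN2 ler_nat//.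
- move=> w; exists (Num.truncn (- X 0%N w j)).+1 => /= h.
  have := truncnS_gt (- X 0%N w j); lra.
by exists (- n%:R); rewrite margFE -[X in prob P X]setCK.
Qed.

Lemma margF_near1 j e : 0 < e -> exists x, 1 - e < margF P X j x.
Proof.
move=> e0; have [|||n hn] := @prob_exhaust _ _ _ P (fun n => [set w | X 0%N w j <= n%:R]) _ _ _ e e0.
- by move=> n; exact: measurable_le_coord.
- by move=> n w /= h; rewrite (le_trans h)// ler_nat.
- move=> w; exists (Num.truncn (X 0%N w j)).+1 => /=.
  exact/ltW/truncnS_gt.
exists n%:R; rewrite margFE; move: hn; rewrite probC; last exact: measurable_le_coord.
lra.
Qed.

(** Up to an event of probability below e/4, all other coordinates lie below a fixed [n], so the
    marginal is uniformly close to the restriction of F to a line. *)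
Lemma margF_cont j : continuous (margF P X j).
Proof.
move=> x; apply/cvgrPdist_lt => e e0.
have e4 : 0 < e / 4 by lra.
pose A (n : nat) := [set w | leRd (X 0%N w) (fun=> (n%:R)%:E)].
have [|||n hn] := @prob_exhaust _ _ _ P A _ _ _ _ e4.
- by move=> n; exact: measurable_leRd.
- by move=> n w /= h i; rewrite (le_trans (h i))// lee_fin ler_nat.
- move=> w; exists (\max_(i < d) (Num.truncn (X 0%N w i)).+1)%N => i.
  rewrite lee_fin (le_trans (ltW (truncnS_gt _)))// ler_nat.
  exact: (@leq_bigmax _ (fun i => (Num.truncn (X 0%N w i)).+1)).
have mA := measurable_leRd 0 (fun=> (n%:R)%:E).
pose t (y : R) (i : 'I_d) : R := if i == j then y else n%:R.
have hF y : `|margF P X j y - distF P X (fun i => (t y i)%:E)| < e / 4.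
  have mB := measurable_leRd 0 (fun i => (t y i)%:E).
  have BF : distF P X (fun i => (t y i)%:E) <= margF P X j y.
    rewrite margFE; apply: le_prob => //; first exact: measurable_le_coord.
    by move=> w /(_ j); rewrite /t eqxx lee_fin.
  rewrite ger0_norm ?subr_ge0// ltrBlDr (le_lt_trans _ (ltr_leD hn (lexx _)))//.
  rewrite margFE; apply: le_trans (probU_le _ (measurableC mA) mB).
  apply: le_prob; [exact: measurable_le_coord|apply: measurableU => //; exact: measurableC|].
  move=> w /= h; have [Aw|Aw] := pselect (A n w); [right|by left].
  by move=> i; rewrite /t; case: eqP => [->|_]; rewrite ?lee_fin//; exact: Aw.
have [delta delta0 hd] := cF (t x) e4.
near=> y.
have xy : `|x - y| < delta by near: y; apply: cvgr_dist_lt.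
have h1 := hF x; have h2 := hF y.
have h3 : `|distF P X (fun i => (t y i)%:E) - distF P X (fun i => (t x i)%:E)| < e / 4.
  by apply: hd => i; rewrite /t; case: eqP => _; rewrite ?subrr ?normr0// distrC.
move: h1 h2 h3; rewrite !ltr_norml => /andP[? ?] /andP[? ?] /andP[? ?].
by apply/andP; split; lra.
Unshelve. all: by end_near. Qed.

Lemma quantile_ex j u : 0 < u < 1 -> exists x, margF P X j x = u.
Proof.
move=> /andP[u0 u1].
have [a ha] := margF_near0 j u0.
have [|b hb] := @margF_near1 j (1 - u); first by rewrite subr_gt0.
have hb' : u < margF P X j b by move: hb; rewrite opprB addrCA subrr addr0.
have ab : a <= b.
  by rewrite leNgt; apply/negP => /ltW/(le_margF j); rewrite leNgt (lt_trans ha).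
have cw : {within `[a, b], continuous (margF P X j)}.
  by apply: continuous_subspaceT; exact: margF_cont.
have [|c _ cu] := IVT ab cw (v := u); last by exists c.
rewrite min_l ?le_margF// max_r ?le_margF//.
by rewrite (ltW ha) (ltW hb').
Qed.

(* Marginal quantiles of F, with value -oo below level 0 and +oo above level 1,
   so that grids of the cube [0, 1]^d extend to the compactified space. *)
Definition qt (j : 'I_d) (u : R) : \bar R :=
  if u <= 0 then -oo%E else if 1 <= u then +oo%E else
  (xget 0 [set x | margF P X j x = u])%:E.

Lemma qtP j u : 0 < u < 1 -> exists2 x, qt j u = x%:E & margF P X j x = u.
Proof.
move=> u01; have [x hx] := quantile_ex j u01.
exists (xget 0 [set x | margF P X j x = u]).
  by move/andP: u01 => [u0 u1]; rewrite /qt leNgt u0 /= leNgt u1.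
exact: (@xgetPex _ 0 [set x | margF P X j x = u] (ex_intro _ x hx)).
Qed.

Lemma qtN j u : u <= 0 -> qt j u = -oo%E.
Proof. by rewrite /qt => ->. Qed.

Lemma qtY j u : 1 <= u -> qt j u = +oo%E.
Proof. by move=> u1; rewrite /qt u1 leNgt (lt_le_trans ltr01 u1). Qed.

Lemma qt_lt j u v : u < v -> 0 < v -> u < 1 -> (qt j u < qt j v)%E.
Proof.
move=> uv v0 u1; have [u0|u0] := lerP u 0.
  rewrite (qtN _ u0); have [v1|v1] := lerP 1 v; first by rewrite qtY.
  by have [|y -> _] := @qtP j v; rewrite ?v0 ?v1 ?ltNyr.
have [|x -> xu] := @qtP j u; first by rewrite u0.
have [v1|v1] := lerP 1 v; first by rewrite qtY// ltry.
have [|y -> yv] := @qtP j v; first by rewrite v0 v1.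
by rewrite lte_fin ltNge; apply/negP => /(le_margF j); rewrite xu yv leNgt uv.
Qed.

Lemma qt_le j u v : u <= v -> (qt j u <= qt j v)%E.
Proof.
rewrite le_eqVlt => /predU1P[->//|uv].
have [v0|v0] := lerP v 0; first by rewrite !qtN// (le_trans (ltW uv)).
have [u1|u1] := lerP 1 u; first by rewrite !qtY// (le_trans u1 (ltW uv)).
exact/ltW/qt_lt.
Qed.

Definition coord_prob j (t : \bar R) := prob P [set w | ((X 0%N w j)%:E <= t)%E].

Lemma coord_probE j u : coord_prob j (qt j u) = Num.max 0 (Num.min 1 u).
Proof.
rewrite /coord_prob; have [u0|u0] := lerP u 0.
  rewrite qtN// min_r; last by rewrite (le_trans u0).
  rewrite max_l// (_ : [set _ | _] = set0); first by rewrite /prob measure0.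
  by apply/seteqP; split=> // w /=; rewrite leeNy_eq.
have [u1|u1] := lerP 1 u.
  rewrite qtY// max_r// (_ : [set _ | _] = setT).
    by rewrite /prob (probability_setT P).
  by apply/seteqP; split=> // w _ /=; exact: leey.
rewrite max_r; last exact: ltW.
have [|x -> xu] := @qtP j u; first by rewrite u0 u1.
by rewrite -xu margFE; congr prob; apply/seteqP; split=> w /=; rewrite lee_fin.
Qed.

Lemma coord_prob_diff j u v : u <= v ->
  coord_prob j (qt j v) - coord_prob j (qt j u) <= v - u.
Proof.
rewrite !coord_probE => uv; rewrite !minEle.
by do 2 (case: ifPn; rewrite -?ltNge => ?); rewrite !maxEle;
  repeat (case: ifPn; rewrite -?ltNge => ?); lra.
Qed.

Definition ind (t : 'I_d -> \bar R) (x : 'I_d -> R) : R := \1_[set y | leRd y t] x.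

Lemma indE t x : ind t x = (`[< leRd x t >])%:R.
Proof. by rewrite /ind indicE /=; congr (_%:R); rewrite -[LHS]asboolb; apply: asbool_equiv_eq; rewrite in_setE. Qed.

Lemma bmeas_ind i t : bmeas (fun w => ind t (X i w)).
Proof.
rewrite (_ : (fun w => _) = \1_[set w | leRd (X i w) t]); last first.
  apply/funext => w; rewrite /ind !indicE.
  suff -> : (X i w \in [set y | leRd y t]) = (w \in [set w | leRd (X i w) t]) by [].
  by apply/idP/idP; rewrite !inE.
exact: bmeas_indic (measurable_leRd i t).
Qed.

Lemma le_ind s t x : (forall j, (s j <= t j)%E) -> ind s x <= ind t x.
Proof.
move=> st; rewrite !indE ler_nat.
case: asboolP => // h; case: asboolP => // [[]] j.
exact: le_trans (st j).
Qed.

Lemma ind_itv t x : 0 <= ind t x <= 1.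
Proof. by rewrite indE ler0n lern1 leq_b1. Qed.

Definition qvec (u : 'I_d -> R) : 'I_d -> \bar R := fun j => qt j (u j).

(** A point of the larger box outside the smaller one violates the constraint of some coordinate; a
    union bound over the coordinates gives the sum. *)
Lemma Ex_ind_diff u v : (forall j, u j <= v j) ->
  Ex P (fun w => ind (qvec v) (X 0%N w)) - Ex P (fun w => ind (qvec u) (X 0%N w)) <= \sum_j (v j - u j).
Proof.
move=> uv; pose I j t (w : T) : R := \1_[set w | ((X 0%N w j)%:E <= t)%E] w.
have bI j t : bmeas (I j t) by apply: bmeas_indic; exact: measurable_ele_coord.
rewrite -ExB; try exact: bmeas_ind.
apply: (@le_trans _ _ (Ex P (fun w => \sum_j (I j (qt j (v j)) w - I j (qt j (u j)) w)))).
  apply: le_Ex.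
  - by apply: bmeasB; exact: bmeas_ind.
  - by apply: bmeas_sum => j _; exact: bmeasB.
  move=> w; have I01 j : 0 <= I j (qt j (v j)) w - I j (qt j (u j)) w.
    rewrite /I !indicE subr_ge0 ler_nat.
    case: (boolP (w \in [set w | ((X 0%N w j)%:E <= qt j (u j))%E])) => //=.
    by rewrite !inE /= => h; rewrite mem_set//=; exact: le_trans (qt_le j (uv j)).
  rewrite !indE; case: asboolP => [hv|_]; last first.
    apply: (@le_trans _ _ 0); last by apply: sumr_ge0 => j _; exact: I01.
    by rewrite sub0r oppr_le0 ler0n.
  case: asboolP => hu.
    by rewrite subrr; apply: sumr_ge0 => j _; exact: I01.
  have [j hj] : exists j, ~ ((X 0%N w j)%:E <= qt j (u j))%E by apply/existsNP.
  rewrite (bigD1 j)//= /I !indicE mem_set; last exact: hv.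
  rewrite memNset// lerDl; apply: sumr_ge0 => i _; exact: I01.
rewrite Ex_sum; last by move=> j; exact: bmeasB.
apply: ler_sum => j _; rewrite ExB// !Ex_indic; try exact: measurable_ele_coord.
exact: coord_prob_diff.
Qed.

End Quantiles.

(** Values in [0, 1] keep the supremum finite, so that [fine] does not collapse it to 0. *)
Lemma modulus_ge {R : realType} (g : R -> R) (delta : \bar R) t s :
  (forall x, 0 <= g x <= 1) -> (`|t - s|%:E <= delta)%E -> `|g t - g s| <= modulus g delta.
Proof.
move=> g01 ts; rewrite /modulus; set S := [set e | _].
have ubS : (ereal_sup S <= 1)%E.
  apply: ge_ereal_sup => _ [x [y [_ ->]]]; rewrite lee_fin ler_norml.
  by have := g01 x; have := g01 y => /andP[? ?] /andP[? ?]; apply/andP; split; lra.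
have leS : ((`|g t - g s|)%:E <= ereal_sup S)%E.
  by apply: ereal_sup_ubound; exists t, s.
rewrite -lee_fin fineK// fin_numElt (lt_le_trans _ leS) ?ltNyr//=.
by rewrite (le_lt_trans ubS) ?ltry.
Qed.

Lemma ereal_gap {R : realType} (a b : \bar R) (x y : R) :
  (a < x%:E)%E -> (y%:E < b)%E -> ((y - x)%:E <= b - a)%E.
Proof.
case: a => [a||]; case: b => [b||] //=; rewrite ?lte_fin ?leey//.
move=> ax yb; rewrite -EFinB lee_fin; lra.
Qed.

(** * Approximants on the quantile grid *)

Section Approximants.
Context {R : realType} {dT} {T : measurableType dT} (P : probability T R) (d : nat).
Context (X : nat -> T -> 'I_d -> R) (G : set (('I_d -> R) -> R)) (nG : (('I_d -> R) -> R) -> R).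
Context (Psi : R -> R) (gamma : R).
Hypothesis mX : forall i j, measurable_fun setT (fun w => X i w j).
Hypothesis cF : distF_continuous P X.
Hypothesis hG : function_space G nG.
Hypothesis hctrl : control_function P X G nG Psi.
Hypothesis hPsi : exists C z0 : R, forall z, z0 <= z -> Psi z <= C * z `^ gamma^-1.
Hypothesis gamma0 : 0 < gamma.

Local Notation a := (2 `^ gamma^-1 : R).

Lemma rate_ge1 : 1 <= a.
Proof. by rewrite -[leLHS](powRr0 2) ler_powR ?ler1n// invr_ge0 ltW. Qed.

Lemma G0 : G (fun=> 0) /\ nG (fun=> 0) = 0.
Proof.
case: hG => _ Gc _ _ [_ _ nZ]; split; first exact: Gc.
by have := nZ 0 (fun=> 0) (Gc 0); rewrite normr0 !mul0r.
Qed.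

(** Makes the asymptotic growth condition valid at every generation: below the threshold
    monotonicity bounds [Psi] by a constant, and a^k >= 1. *)
Lemma Psi_bound : exists2 C, 0 <= C & forall k, Psi (2 ^+ k) <= C * a ^+ k.
Proof.
have [C [z0 hC]] := hPsi; case: hctrl => Psi0 Psimon _.
pose Z := Num.max z0 1; have Z1 : 1 <= Z by rewrite le_max lexx orbT.
have PZ : 0 <= Psi Z by apply: Psi0; lra.
exists (`|C| + Psi Z); first by rewrite addr_ge0.
move=> k; have a1 := rate_ge1.
have ak : 1 <= a ^+ k by apply: exprn_ege1.
have [kZ|Zk] := lerP Z (2 ^+ k).
  rewrite (le_trans (hC _ _))//; first by rewrite (le_trans _ kZ)// le_max lexx.
  rewrite -powR_mulrn// powRAC powR_mulrn ?powR_ge0// ler_wpM2r ?exprn_ge0 ?powR_ge0//.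
  by rewrite (le_trans (ler_norm _))// lerDl.
apply: (@le_trans _ _ (Psi Z)); first by apply: Psimon; [exact: exprn_ge0|exact: ltW].
rewrite -[leLHS]mulr1; apply: ler_pM => //.
by rewrite lerDr.
Qed.

(** One mesh of the grid in every coordinate separates the two boxes of the control function. The
    modulus of each marginal over such a mesh is at least 2^-(k+1), so the seminorm is at most
    Psi(2^(k+1)). *)
Lemma approximant_ex : exists2 C, 0 <= C & forall k (i : 'I_d -> nat),
  (forall j, i j <= 2 ^ k)%N -> exists phi, [/\ G phi,
    forall x, ind (qvec P X (fun j => ((i j)%:R - 1) / 2 ^+ k)) x <= phi x,
    forall x, phi x <= ind (qvec P X (fun j => (i j)%:R / 2 ^+ k)) x &
    nG phi <= C * a ^+ k].
Proof.
have [C C0 hC] := Psi_bound; case: hctrl => Psi0 Psimon hphi.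
have a1 := rate_ge1; have a0 : 0 <= a by rewrite powR_ge0.
exists (C * a) => [|k i ik]; first by rewrite mulr_ge0.
have k0 : 0 < 2 ^+ k :> R by rewrite exprn_gt0.
(* If some index is 0, both quantiles in that coordinate are -oo: the control function asks for
   strictly ordered corners and does not apply, but both boxes are empty and 0 is an approximant. *)
have [[j ij0]|ipos] := pselect (exists j, i j = 0%N).
  have [G00 nG00] := G0; exists (fun=> 0); split=> //.
  - move=> x; rewrite indE; case: asboolP => // /(_ j).
    by rewrite /qvec ij0 qtN ?leeNy_eq// pmulr_lle0 ?invr_gt0// sub0r lerN10.
  - by rewrite nG00; apply: mulr_ge0; [exact: mulr_ge0|exact: exprn_ge0].
have i0 j : (0 < i j)%N by rewrite lt0n; apply/eqP => h; apply: ipos; exists j.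
have ik' j : (i j)%:R <= 2 ^+ k :> R by rewrite -natrX ler_nat.
have i1 j : 1 <= (i j)%:R :> R by rewrite ler1n.
pose lo j : R := ((i j)%:R - 1) / 2 ^+ k; pose hi j : R := (i j)%:R / 2 ^+ k.
have lohi j : (qvec P X lo j < qvec P X hi j)%E.
  apply: qt_lt => //; rewrite /lo /hi.
  - by rewrite ltr_pM2r ?invr_gt0// ltrBlDr ltrDl.
  - by rewrite divr_gt0// (lt_le_trans ltr01).
  - by rewrite ltr_pdivrMr// mul1r; have := ik' j; lra.
have [phi [Gphi phil phiu]] := hphi (qvec P X lo) (qvec P X hi) lohi.
set m := \big[_/_]_(j < d) _ => nphi.
have mge : (2 ^+ k.+1)^-1 <= m.
  apply: le_bigmin.
    by rewrite invf_le1 ?exprn_gt0// exprn_ege1// ler1n.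
  move=> j _.
  (* The end quantiles may be infinite, whereas the modulus is taken over real points. The levels
     are moved inwards by a quarter of a mesh at each end, which leaves half a mesh, 2^-(k+1). *)
  pose u : R := ((i j)%:R - 3 / 4) / 2 ^+ k; pose v : R := ((i j)%:R - 1 / 4) / 2 ^+ k.
  have lou : lo j < u by rewrite ltr_pM2r ?invr_gt0//; lra.
  have uv : u < v by rewrite ltr_pM2r ?invr_gt0//; lra.
  have vhi : v < hi j by rewrite ltr_pM2r ?invr_gt0//; lra.
  have u0 : 0 < u by rewrite divr_gt0//; have := i1 j; lra.
  have v1 : v < 1 by rewrite ltr_pdivrMr// mul1r; have := ik' j; lra.
  have [|x xE xu] := @qtP _ _ _ P _ X mX cF j u; first by rewrite u0 (lt_trans uv).
  have [|y yE yv] := @qtP _ _ _ P _ X mX cF j v; first by rewrite (lt_trans u0 uv) v1.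
  have xy : x <= y.
    by rewrite -lee_fin -xE -yE; apply: qt_le => //; exact: ltW.
  have : (2 ^+ k.+1)^-1 <= `|margF P X j y - margF P X j x|.
    rewrite yv xu /u /v -mulrBl ger0_norm; last by apply: divr_ge0; [lra|exact: ltW].
    rewrite exprS invfM; apply: ler_wpM2r; first by rewrite invr_ge0 ltW.
    lra.
  move=> /le_trans; apply; apply: modulus_ge; first by move=> z; exact: margF_itv.
  rewrite ger0_norm ?subr_ge0//; apply: ereal_gap.
    by rewrite -xE; apply: qt_lt => //; exact: (lt_trans lou (lt_trans uv v1)).
  rewrite -yE; apply: qt_lt => //.
  exact: (lt_trans (lt_trans u0 uv) vhi).
exists phi; split=> //; have m0 : 0 < m by rewrite (lt_le_trans _ mge)// invr_gt0 exprn_gt0.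
apply: (le_trans (nphi m0)); rewrite -mulrA -exprS; apply: le_trans (hC _).
apply: Psimon; first by rewrite invr_ge0 ltW.
by rewrite invf_ple ?posrE// exprn_gt0.
Qed.

End Approximants.

(** * Tail bounds and chaining *)

Lemma powR2_lt {R : realType} (x y : R) : x < y -> 2 `^ x < 2 `^ y :> R.
Proof. by move=> xy; rewrite /powR pnatr_eq0 /= ltr_expR ltr_pM2r// ln_gt0// ltr1n. Qed.

Section TailBound.
Context {R : realType} {dT} {T : measurableType dT} (P : probability T R) (d : nat).
Context (X : nat -> T -> 'I_d -> R) (G : set (('I_d -> R) -> R)) (nG : (('I_d -> R) -> R) -> R).
Context (r : R) (Theta : nat -> R) (p : nat) (gamma : R).
Hypothesis mX : forall i j, measurable_fun setT (fun w => X i w j).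
Hypothesis sX : stationary P X.
Hypothesis hG : function_space G nG.
Hypothesis hmix : multiple_mixing P X G nG Theta r.
Hypothesis p0 : (0 < p)%N.
Hypothesis hsum : (\sum_(0 <= i <oo) (((i ^ (2 * p - 2))%N)%:R * Theta i)%:E < +oo)%E.
Hypothesis gamma0 : 0 < gamma.

Local Notation a := (2 `^ gamma^-1 : R).
Local Notation b := (2 `^ (- r^-1) : R).

Definition mean (f : ('I_d -> R) -> R) : R := Ex P (fun w => f (X 0%N w)).

Definition emp (n : nat) (f : ('I_d -> R) -> R) (w : T) : R :=
  (Num.sqrt n%:R)^-1 * \sum_(1 <= i < n.+1) (f (X i w) - mean f).

(** From |f| <= 1 and r >= 1 follows |f|^r <= |f|. The norm is given as a real number, as
    [moment_bound] asks. *)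
Lemma Lnorm_bound (f : T -> R) e : 1 <= r -> measurable_fun setT f -> (forall w, `|f w| <= 1) ->
  Ex P (fun w => `|f w|) <= e -> 0 <= e ->
  exists l, [/\ Lnorm P r%:E (fun w => (f w)%:E) = l%:E, 0 <= l & l <= e `^ r^-1].
Proof.
move=> r1 mf f1 fe e0; have r0 : 0 < r by apply: lt_le_trans r1.
have bf : bmeas (fun w => `|f w| `^ r).
  split; first by apply: (measurableT_comp (measurable_powR r)); exact: measurableT_comp.
  exists 1 => w; rewrite ger0_norm ?powR_ge0//.
  by have := @ge0_ler_powR _ r (ltW r0) `|f w| 1; rewrite powR1 !nnegrE; apply.
have bn : bmeas (fun w => `|f w|) by apply: bmeas_norm; split=> //; exists 1.
exists ((Ex P (fun w => `|f w| `^ r)) `^ r^-1); split.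
- rewrite Lnorm.unlock.
  under eq_integral do rewrite abse_EFin poweR_EFin.
  by rewrite ExE// poweR_EFin.
- exact: powR_ge0.
- apply: ge0_ler_powR; rewrite ?nnegrE//; first by rewrite invr_ge0 ltW.
    by apply: Ex_ge0 => w; exact: powR_ge0.
  apply: le_trans fe; apply: le_Ex => // w.
  have [->|fw0] := eqVneq (f w) 0; first by rewrite normr0 powR0// gt_eqF.
  by rewrite ge1r_powR// normr_gt0 fw0 f1.
Qed.

(** Here a >= 1 because gamma > 0, and b >= 1/2 because r >= 1. It yields n (a b)^k >= 1 whenever
    2^k <= n. *)
Lemma ab_ge : 1 <= r -> 2^-1 <= a * b.
Proof.
move=> r1; have r0 : 0 < r by apply: lt_le_trans r1.
have b2 : 2^-1 <= b.
  rewrite -[leLHS](powR_inv1 (ler0n _ 2)) ler_powR ?ler1n// lerN2 invf_le1//.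
have a1 : 1 <= a by exact: rate_ge1.
rewrite -[leLHS]mul1r ler_pM//.
Qed.

(** Markov's inequality of order 2p. With y = n (a b)^k the moment bound is of order y + y^p, and y
    >= 1 absorbs the linear term; dividing by n^p, which comes from the normalisation, leaves (a
    b)^(k p). *)
Lemma tail_bound c : 0 <= c -> exists2 C, 0 <= C & forall k n f lam,
  (2 ^ k <= n)%N -> G f -> (forall x, `|f x| <= 1) -> nG f <= c * a ^+ k ->
  mean (fun x => `|f x|) <= c / 2 ^+ k -> 0 < lam ->
  prob P [set w | lam <= `|emp n f w|] <= C * (a * b) ^+ (k * p) / lam ^+ (2 * p).
Proof.
move=> c0.
have [C0 C00 HC0] := moment_bound mX sX hG hmix p0 hsum.
case: (hmix) => r1 _ _ _; have r0 : 0 < r by apply: lt_le_trans r1.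
case: (hG) => mG Gc GD GZ [nG0 nGD nGZ].
set n1 := nG (fun=> 1); have n10 : 0 <= n1 by apply: nG0; exact: Gc.
have a1 : 1 <= a by exact: rate_ge1.
have b0 : 0 < b by exact: powR_gt0.
have ab0 : 0 < a * b by rewrite mulr_gt0// (lt_le_trans ltr01).
set c' := c `^ r^-1 * (c + n1).
have c'0 : 0 <= c' by rewrite mulr_ge0 ?powR_ge0// addr_ge0.
exists (4 ^+ p * C0 * (c' + c' ^+ p)).
  by rewrite !mulr_ge0// ?exprn_ge0// addr_ge0// exprn_ge0.
move=> k n f lam kn Gf f1 nf Ef lam0.
have mf i : measurable_fun setT (fun w => f (X i w)) by exact: (G_measurable mX hG).
have bf i : bmeas (fun w => f (X i w)) by split=> //; exists 1.
have mf1 : `|mean f| <= 1 by apply: norm_Ex_le.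
have mfE : `|mean f| <= mean (fun x => `|f x|) by apply: le_norm_Ex.
(* Centring may double the sup norm, and mixing is assumed for functions bounded by 1; undoing the
   factor 1/2 produces 4^p in the constant. *)
pose fb x := 2^-1 * f x + (- (mean f / 2)).
have fbE x : fb x = (f x - mean f) / 2 by rewrite /fb; lra.
have Gfb : G fb by apply: GD; [exact: GZ|exact: Gc].
have fb1 x : `|fb x| <= 1.
  rewrite fbE normrM [`|2^-1|]ger0_norm// ler_pdivrMr// mul1r.
  by rewrite (le_trans (ler_normB _ _))//; have := f1 x; lra.
have Efb : (\int[P]_w (fb (X 0%N w))%:E = 0)%E.
  have bfb : bmeas (fun w => fb (X 0%N w)).
    by split; [exact: (G_measurable mX hG)|exists 1].
  rewrite ExE//; congr (_%:E); rewrite /fb ExD; [|exact: bmeasZ|exact: bmeas_cst].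
  by rewrite ExZ// Ex_cst -/(mean f); lra.
have Enfb : Ex P (fun w => `|fb (X 0%N w)|) <= c / 2 ^+ k.
  apply: le_trans Ef; rewrite /mean.
  apply: (@le_trans _ _ (Ex P (fun w => 2^-1 * (`|f (X 0%N w)| + `|mean f|)))).
    apply: le_Ex.
    - by apply: bmeas_norm; split; [exact: (G_measurable mX hG)|exists 1].
    - by apply: bmeasZ; apply: bmeasD; [exact: bmeas_norm|exact: bmeas_cst].
    move=> w; rewrite fbE normrM [`|2^-1|]ger0_norm// mulrC ler_wpM2l//.
    exact: ler_normB.
  rewrite ExZ; last by apply: bmeasD; [exact: bmeas_norm|exact: bmeas_cst].
  rewrite ExD; [|exact: bmeas_norm|exact: bmeas_cst].
  by rewrite Ex_cst; rewrite /mean in mfE *; lra.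
have ck0 : 0 <= c / 2 ^+ k by rewrite divr_ge0// exprn_ge0.
have [l [lE l0 lb]] := Lnorm_bound r1 (G_measurable mX hG 0 Gfb) (fun w => fb1 _) Enfb ck0.
have lb' : l <= c `^ r^-1 * b ^+ k.
  apply: (le_trans lb); rewrite powRM ?invr_ge0 ?exprn_ge0//.
  rewrite ler_wpM2l ?powR_ge0// -(powR_invn k (ler0n _ 2)) -powRrM.
  by rewrite -powR_mulrn ?powR_ge0// -powRrM mulNr mulrC mulNr.
have nfb : nG fb <= (c + n1) * a ^+ k.
  have ak1 : 1 <= a ^+ k by exact: exprn_ege1.
  have -> : fb = (fun x => 2^-1 * f x + (- (mean f / 2)) * 1).
    by apply/funext => x; rewrite mulr1.
  rewrite (le_trans (nGD _ _ (GZ _ _ Gf) (GZ _ _ (Gc 1))))//.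
  rewrite (nGZ _ _ Gf) (nGZ _ _ (Gc 1)) -/n1 normrN normrM [`|2^-1|]ger0_norm//.
  have h1 : `|mean f| * 2^-1 * n1 <= n1 * a ^+ k.
    rewrite mulrC ler_wpM2l//; apply: le_trans ak1; lra.
  have h2 := nG0 _ Gf.
  rewrite mulrDl lerD//; lra.
have nfb0 : 0 <= nG fb by exact: nG0.
set rho := l * nG fb; have rho0 : 0 <= rho by rewrite mulr_ge0.
have rhob : rho <= c' * (a * b) ^+ k.
  rewrite (le_trans (ler_pM l0 nfb0 lb' nfb))// /c' exprMn.
  by rewrite mulrACA [b ^+ k * _]mulrC.
have n0 : 0 < n%:R :> R by rewrite ltr0n (leq_trans _ kn)// expn_gt0.
have M1 := HC0 fb l n Gfb fb1 Efb lE.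
have sumE w : emp n f w = 2 * (Num.sqrt n%:R)^-1 * \sum_(1 <= i < n.+1) fb (X i w).
  rewrite /emp -mulrA mulrCA; congr (_ * _); rewrite mulr_sumr.
  by apply: eq_bigr => i _; rewrite fbE mulrCA mulfV// mulr1.
have bS : bmeas (fun w => \sum_(1 <= i < n.+1) fb (X i w)).
  by apply: bmeas_sum => i _; split; [exact: (G_measurable mX hG)|exists 1].
have bE : bmeas (emp n f).
  by rewrite (funext sumE); exact: bmeasZ.
have E2 : Ex P (fun w => emp n f w ^+ (2 * p)) <= 4 ^+ p * C0 * (c' + c' ^+ p) * (a * b) ^+ (k * p).
  have -> : (fun w => emp n f w ^+ (2 * p)) =
      (fun w => (4 ^+ p / n%:R ^+ p) * (\sum_(1 <= i < n.+1) fb (X i w)) ^+ (2 * p)).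
    apply/funext => w; rewrite sumE exprMn; congr (_ * _).
    have -> : (2 * (Num.sqrt n%:R)^-1) ^+ (2 * p) = ((2 * (Num.sqrt n%:R)^-1) ^+ 2) ^+ p :> R.
      exact: exprM.
    have -> : (2 * (Num.sqrt n%:R)^-1) ^+ 2 = 4 * n%:R^-1 :> R.
      rewrite exprMn; congr (_ * _); first by rewrite -natrX.
      by rewrite -[in RHS](sqr_sqrtr (ler0n R n)) exprVn.
    by rewrite exprMn exprVn.
  rewrite ExZ; last exact: bmeasX.
  rewrite -!mulrA ler_wpM2l ?exprn_ge0//.
  rewrite ler_pdivrMl ?exprn_gt0//.
  apply: (le_trans M1); rewrite [leRHS]mulrCA ler_wpM2l//.
  have nrho : n%:R * rho <= n%:R * (c' * (a * b) ^+ k) by rewrite ler_wpM2l.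
  have kab : n%:R^-1 <= (a * b) ^+ k.
    apply: (@le_trans _ _ (2^-1 ^+ k)); last first.
      by apply: lerXn2r; rewrite ?nnegrE ?invr_ge0 ?(ltW ab0)//; exact: ab_ge.
    by rewrite exprVn lef_pV2 ?posrE ?exprn_gt0// -natrX ler_nat.
  have kab0 : 0 <= (a * b) ^+ k by rewrite exprn_ge0 ?ltW.
  have t1 : n%:R * rho <= n%:R ^+ p * (c' * (a * b) ^+ (k * p)).
    apply: (le_trans nrho); rewrite exprM.
    move: ((a * b) ^+ k) kab kab0 => K kab kab0.
    have nK : 1 <= n%:R * K by rewrite -ler_pdivrMl// mulr1.
    rewrite mulrCA [leRHS]mulrCA ler_wpM2l// -exprMn.
    by rewrite -[leLHS]expr1 ler_weXn2l.
  have t2 : (n%:R * rho) ^+ p <= n%:R ^+ p * (c' ^+ p * (a * b) ^+ (k * p)).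
    rewrite exprM -!exprMn; apply: lerXn2r; last exact: nrho.
      by rewrite nnegrE; exact: mulr_ge0.
    by rewrite nnegrE; apply: mulr_ge0 => //; exact: mulr_ge0.
  by rewrite mulrDl mulrDr lerD.
have lam2 : 0 < lam ^+ (2 * p) by exact: exprn_gt0.
have sub : [set w | lam <= `|emp n f w|] `<=` [set w | lam ^+ (2 * p) <= emp n f w ^+ (2 * p)].
  move=> w /= h; have -> : emp n f w ^+ (2 * p) = `|emp n f w| ^+ (2 * p).
    by rewrite -normrX ger0_norm// exprM exprn_ge0// sqr_ge0.
  by apply: lerXn2r; rewrite ?nnegrE// ltW.
have bE2 : bmeas (fun w => emp n f w ^+ (2 * p)) by exact: bmeasX.
have mle (g : T -> R) z : bmeas g -> measurable [set w | z <= g w].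
  by move=> bg; rewrite -[X in measurable X]setTI; apply: measurable_fun_le => //; exact: bg.1.
apply: (@le_trans _ _ (prob P [set w | lam ^+ (2 * p) <= emp n f w ^+ (2 * p)])).
  by apply: le_prob => //; apply: mle => //; exact: bmeas_norm.
apply: (le_trans (@Ex_markov _ _ _ P _ _ bE2 _ lam2)).
  by move=> w; rewrite exprM exprn_ge0// sqr_ge0.
by rewrite ler_wpM2r// invr_ge0 ltW.
Qed.

(** The left-hand side is 2^e with e = d + p (1/gamma - 1/r), negative by the bound on [gamma]. The
    choice x = 2^(e/(4p)) gives x^(2p) = 2^(e/2), halfway in the exponent between 2^e and 1. *)
Lemma rate_exists : 1 <= r -> d%:R * r < p%:R -> r * p%:R / (p%:R - r * d%:R) < gamma ->
  exists x : R, [/\ 0 < x, x < 1 & 2 ^+ d * (a * b) ^+ p < x ^+ (2 * p)].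
Proof.
move=> r1 dr hgam.
have r0 : 0 < r by apply: lt_le_trans r1.
have pp : 0 < p%:R :> R by rewrite ltr0n.
have pd : 0 < p%:R - r * d%:R by rewrite subr_gt0 mulrC.
have th : 2 ^+ d * (a * b) ^+ p = 2 `^ (d%:R + p%:R * (gamma^-1 - r^-1)).
  rewrite powRD ?pnatr_eq0 ?implybT// powR_mulrn//; congr (_ * _).
  rewrite -powRD ?pnatr_eq0 ?implybT// mulrC -powR_mulrn ?powR_ge0// -powRrM.
  by rewrite mulrC.
set e := d%:R + _ in th.
have e0 : e < 0.
  rewrite /e.
  have gi : gamma^-1 < (p%:R - r * d%:R) / (r * p%:R).
    by rewrite -[ltRHS]invrK ltf_pV2 ?posrE ?invr_gt0 ?divr_gt0 ?mulr_gt0// invf_div.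
  have -> : d%:R = p%:R * (r^-1 - (p%:R - r * d%:R) / (r * p%:R)) :> R.
    field; by rewrite !gt_eqF.
  by rewrite -mulrDr pmulr_rlt0//; lra.
exists (2 `^ (e / (4 * p%:R))); split.
- exact: powR_gt0.
- rewrite -[ltRHS](powRr0 2) powR2_lt//.
  by rewrite pmulr_llt0// invr_gt0 mulr_gt0.
- rewrite th -powR_mulrn ?powR_ge0// -powRrM natrM.
  have -> : e / (4 * p%:R) * (2 * p%:R) = e / 2 by field; rewrite gt_eqF.
  rewrite powR2_lt//; lra.
Qed.

End TailBound.

(** * Links of the chaining and good events *)

Section Chaining.
Context {R : realType} {dT} {T : measurableType dT} (P : probability T R) (d : nat).
Context (X : nat -> T -> 'I_d -> R) (G : set (('I_d -> R) -> R)) (nG : (('I_d -> R) -> R) -> R).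
Hypothesis mX : forall i j, measurable_fun setT (fun w => X i w j).
Hypothesis cF : distF_continuous P X.
Hypothesis hG : function_space G nG.

Local Notation qv := (qvec P X).
Local Notation qt := (qt P X).
Local Notation emp := (emp P X).
Local Notation mean := (mean P X).

Definition obs_bmeas (f : ('I_d -> R) -> R) := forall i, bmeas (fun w => f (X i w)).

Lemma obs_ind t : obs_bmeas (ind t).
Proof. by move=> i; exact: bmeas_ind. Qed.

Lemma meanB f g : obs_bmeas f -> obs_bmeas g -> mean (fun y => f y - g y) = mean f - mean g.
Proof. by move=> bf bg; rewrite /mean ExB. Qed.

Lemma le_mean f g : obs_bmeas f -> obs_bmeas g -> (forall y, f y <= g y) -> mean f <= mean g.
Proof. by move=> bf bg fg; apply: le_Ex. Qed.

Lemma empB n f g w : obs_bmeas f -> obs_bmeas g ->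
  emp n (fun y => f y - g y) w = emp n f w - emp n g w.
Proof.
move=> bf bg; rewrite /emp -mulrBr; congr (_ * _); rewrite -sumrB.
by apply: eq_bigr => i _; rewrite meanB//; ring.
Qed.

Lemma emp_cst n c w : emp n (fun=> c) w = 0.
Proof.
rewrite /emp big1 ?mulr0// => i _.
by rewrite /mean Ex_cst subrr.
Qed.

Lemma Un_emp n w t : Un P X n w t = emp n (ind t) w.
Proof.
rewrite /Un /emp; congr (_ * _); apply: eq_bigr => i _; congr (_ - _).
rewrite /mean /distF (_ : (fun w => _) = \1_[set w | leRd (X 0%N w) t]).
  by rewrite Ex_indic//; exact: measurable_leRd.
by apply/funext => w'; rewrite indE indicE; congr (_%:R).
Qed.

(** The uncentred sums are monotone; centring costs only the deterministic drift, the difference of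
    means times sqrt n. *)
Lemma emp_le n f g w : obs_bmeas f -> obs_bmeas g -> (forall y, f y <= g y) ->
  emp n f w - emp n g w <= Num.sqrt n%:R * (mean g - mean f).
Proof.
move=> bf bg fg; rewrite /emp -mulrBr -sumrB.
have [->|n0] := posnP n; first by rewrite sqrtr0 invr0 !mul0r.
have s0 : 0 < Num.sqrt n%:R :> R by rewrite sqrtr_gt0 ltr0n.
rewrite ler_pdivrMl// mulrA -expr2 sqr_sqrtr//.
apply: (@le_trans _ _ (\sum_(1 <= i < n.+1) (mean g - mean f))).
  by apply: ler_sum => i _; have := fg (X i w); lra.
by rewrite sumr_const_nat subSS subn0 mulr_natl.
Qed.

Definition bracket (u v : 'I_d -> R) (f : ('I_d -> R) -> R) :=
  forall y, ind (qv u) y <= f y /\ f y <= ind (qv v) y.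

Lemma bracket_sub u v u' v' f : (forall j, u' j <= u j) -> (forall j, v j <= v' j) ->
  bracket u v f -> bracket u' v' f.
Proof.
move=> uu vv h y; have [h1 h2] := h y; split.
  by apply: le_trans h1; apply: le_ind => j; exact: (qt_le mX cF).
by apply: (le_trans h2); apply: le_ind => j; exact: (qt_le mX cF).
Qed.

Lemma bracket_itv u v f y : bracket u v f -> 0 <= f y <= 1.
Proof.
move=> h; have [h1 h2] := h y.
have /andP[? _] := ind_itv (qv u) y; have /andP[_ ?] := ind_itv (qv v) y.
by apply/andP; split; [exact: le_trans h1|exact: le_trans h2 _].
Qed.

Lemma mean_bracket_diff u v f g : (forall j, u j <= v j) -> obs_bmeas f -> obs_bmeas g ->
  bracket u v f -> bracket u v g ->
  mean (fun y => `|f y - g y|) <= \sum_j (v j - u j).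
Proof.
move=> uv bf bg hf hg; apply: le_trans (Ex_ind_diff mX cF uv).
rewrite -ExB; try exact: bmeas_ind.
apply: le_Ex.
- by apply: bmeas_norm; apply: bmeasB.
- by apply: bmeasB; exact: bmeas_ind.
move=> w; have [h1 h2] := hf (X 0%N w); have [h3 h4] := hg (X 0%N w).
by rewrite ler_norml; apply/andP; split; lra.
Qed.

(* The dyadic cell of generation k, in the quantile scale, that contains t. *)
Definition cell (k : nat) (t : 'I_d -> \bar R) (j : 'I_d) : nat :=
  \max_(i < 2 ^ k | (qt j ((val i)%:R / 2 ^+ k) <= t j)%E) i.

(** An adjunction between grid indices and quantiles, through which cells are compared by comparing
    quantiles. *)
Lemma cell_geP k t j i : (i < 2 ^ k)%N -> (i <= cell k t j)%N = (qt j (i%:R / 2 ^+ k) <= t j)%E.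
Proof.
move=> ik; apply/idP/idP; last first.
  by move=> h; exact: (@leq_bigmax_cond _ (fun i : 'I_(2 ^ k) => (qt j ((val i)%:R / 2 ^+ k) <= t j)%E)
    (fun i => val i) (Ordinal ik) h).
move=> ic; have z : (0 < 2 ^ k)%N by rewrite expn_gt0.
have [|c hc cE] := @eq_bigmax_cond _ (fun i : 'I_(2 ^ k) => (qt j ((val i)%:R / 2 ^+ k) <= t j)%E)
    (fun i => val i).
  by apply/card_gt0P; exists (Ordinal z); rewrite unfold_in /= mul0r qtN// leNye.
apply: le_trans hc; apply: (qt_le mX cF).
rewrite ler_wpM2r ?invr_ge0 ?exprn_ge0// ler_nat -cE.
exact: ic.
Qed.

Lemma cell_lt k t j : (cell k t j < 2 ^ k)%N.
Proof.
have z : (0 < 2 ^ k)%N by rewrite expn_gt0.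
by rewrite -(prednK z) ltnS; apply/bigmax_leqP => i _; rewrite -ltnS (prednK z).
Qed.

Lemma cell_le k t j : (qt j ((cell k t j)%:R / 2 ^+ k) <= t j)%E.
Proof. by rewrite -cell_geP// cell_lt. Qed.

(** The last cell contains its upper end +oo, so strictness can fail there only. *)
Lemma cell_gt k t j : (cell k t j).+1 = (2 ^ k)%N \/ (t j < qt j ((cell k t j).+1%:R / 2 ^+ k))%E.
Proof.
have := cell_lt k t j; rewrite leq_eqVlt => /predU1P[->|h]; [by left|right].
by rewrite ltNge -cell_geP// ltnn.
Qed.

Lemma cell_ge k t j : (t j <= qt j ((cell k t j).+1%:R / 2 ^+ k))%E.
Proof.
have [->|/ltW//] := cell_gt k t j.
by rewrite natrX divff ?gt_eqF ?exprn_gt0// qtY// leey.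
Qed.

Lemma cell_half k t j : (cell k.+1 t j)./2 = cell k t j.
Proof.
apply/eqP; rewrite eqn_leq; apply/andP; split.
  have h : ((cell k.+1 t j)./2 < 2 ^ k)%N.
    by have := cell_lt k.+1 t j; rewrite expnS; lia.
  rewrite cell_geP//; apply: le_trans (cell_le k.+1 t j); apply: (qt_le mX cF).
  rewrite exprS invfM mulrA ler_wpM2r ?invr_ge0 ?exprn_ge0//.
  rewrite ler_pdivlMr// -natrM ler_nat; lia.
have h := cell_lt k t j.
rewrite geq_half_double cell_geP; last by rewrite expnS; lia.
apply: le_trans (cell_le k t j); apply: (qt_le mX cF).
by rewrite -muln2 natrM exprS invfM mulrA -[_ * 2 / 2]mulrA divff// mulr1.
Qed.

Lemma cell0 t j : cell 0 t j = 0%N.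
Proof. by have := cell_lt 0 t j; rewrite expn0; lia. Qed.

Lemma ind_cell k t : bracket (fun j => (cell k t j)%:R / 2 ^+ k)
  (fun j => (cell k t j).+1%:R / 2 ^+ k) (ind t).
Proof.
by move=> y; split; apply: le_ind => j; [exact: cell_le|exact: cell_ge].
Qed.

Context (gamma : R).
Hypothesis gamma0 : 0 < gamma.
Local Notation a := (2 `^ gamma^-1 : R).
Context (phi : nat -> ('I_d -> nat) -> ('I_d -> R) -> R) (C1 : R) (x : R).
Hypothesis C10 : 0 <= C1.
Hypothesis hphi : forall k i, (forall j, (i j <= 2 ^ k)%N) -> [/\ G (phi k i),
  bracket (fun j => ((i j)%:R - 1) / 2 ^+ k) (fun j => (i j)%:R / 2 ^+ k) (phi k i) &
  nG (phi k i) <= C1 * a ^+ k].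
Hypothesis x0 : 0 < x.

(** Capping at 2^k, that is at level 1, keeps the index in the range where approximants are
    available. *)
Definition cap_shift (k : nat) (i o : 'I_d -> nat) : 'I_d -> nat :=
  fun j => minn (i j + o j) (2 ^ k).

Definition top_cell (k : nat) : 'I_d -> nat := fun=> (2 ^ k - 1)%N.

(* The differences of approximants occurring in the chaining at generation k:
   from a cell to its parent, between neighbouring cells, and from the last cell to 1. *)
Definition link (k : nat) : finType :=
  ({ffun 'I_d -> 'I_(2 ^ k)} + {ffun 'I_d -> 'I_(2 ^ k)} * {ffun 'I_d -> 'I_3} + unit)%type.

Definition link_hi k (l : link k) : ('I_d -> R) -> R :=
  match l with
  | inl (inl i) => phi k (fun j => val (i j))
  | inl (inr (i, o)) => phi k (cap_shift k (fun j => val (i j)) (fun j => val (o j)))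
  | inr _ => fun=> 1
  end.

Definition link_lo k (l : link k) : ('I_d -> R) -> R :=
  match l with
  | inl (inl i) => phi k.-1 (fun j => (val (i j))./2)
  | inl (inr (i, o)) => phi k (fun j => val (i j))
  | inr _ => phi k (top_cell k)
  end.

Definition link_fun k (l : link k) : ('I_d -> R) -> R := fun y => link_hi l y - link_lo l y.

Lemma G_obs f M : G f -> (forall y, `|f y| <= M) -> obs_bmeas f.
Proof. by move=> Gf fM i; exact: (G_bmeas mX hG). Qed.

Lemma obs_phi k i : (forall j, (i j <= 2 ^ k)%N) -> obs_bmeas (phi k i).
Proof.
move=> ik; have [Gp Bp _] := hphi ik; apply: (G_obs (M := 1) Gp) => y.
by have /andP[? ?] := bracket_itv y Bp; rewrite ger0_norm.
Qed.

Lemma lt_expn0 v : (v < 2 ^ 0)%N -> v = 0%N.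
Proof. by rewrite expn0 ltnS leqn0 => /eqP. Qed.

Lemma half_lt_expn k v : (v < 2 ^ k)%N -> (v./2 <= 2 ^ k.-1)%N.
Proof. by case: k => [/lt_expn0 ->//|k]; rewrite expnS /=; lia. Qed.

Lemma half_le k (i : {ffun 'I_d -> 'I_(2 ^ k)}) j : ((val (i j))./2 <= 2 ^ k.-1)%N.
Proof. exact/half_lt_expn/ltn_ord. Qed.

(** Both functions of a link lie between indicators of boxes at most four meshes apart in each
    coordinate. Their difference thus has mean absolute value at most 4 d / 2^k, which is the decay
    that [tail_bound] asks for. *)
Lemma link_bracket k (l : link k) : exists u v, [/\ forall j, u j <= v j,
  \sum_j (v j - u j) <= 4 * d%:R / 2 ^+ k, bracket u v (link_hi l) & bracket u v (link_lo l)].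
Proof.
have k0 : 0 < (2 ^+ k)^-1 :> R by rewrite invr_gt0 exprn_gt0.
have sumb (u v : 'I_d -> R) : (forall j, v j - u j <= 4 / 2 ^+ k) ->
    \sum_j (v j - u j) <= 4 * d%:R / 2 ^+ k.
  move=> h; apply: (@le_trans _ _ (\sum_(j < d) 4 / 2 ^+ k)); first exact: ler_sum.
  by rewrite sumr_const card_ord -mulr_natl; lra.
case: l => [[i|[i o]]|[]] /=.
(* In units of 2^-k the parent's lower level is twice (half i - 1), rounded down, hence at least i -
   3. *)
- exists (fun j => ((val (i j))%:R - 3) / 2 ^+ k), (fun j => (val (i j))%:R / 2 ^+ k); split.
  + by move=> j; rewrite ler_wpM2r ?(ltW k0)//; lra.
  + by apply: sumb => j; rewrite -mulrBl ler_wpM2r ?(ltW k0)//; lra.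
  + have [|_ h _] := @hphi k (fun j => val (i j)); first by move=> j; exact/ltnW/ltn_ord.
    by apply: bracket_sub h => j //; rewrite ler_wpM2r ?(ltW k0)//; lra.
  + have [|_ h _] := @hphi k.-1 (fun j => (val (i j))./2); first by move=> j; exact: half_le.
    apply: bracket_sub h => j /=.
      case: k i {sumb} k0 => [|k] i k0.
        have -> : val (i j) = 0%N by exact/lt_expn0/ltn_ord.
        by rewrite ler_wpM2r ?(ltW k0)//= mulr0n; lra.
      rewrite /= exprS invfM mulrA ler_wpM2r ?invr_ge0 ?exprn_ge0//.
      rewrite ler_pdivrMr//.
      have : (val (i j))%:R <= ((val (i j))./2).*2.+1%:R :> R by rewrite ler_nat; lia.
      by rewrite -natr1 -muln2 natrM; lra.
    case: k i {sumb} k0 => [|k] i k0.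
      by have -> : val (i j) = 0%N by exact/lt_expn0/ltn_ord.
    rewrite /= exprS invfM mulrA ler_wpM2r ?invr_ge0 ?exprn_ge0//.
    by rewrite ler_pdivlMr// -natrM ler_nat; lia.
- exists (fun j => ((val (i j))%:R - 1) / 2 ^+ k), (fun j => ((val (i j))%:R + 2) / 2 ^+ k); split.
  + by move=> j; rewrite ler_wpM2r ?(ltW k0)//; lra.
  + by apply: sumb => j; rewrite -mulrBl ler_wpM2r ?(ltW k0)//; lra.
  + have [|_ h _] := @hphi k (cap_shift k (fun j => val (i j)) (fun j => val (o j))).
      by move=> j; rewrite /cap_shift geq_minr.
    have bo2 := fun j => ltn_ord (o j).
    apply: bracket_sub h => j; rewrite ler_wpM2r ?(ltW k0)//.
      have : (val (i j))%:R <= (cap_shift k (fun j => val (i j)) (fun j => val (o j)) j)%:R :> R.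
        by rewrite ler_nat /cap_shift leq_min leq_addr ltnW// ltn_ord.
      lra.
    have : (cap_shift k (fun j => val (i j)) (fun j => val (o j)) j)%:R <= (val (i j) + 2)%:R :> R.
      by rewrite ler_nat /cap_shift geq_min leq_add2l -ltnS bo2.
    by rewrite natrD.
  + have [|_ h _] := @hphi k (fun j => val (i j)); first by move=> j; exact/ltnW/ltn_ord.
    by apply: bracket_sub h => j //; rewrite ler_wpM2r ?(ltW k0)//; lra.
- have z : (0 < 2 ^ k)%N by rewrite expn_gt0.
  have topE : (2 ^ k - 1)%:R = 2 ^+ k - 1 :> R by rewrite natrB// natrX.
  have kk : 2 ^+ k / 2 ^+ k = 1 :> R by rewrite divff ?gt_eqF ?exprn_gt0.
  exists (fun=> (2 ^+ k - 2) / 2 ^+ k), (fun=> 1); split.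
  + by move=> j /=; rewrite -[leRHS]kk ler_wpM2r ?(ltW k0)//; lra.
  + by apply: sumb => j /=; rewrite -[X in X - _]kk -mulrBl ler_wpM2r ?(ltW k0)//; lra.
  + move=> y; split; first by case/andP: (ind_itv (qv (fun=> (2 ^+ k - 2) / 2 ^+ k)) y).
    rewrite indE; case: asboolP => // h; exfalso; apply: h => j.
    by rewrite /qvec qtY// leey.
  + have [|_ h _] := @hphi k (top_cell k); first by move=> j; exact: leq_subr.
    apply: bracket_sub h => j /=; rewrite /top_cell topE.
      by rewrite ler_wpM2r ?(ltW k0)//; lra.
    by rewrite -[leRHS]kk ler_wpM2r ?(ltW k0)//; lra.
Qed.

Lemma link_G k (l : link k) : [/\ G (link_hi l), G (link_lo l) &
  nG (link_hi l) + nG (link_lo l) <= (2 * C1 + nG (fun=> 1)) * a ^+ k].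
Proof.
case: (hG) => _ Gc _ _ [nG0 _ _].
have a1 : 1 <= a by exact: rate_ge1.
have ak : 1 <= a ^+ k by exact: exprn_ege1.
have n1 : 0 <= nG (fun=> 1) by apply: nG0; exact: Gc.
have n1k : nG (fun=> 1) <= nG (fun=> 1) * a ^+ k by rewrite ler_peMr.
have n1k0 : 0 <= nG (fun=> 1) * a ^+ k by exact: le_trans n1k.
have Ck0 : 0 <= C1 * a ^+ k by rewrite mulr_ge0// (le_trans ler01).
case: l => [[i|[i o]]|[]] /=.
- have [|G1 _ h1] := @hphi k (fun j => val (i j)); first by move=> j; exact/ltnW/ltn_ord.
  have [|G2 _ h2] := @hphi k.-1 (fun j => (val (i j))./2); first by move=> j; exact: half_le.
  split=> //.
  have : C1 * a ^+ k.-1 <= C1 * a ^+ k by rewrite ler_wpM2l// ler_weXn2l// leq_pred.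
  lra.
- have [|G1 _ h1] := @hphi k (cap_shift k (fun j => val (i j)) (fun j => val (o j))).
    by move=> j; rewrite /cap_shift geq_minr.
  have [|G2 _ h2] := @hphi k (fun j => val (i j)); first by move=> j; exact/ltnW/ltn_ord.
  split=> //; lra.
- have [|G2 _ h2] := @hphi k (top_cell k); first by move=> j; exact: leq_subr.
  split=> //; lra.
Qed.

Lemma link_obs k (l : link k) : obs_bmeas (link_hi l) /\ obs_bmeas (link_lo l).
Proof.
have [u [v [_ _ h1 h2]]] := link_bracket l; have [G1 G2 _] := link_G l.
by split; [apply: (G_obs (M := 1) G1)|apply: (G_obs (M := 1) G2)] => y;
  [have /andP[? ?] := bracket_itv y h1|have /andP[? ?] := bracket_itv y h2]; rewrite ger0_norm.
Qed.

(* Only generations with 2^k <= n are controlled: below that scale, the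
   deterministic increment sqrt n / 2^k of the brackets is negligible. *)
Definition good (n m : nat) : set T :=
  [set w | forall k, (2 ^ k <= n)%N -> forall l : link k, `|emp n (link_fun l) w| <= 2 ^+ m * x ^+ k].

Definition bad n m k (l : link k) : set T :=
  [set w | 2 ^+ m * x ^+ k <= `|emp n (link_fun l) w|].

Lemma bmeas_emp n f : obs_bmeas f -> bmeas (emp n f).
Proof.
move=> bf; apply: bmeasZ; apply: bmeas_sum => i _.
by apply: bmeasB => //; exact: bmeas_cst.
Qed.

Lemma link_fun_obs k (l : link k) : obs_bmeas (link_fun l).
Proof. by have [h1 h2] := link_obs l => i; exact: bmeasB. Qed.

Lemma measurable_good n m : measurable (good n m).
Proof.
rewrite (_ : good n m = \bigcap_k (if (2 ^ k <= n)%N then \bigcap_(l in [set: link k])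
   [set w | `|emp n (link_fun l) w| <= 2 ^+ m * x ^+ k] else setT)); last first.
  apply/seteqP; split=> w h k; first by move=> _; case: ifP => // kn l _; exact: h.
  by move=> kn l; have := h k Logic.I; rewrite kn => /(_ l Logic.I).
apply: bigcapT_measurable => k; case: ifP => // _.
apply: fin_bigcap_measurable => // l _.
rewrite -[X in measurable X]setTI; apply: measurable_fun_le => //.
by apply: measurableT_comp => //; exact: (bmeas_emp n (@link_fun_obs k l)).1.
Qed.

Lemma measurable_bad n m k (l : link k) : measurable (bad n m l).
Proof.
rewrite -[X in measurable X]setTI; apply: measurable_fun_le => //.
by apply: measurableT_comp => //; exact: (bmeas_emp n (@link_fun_obs k l)).1.
Qed.

Lemma card_link k : (#|link k| <= (2 + 3 ^ d) * 2 ^ (k * d))%N.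
Proof.
rewrite !card_sum card_prod card_unit !card_ffun !card_ord -expnM.
have : (0 < 2 ^ (k * d))%N by rewrite expn_gt0.
move: (2 ^ (k * d))%N (3 ^ d)%N => A B; nia.
Qed.

Lemma geo_sum_le (t : R) n : 0 <= t < 1 -> \sum_(k < n) t ^+ k <= (1 - t)^-1.
Proof.
move=> /andP[t0 t1]; have t1' : 0 < 1 - t by rewrite subr_gt0.
rewrite -[leRHS]mulr1 ler_pdivlMl//.
have h1 := subrX1 t n; have h2 : 0 <= t ^+ n by rewrite exprn_ge0.
lra.
Qed.

Context (r : R) (Theta : nat -> R) (p : nat).
Hypothesis sX : stationary P X.
Hypothesis hmix : multiple_mixing P X G nG Theta r.
Hypothesis p0 : (0 < p)%N.
Hypothesis hsum : (\sum_(0 <= i <oo) (((i ^ (2 * p - 2))%N)%:R * Theta i)%:E < +oo)%E.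
Local Notation b := (2 `^ (- r^-1) : R).
Hypothesis hx : 2 ^+ d * (a * b) ^+ p < x ^+ (2 * p).

(** A union bound over links and generations. Generation k contributes a multiple of th^k / 4^(m p)
    with th = 2^d (a b)^p / x^(2p) < 1, so the geometric series is bounded uniformly in [n]; the
    factor 4^(m p) is the threshold 2^m raised to the power 2p. *)
Lemma prob_good : exists2 C, 0 <= C & forall n m, prob P (~` good n m) <= C / 4 ^+ (m * p).
Proof.
case: (hG) => _ Gc GD GZ [nG0 nGD nGZ].
have n1 : 0 <= nG (fun=> 1) by apply: nG0; exact: Gc.
pose c := 2 * C1 + nG (fun=> 1) + 4 * d%:R.
have c0 : 0 <= c by rewrite !addr_ge0// ?mulr_ge0.
have a1 : 1 <= a by exact: rate_ge1.
have ab0 : 0 <= a * b by rewrite mulr_ge0 ?powR_ge0.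
have [C C0 hC] := tail_bound mX sX hG hmix p0 hsum gamma0 c0.
pose th := 2 ^+ d * (a * b) ^+ p / x ^+ (2 * p).
have x2p : 0 < x ^+ (2 * p) by exact: exprn_gt0.
have th01 : 0 <= th < 1.
  by rewrite /th divr_ge0 ?mulr_ge0 ?exprn_ge0 ?(ltW x0)//= ltr_pdivrMr// mul1r.
exists ((2 + 3 ^ d)%:R * C / (1 - th)).
  by rewrite divr_ge0 ?mulr_ge0// subr_ge0; case/andP: th01 => _ /ltW.
move=> n m.
have lbound k (l : link k) : (2 ^ k <= n)%N ->
    prob P (bad n m l) <= C * (a * b) ^+ (k * p) / (2 ^+ m * x ^+ k) ^+ (2 * p).
  move=> kn; have [G1 G2 hn] := link_G l; have [bo1 bo2] := link_obs l.
  have [u [v [uv uvd b1 b2]]] := link_bracket l.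
  have GN : G (fun y => -1 * link_lo l y) by exact: GZ.
  have lE : link_fun l = (fun y => link_hi l y + -1 * link_lo l y).
    by apply/funext => y; rewrite mulN1r.
  apply: hC => //.
  - by rewrite lE; exact: GD.
  - move=> y; have /andP[? ?] := bracket_itv y b1; have /andP[? ?] := bracket_itv y b2.
    by rewrite /link_fun ler_norml; apply/andP; split; lra.
  - rewrite lE (le_trans (nGD _ _ G1 GN))// nGZ// normrN1 mul1r (le_trans hn)//.
    by rewrite ler_wpM2r ?exprn_ge0 ?powR_ge0// /c lerDl mulr_ge0.
  - apply: (le_trans (mean_bracket_diff uv bo1 bo2 b1 b2)); apply: (le_trans uvd).
    by rewrite ler_wpM2r ?invr_ge0 ?exprn_ge0// /c lerDr addr_ge0// mulr_ge0.
  - by rewrite mulr_gt0 ?exprn_gt0.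
pose B (k : nat) := if (2 ^ k <= n)%N then \big[setU/set0]_(l : link k) bad n m l else set0.
have mB k : measurable (B k).
  rewrite /B; case: ifP => // _; apply: bigsetU_measurable => l _; exact: measurable_bad.
have sub : ~` good n m `<=` \big[setU/set0]_(k < n) B k.
  move=> w /existsNP[k /not_implyP[kn /existsNP[l /negP]]]; rewrite -ltNge => h.
  have kltn : (k < n)%N by rewrite (leq_trans _ kn)// ltn_expl.
  rewrite -bigcup_mkord; exists k => //; rewrite /B kn.
  by rewrite -bigcup_seq; exists l; [rewrite /= mem_index_enum|exact: ltW].
have pB k : prob P (B k) <= (2 + 3 ^ d)%:R * C * th ^+ k / 4 ^+ (m * p).
  rewrite /B; case: ifP => kn; last first.
    rewrite /prob measure0/= divr_ge0 ?mulr_ge0 ?exprn_ge0//.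
    by case/andP: th01.
  apply: (le_trans (prob_bigsetU_le _ _ _)); first by move=> l; exact: measurable_bad.
  pose D := C * (a * b) ^+ (k * p) / (2 ^+ m * x ^+ k) ^+ (2 * p).
  have D0 : 0 <= D.
    by rewrite divr_ge0 ?mulr_ge0 ?exprn_ge0// mulr_ge0 ?exprn_ge0// ltW.
  apply: (@le_trans _ _ (\sum_(l : link k) D)); first by apply: ler_sum => l _; exact: lbound.
  rewrite sumr_const -[leLHS]mulr_natl.
  apply: (@le_trans _ _ (((2 + 3 ^ d) * 2 ^ (k * d))%:R * D)).
    by rewrite ler_wpM2r// ler_nat; exact: card_link.
  rewrite le_eqVlt; apply/orP; left; apply/eqP.
  rewrite /D /th natrM natrX !exprMn !exprVn -!exprM.
  have -> : 4 ^+ (m * p) = 2 ^+ (m * (2 * p)) :> R.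
    rewrite (mulnCA m 2 p).
    by rewrite [RHS]exprM; congr (_ ^+ _); rewrite expr2; ring.
  rewrite [(d * k)%N]mulnC [(p * k)%N]mulnC [(2 * p * k)%N]mulnC.
  have e1 : (2 ^+ (m * (2 * p)) : R) != 0 by rewrite gt_eqF ?exprn_gt0.
  have e2 : x ^+ (k * (2 * p)) != 0 by rewrite gt_eqF ?exprn_gt0.
  field; by rewrite e1 e2.
apply: (@le_trans _ _ (\sum_(k < n) prob P (B k))).
  apply: le_trans (@prob_bigsetU_le _ _ _ P _ (index_enum 'I_n) (fun k : 'I_n => B k) (fun k => mB k)).
  apply: le_prob => //.
    by apply: measurableC; exact: measurable_good.
  by apply: bigsetU_measurable.
apply: (@le_trans _ _ (\sum_(k < n) (2 + 3 ^ d)%:R * C * th ^+ k / 4 ^+ (m * p))).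
  by apply: ler_sum => k _; exact: pB.
rewrite -mulr_suml ler_wpM2r ?invr_ge0 ?exprn_ge0// -mulr_sumr ler_wpM2l ?mulr_ge0//.
exact: geo_sum_le.
Qed.

End Chaining.

(** * The empirical process on good events *)

Section ChainingBounds.
Context {R : realType} {dT} {T : measurableType dT} (P : probability T R) (d : nat).
Context (X : nat -> T -> 'I_d -> R) (G : set (('I_d -> R) -> R)) (nG : (('I_d -> R) -> R) -> R).
Hypothesis d0 : (0 < d)%N.
Hypothesis mX : forall i j, measurable_fun setT (fun w => X i w j).
Hypothesis cF : distF_continuous P X.
Hypothesis hG : function_space G nG.
Context (gamma : R) (phi : nat -> ('I_d -> nat) -> ('I_d -> R) -> R) (C1 : R) (x : R).
Hypothesis gamma0 : 0 < gamma.
Hypothesis C10 : 0 <= C1.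
Hypothesis hphi : forall k i, (forall j, (i j <= 2 ^ k)%N) -> [/\ G (phi k i),
  bracket P X (fun j => ((i j)%:R - 1) / 2 ^+ k) (fun j => (i j)%:R / 2 ^+ k) (phi k i) &
  nG (phi k i) <= C1 * (2 `^ gamma^-1) ^+ k].
Hypotheses (x0 : 0 < x) (x1 : x < 1).

Local Notation qv := (qvec P X).
Local Notation emp := (emp P X).
Local Notation mean := (mean P X).
Local Notation cell := (cell P X).
Local Notation good := (good P X phi x).
Local Notation Y k t := (phi k (cell k t)).

Let cell_lt' k t j : (cell k t j < 2 ^ k)%N. Proof. exact: cell_lt. Qed.
Let cell_le' k t j : (cell k t j <= 2 ^ k)%N. Proof. exact/ltnW/cell_lt. Qed.
Let obs k i : (forall j, (i j <= 2 ^ k)%N) -> obs_bmeas X (phi k i).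
Proof. by move=> ik; exact: (obs_phi mX hG hphi). Qed.
Let obs1 : obs_bmeas X (fun=> 1 : R).
Proof. by move=> i; exact: bmeas_cst. Qed.

Lemma emp_link n m k w i o : (2 ^ k <= n)%N -> good n m w ->
  (forall j, (i j < 2 ^ k)%N) -> (forall j, (o j < 3)%N) ->
  `|emp n (phi k (cap_shift k i o)) w - emp n (phi k i) w| <= 2 ^+ m * x ^+ k.
Proof.
move=> kn gw ik o3.
pose fi : {ffun 'I_d -> 'I_(2 ^ k)} := [ffun j => Ordinal (ik j)].
pose fo : {ffun 'I_d -> 'I_3} := [ffun j => Ordinal (o3 j)].
have fiE : (fun j => val (fi j)) = i by apply/funext => j; rewrite ffunE.
have foE : (fun j => val (fo j)) = o by apply/funext => j; rewrite ffunE.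
have := gw k kn (inl (inr (fi, fo)) : link d k); rewrite /link_fun /link_hi /link_lo fiE foE.
rewrite empB//; apply: obs => j; last exact: ltnW.
by rewrite /cap_shift geq_minr.
Qed.

Lemma emp_refine n m k w t : (2 ^ k.+1 <= n)%N -> good n m w ->
  `|emp n (Y k.+1 t) w - emp n (Y k t) w| <= 2 ^+ m * x ^+ k.+1.
Proof.
move=> kn gw.
pose fi : {ffun 'I_d -> 'I_(2 ^ k.+1)} := [ffun j => Ordinal (cell_lt' k.+1 t j)].
have fiE : (fun j => val (fi j)) = cell k.+1 t by apply/funext => j; rewrite ffunE.
have fiE2 : (fun j => (val (fi j))./2) = cell k t.
  by apply/funext => j; rewrite ffunE /= cell_half.
have := gw k.+1 kn (inl (inl fi) : link d k.+1); rewrite /link_fun /link_hi /link_lo fiE fiE2 /=.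
by rewrite empB//; apply: obs => j; exact: cell_le'.
Qed.

Lemma emp_top n m k w : (2 ^ k <= n)%N -> good n m w ->
  `|emp n (phi k (@top_cell d k)) w| <= 2 ^+ m * x ^+ k.
Proof.
move=> kn gw; have := gw k kn (inr tt : link d k); rewrite /link_fun /link_hi /link_lo.
rewrite empB//; first by rewrite emp_cst sub0r normrN.
by apply: obs => j; exact: leq_subr.
Qed.

(** The geometric sum is kept in its exact form, since the induction on [l] needs the term with k +
    l. *)
Lemma emp_chain n m k l w t : (2 ^ (k + l) <= n)%N -> good n m w ->
  `|emp n (Y (k + l) t) w - emp n (Y k t) w| <= 2 ^+ m * ((x ^+ k - x ^+ (k + l)) / (1 - x)).
Proof.
have x1' : 0 < 1 - x by rewrite subr_gt0.
elim: l => [|l IH] kn gw; first by rewrite addn0 !subrr normr0 mul0r mulr0.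
rewrite addnS in kn *.
have kn' : (2 ^ (k + l) <= n)%N by rewrite (leq_trans _ kn)// leq_exp2l.
rewrite (le_trans (ler_distD (emp n (Y (k + l) t) w) _ _))//.
apply: (le_trans (lerD (emp_refine t kn gw) (IH kn' gw))).
rewrite -mulrDr ler_wpM2l ?exprn_ge0// -lerBrDr -mulrBl.
rewrite [leRHS](_ : _ = x ^+ (k + l)); last first.
  have -> : x ^+ k - x ^+ (k + l).+1 - (x ^+ k - x ^+ (k + l)) = x ^+ (k + l) * (1 - x).
    by rewrite exprS; ring.
  by rewrite mulfK// gt_eqF.
by rewrite exprS ler_piMl ?exprn_ge0// ltW.
Qed.

(** Stopping at a generation with 2^K comparable to n turns the drift, of order sqrt n / 2^K, into
    one of order 1 / sqrt n. *)
Lemma sqrt_scale n K (D : R) : (0 < n)%N -> (n < 2 ^ K.+1)%N -> 0 <= D ->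
  Num.sqrt n%:R * (D / 2 ^+ K) <= 2 * D * (Num.sqrt n%:R)^-1.
Proof.
move=> n0 nK D0; have s0 : 0 < Num.sqrt n%:R :> R by rewrite sqrtr_gt0 ltr0n.
rewrite ler_pdivlMr// mulrAC -expr2 sqr_sqrtr// mulrA ler_pdivrMr ?exprn_gt0//.
have : n%:R <= 2 * 2 ^+ K :> R by rewrite -exprS -natrX ler_nat ltnW.
have : 0 <= 2 ^+ K :> R by rewrite exprn_ge0.
nra.
Qed.

(** A shift by 2 is needed because the lower bracket lies one level below the index and must reach
    the upper end of the cell. In the last cell the shift is capped and a boundary layer is missed;
    there the approximant of index [top_cell] vanishes and the second summand equals 1. *)
Lemma emp_upper k t y : ind t y <=
  phi k (cap_shift k (cell k t) (fun=> 2%N)) y + (1 - phi k (@top_cell d k) y).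
Proof.
have [|_ B1 _] := @hphi k (cap_shift k (cell k t) (fun=> 2%N)).
  by move=> j; rewrite /cap_shift geq_minr.
have [|_ B2 _] := @hphi k (@top_cell d k); first by move=> j; exact: leq_subr.
have [l1 u1] := B1 y; have [l2 u2] := B2 y.
have /andP[p0 p1] := bracket_itv y B1; have /andP[q0 q1] := bracket_itv y B2.
have /andP[_ i1] := ind_itv t y.
move: u2; rewrite indE; case: asboolP => [ytop|_] u2; last by rewrite mulr0n in u2; lra.
suff : ind t y <= phi k (cap_shift k (cell k t) (fun=> 2%N)) y by lra.
apply: le_trans l1; rewrite !indE ler_nat; case: asboolP => // yt.
case: asboolP => // [[]] j; rewrite /qvec /cap_shift /=.
have z : (0 < 2 ^ k)%N by rewrite expn_gt0.
have [h|h] := leqP (cell k t j + 2)%N (2 ^ k)%N.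
  rewrite natrD -addrA (_ : 2 - 1 = 1 :> R); last by lra.
  rewrite natr1; apply: le_trans (yt j) _; exact: cell_ge.
apply: le_trans (ytop j) _.
rewrite /qvec /top_cell natrB//.
Qed.

(** [emp_chain] leads from generation k to K = [trunc_log 2 n]. At generation K the indicator is
    enclosed between functions built from approximants with means O(2^-K) apart, and [emp_le] with
    [sqrt_scale] bounds what remains. *)
Lemma emp_approx : exists2 c, 0 <= c & forall n m k w t, (2 ^ k <= n)%N -> good n m w ->
  `|emp n (ind t) w - emp n (Y k t) w| <= c * (2 ^+ m * x ^+ k + (Num.sqrt n%:R)^-1).
Proof.
have x1' : 0 < 1 - x by rewrite subr_gt0.
(* The inverse of 1 - x sums the chain, 2 counts the two links used in the upper enclosure, and 14 d
   is twice the 3 d + 4 d meshes separating the means there. *)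
exists ((1 - x)^-1 + 2 + 14 * d%:R); first by rewrite !addr_ge0 ?mulr_ge0// invr_ge0 ltW.
move=> n m k w t kn gw.
have n0 : (0 < n)%N by rewrite (leq_trans _ kn)// expn_gt0.
have s0 : 0 < (Num.sqrt n%:R)^-1 :> R by rewrite invr_gt0 sqrtr_gt0 ltr0n.
set K := trunc_log 2 n.
have Kn : (2 ^ K <= n)%N by rewrite trunc_logP.
have nK : (n < 2 ^ K.+1)%N by rewrite trunc_log_ltn.
have kK : (k <= K)%N by rewrite trunc_log_max.
have chain := @emp_chain n m k (K - k) w t; rewrite subnKC// in chain.
have {chain}ch := chain Kn gw.
set M := 2 ^+ m : R in ch *; have M0 : 0 <= M by rewrite exprn_ge0.
pose J2 := cap_shift K (cell K t) (fun=> 2%N).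
have J2le j : (J2 j <= 2 ^ K)%N by rewrite /J2 /cap_shift geq_minr.
have tople j : (@top_cell d K j <= 2 ^ K)%N by exact: leq_subr.
have [_ BY _] := hphi (cell_le' K t).
have [_ BJ _] := hphi J2le.
have [_ BT _] := hphi tople.
have oY := obs (cell_le' K t); have oJ := obs J2le; have oT := obs tople.
have oI : obs_bmeas X (ind t) by exact: obs_ind.
have K0 : 0 < (2 ^+ K)^-1 :> R by rewrite invr_gt0 exprn_gt0.
have sumb (u v : 'I_d -> R) D : (forall j, v j - u j <= D / 2 ^+ K) ->
    \sum_j (v j - u j) <= D * d%:R / 2 ^+ K.
  move=> h; apply: (@le_trans _ _ (\sum_(j < d) D / 2 ^+ K)); first exact: ler_sum.
  by rewrite sumr_const card_ord -[leLHS]mulr_natl; lra.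
have mdiff f g u v D : obs_bmeas X f -> obs_bmeas X g -> (forall j, u j <= v j) ->
    bracket P X u v f -> bracket P X u v g -> (forall j, v j - u j <= D / 2 ^+ K) ->
    mean f - mean g <= D * d%:R / 2 ^+ K.
  move=> bf bg uv hf hg uvD; rewrite -meanB//.
  apply: (@le_trans _ _ (mean (fun y => `|f y - g y|))).
    apply: le_mean; [by move=> i; exact: bmeasB|by move=> i; apply: bmeas_norm; exact: bmeasB|].
    by move=> y; exact: ler_norm.
  by apply: le_trans (sumb _ _ _ uvD); exact: mean_bracket_diff.
have indlo : bracket P X (fun j => ((cell K t j)%:R - 1) / 2 ^+ K)
   (fun j => ((cell K t j)%:R + 2) / 2 ^+ K) (ind t).
  apply: bracket_sub (ind_cell mX cF K t) => // j; rewrite ler_wpM2r ?(ltW K0)//; first lra.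
  by rewrite -natr1; lra.
have Ylo : bracket P X (fun j => ((cell K t j)%:R - 1) / 2 ^+ K)
   (fun j => ((cell K t j)%:R + 2) / 2 ^+ K) (Y K t).
  by apply: bracket_sub BY => // j; rewrite ler_wpM2r ?(ltW K0)//; lra.
have Jlo : bracket P X (fun j => ((cell K t j)%:R - 1) / 2 ^+ K)
   (fun j => ((cell K t j)%:R + 2) / 2 ^+ K) (phi K J2).
  have lo j : (cell K t j)%:R <= (J2 j)%:R :> R.
    by rewrite ler_nat /J2 /cap_shift leq_min leq_addr ltnW// cell_lt'.
  have hi j : (J2 j)%:R <= (cell K t j)%:R + 2 :> R.
    by rewrite -natrD ler_nat /J2 /cap_shift geq_minl.
  apply: bracket_sub BJ => // j; rewrite ler_wpM2r ?(ltW K0)//.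
  by have := lo j; lra.
have uvle j : ((cell K t j)%:R - 1) / 2 ^+ K <= ((cell K t j)%:R + 2) / 2 ^+ K :> R.
  by rewrite ler_wpM2r ?(ltW K0)//; lra.
have uv3 j : ((cell K t j)%:R + 2) / 2 ^+ K - ((cell K t j)%:R - 1) / 2 ^+ K <= 3 / 2 ^+ K :> R.
  by rewrite -mulrBl ler_wpM2r ?(ltW K0)//; lra.
have d0' : 0 <= d%:R :> R by [].
have low : emp n (Y K t) w - emp n (ind t) w <= 6 * d%:R * (Num.sqrt n%:R)^-1.
  have le_Y y : Y K t y <= ind t y.
    have [_ h] := BY y; apply: (le_trans h); apply: le_ind => j; exact: cell_le.
  apply: (le_trans (emp_le P n w oY oI le_Y)).
  apply: (@le_trans _ _ (Num.sqrt n%:R * (3 * d%:R / 2 ^+ K))).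
    by rewrite ler_wpM2l ?sqrtr_ge0//; exact: (mdiff _ _ _ _ _ oI oY uvle).
  apply: (le_trans (sqrt_scale n0 nK _)); [exact: mulr_ge0|lra].
have up : emp n (ind t) w - emp n (Y K t) w <= 2 * (M * x ^+ K) + 14 * d%:R * (Num.sqrt n%:R)^-1.
  pose psi y : R := phi K J2 y - (phi K (@top_cell d K) y - 1).
  have oT1 : obs_bmeas X (fun y => phi K (@top_cell d K) y - 1).
    by move=> i; apply: bmeasB; [exact: oT|exact: bmeas_cst].
  have opsi : obs_bmeas X psi by move=> i; apply: bmeasB; [exact: oJ|exact: oT1].
  have le_psi y : ind t y <= psi y by have := emp_upper K t y; rewrite /psi -/J2; lra.
  have h1 := emp_le P n w oI opsi le_psi.
  have h2 : emp n psi w = emp n (phi K J2) w - emp n (phi K (@top_cell d K)) w.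
    by rewrite /psi empB// empB// emp_cst subr0.
  have h3 : mean psi = mean (phi K J2) - (mean (phi K (@top_cell d K)) - mean (fun=> 1)).
    by rewrite /psi meanB// meanB.
  have h4 : mean (phi K J2) - mean (ind t) <= 3 * d%:R / 2 ^+ K.
    exact: (mdiff _ _ _ _ _ oJ oI uvle).
  have h5 : mean (fun=> 1) - mean (phi K (@top_cell d K)) <= 4 * d%:R / 2 ^+ K.
    have [u [v [uv uvd b1 b2]]] := link_bracket mX cF gamma0 C10 hphi x0 (inr tt : link d K).
    apply: le_trans uvd; rewrite -meanB//.
    apply: le_trans (mean_bracket_diff mX cF uv obs1 oT b1 b2).
    have o1T : obs_bmeas X (fun y => 1 - phi K (@top_cell d K) y).
      by move=> i; apply: bmeasB; [exact: bmeas_cst|exact: oT].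
    apply: le_mean => // [i|y]; last exact: ler_norm.
    by apply: bmeas_norm; exact: o1T.
  have h6 := emp_link Kn gw (cell_lt' K t) (fun=> erefl : (2 < 3)%N); rewrite -/J2 -/M in h6.
  have h7 := emp_top Kn gw; rewrite -/M in h7.
  have h8 : Num.sqrt n%:R * (mean psi - mean (ind t)) <= 14 * d%:R * (Num.sqrt n%:R)^-1.
    apply: (@le_trans _ _ (Num.sqrt n%:R * (7 * d%:R / 2 ^+ K))).
      by rewrite ler_wpM2l ?sqrtr_ge0//; lra.
    apply: (le_trans (sqrt_scale n0 nK _)); [exact: mulr_ge0|lra].
  have h9 := ler_norm (emp n (phi K J2) w - emp n (Y K t) w).
  have h10 := lerNnormlW h7.
  lra.
have xKk : x ^+ K <= x ^+ k by rewrite ler_wiXn2l// ltW.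
have xK0 : 0 <= x ^+ K by rewrite exprn_ge0// ltW.
have ch2 : `|emp n (Y K t) w - emp n (Y k t) w| <= M * (x ^+ k / (1 - x)).
  apply: (le_trans ch); rewrite ler_wpM2l// ler_wpM2r ?invr_ge0 ?(ltW x1')//.
  by rewrite gerBl.
have MxK : M * x ^+ K <= M * x ^+ k by rewrite ler_wpM2l.
have MxK0 : 0 <= M * x ^+ K by rewrite mulr_ge0.
rewrite (le_trans (ler_distD (emp n (Y K t) w) _ _))//.
have AB : `|emp n (ind t) w - emp n (Y K t) w| <= 2 * (M * x ^+ K) + 14 * d%:R * (Num.sqrt n%:R)^-1.
  have ds : (0 : R) <= d%:R * (Num.sqrt n%:R)^-1 by rewrite mulr_ge0// ltW.
  by rewrite ler_norml; apply/andP; split; lra.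
apply: (le_trans (lerD AB ch2)).
have xk0 : 0 <= x ^+ k by rewrite exprn_ge0// ltW.
have Mxk0 : 0 <= M * x ^+ k by rewrite mulr_ge0.
rewrite mulrDr [M * (_ / _)]mulrA.
have e1 : (0 : R) <= (1 - x)^-1 * (Num.sqrt n%:R)^-1 by rewrite mulr_ge0 ?ltW// invr_gt0.
have e2 : 0 <= d%:R * (M * x ^+ k) by rewrite mulr_ge0.
move: MxK e1 e2 s0 Mxk0; move: (M * x ^+ K) (M * x ^+ k) ((Num.sqrt n%:R)^-1) (d%:R : R) ((1 - x)^-1).
move=> A B s D z h1 h2 h3 h4 h5; rewrite !mulrDl [B * z]mulrC; lra.
Qed.

(** Two adjacent cells are compared through the coordinatewise minimum of their indices: each is
    reached from it by a single link with small offsets. *)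
Lemma emp_equicont : exists2 c, 0 <= c & forall n m k w s t, (2 ^ k <= n)%N -> good n m w ->
  (forall j, (cell k s j <= (cell k t j).+1)%N && (cell k t j <= (cell k s j).+1)%N) ->
  `|emp n (ind s) w - emp n (ind t) w| <= c * (2 ^+ m * x ^+ k + (Num.sqrt n%:R)^-1).
Proof.
have [c c0 hc] := emp_approx; exists (2 * c + 2); first by rewrite addr_ge0// mulr_ge0.
move=> n m k w s t kn gw adj.
have hs := hc n m k w s kn gw; have ht := hc n m k w t kn gw.
pose i j := minn (cell k s j) (cell k t j).
have ik j : (i j < 2 ^ k)%N by rewrite /i gtn_min cell_lt'.
have aux u : (forall j, cell k u j <= (i j).+2)%N -> (forall j, i j <= cell k u j)%N ->
    `|emp n (Y k u) w - emp n (phi k i) w| <= 2 ^+ m * x ^+ k.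
  move=> u1 u2; have := emp_link (o := fun j => (cell k u j - i j)%N) kn gw ik.
  have -> : cap_shift k i (fun j => (cell k u j - i j)%N) = cell k u.
    by apply/funext => j; rewrite /cap_shift subnKC// (minn_idPl _).
  apply=> j; have := u1 j; lia.
have s1 : `|emp n (Y k s) w - emp n (phi k i) w| <= 2 ^+ m * x ^+ k.
  apply: aux => j; rewrite /i; last exact: geq_minl.
  by move: (adj j); move: (cell k s j) (cell k t j); clear => a b /andP[]; lia.
have t1 : `|emp n (Y k t) w - emp n (phi k i) w| <= 2 ^+ m * x ^+ k.
  apply: aux => j; rewrite /i; last exact: geq_minr.
  by move: (adj j); move: (cell k s j) (cell k t j); clear => a b /andP[]; lia.
have s0 : (0 : R) <= (Num.sqrt n%:R)^-1 by rewrite invr_ge0 sqrtr_ge0.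
move: hs ht s1 t1; move: (2 ^+ m * x ^+ k) ((Num.sqrt n%:R)^-1) s0 => A B B0.
clear -B0 c0; rewrite !ler_norml => /andP[? ?] /andP[? ?] /andP[? ?] /andP[? ?].
by apply/andP; split; rewrite mulrDl; lra.
Qed.

(** At generation 0 there is one cell, of index 0. Its approximant lies below the indicator of a box
    with corner -oo, which is empty as [d] is positive; so [emp_approx] with k = 0 bounds the
    process itself. *)
Lemma emp_bounded : exists2 c, 0 <= c & forall n m w t, (0 < n)%N -> good n m w ->
  `|emp n (ind t) w| <= c * (2 ^+ m + 1).
Proof.
have [c c0 hc] := emp_approx; exists c => // n m w t n0 gw.
have := hc n m 0%N w t; rewrite expn0 expr0 mulr1 => /(_ n0 gw).
have -> : phi 0 (cell 0 t) = (fun=> 0).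
  apply/funext => y; have [_ B _] := hphi (cell_le' 0 t); have [l u] := B y.
  have /andP[p _] := bracket_itv y B; apply/eqP; rewrite eq_le p andbT.
  apply: (le_trans u); rewrite indE; case: asboolP => // /(_ (Ordinal d0)).
  by rewrite /qvec cell0 mul0r qtN.
rewrite emp_cst subr0 => /le_trans; apply; rewrite ler_wpM2l// lerD2l.
have s1 : 1 <= Num.sqrt n%:R :> R by rewrite -[leLHS]sqrtr1 ler_sqrt// ler1n.
by rewrite invf_le1// (lt_le_trans ltr01).
Qed.

End ChainingBounds.

(** * Gaussian limits *)

Section Gauss.
Context {R : realType}.
Local Notation mu := (@lebesgue_measure R).

Definition gexp (s : R) (h : R -> R) : R := fine (gauss_expect s h).

Lemma std_gauss_densityE (x : R) : std_gauss_density x = normal_pdf 0 1 x.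
Proof.
transitivity (normal_peak 1 * normal_fun 0 1 x); last by rewrite normal_pdfE ?oner_neq0.
rewrite /normal_peak /normal_fun /std_gauss_density mulrC !expr1n mul1r subr0.
by rewrite mulr_natl.
Qed.

Lemma std_gauss_density_ge0 (x : R) : 0 <= std_gauss_density x.
Proof. by rewrite std_gauss_densityE normal_pdf_ge0. Qed.

Lemma measurable_std_gauss_density : measurable_fun setT (@std_gauss_density R).
Proof. by rewrite (funext std_gauss_densityE); exact: measurable_normal_pdf. Qed.

Lemma integrable_density M : mu.-integrable setT (fun x => (M * std_gauss_density x)%:E).
Proof.
under eq_fun do rewrite EFinM; apply: integrableZl => //.
under eq_fun do rewrite std_gauss_densityE.
exact: integrable_normal_pdf.
Qed.

Lemma gauss_integrable (f : R -> R) M : measurable_fun setT f -> (forall x, `|f x| <= M) ->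
  mu.-integrable setT (fun x => (f x * std_gauss_density x)%:E).
Proof.
move=> mf fM; apply: (le_integrable measurableT _ _ (integrable_density M)).
  by apply/measurable_EFinP; apply: measurable_funM => //; exact: measurable_std_gauss_density.
move=> x _; rewrite lee_fin !normrM ler_wpM2r// (le_trans (fM x))// ler_norm//.
Qed.

Lemma measurable_scaled (h : R -> R) (s : R) :
  measurable_fun [set: R] h -> measurable_fun [set: R] (fun x : R => h (s * x)).
Proof. by move=> mh; apply: measurableT_comp => //; exact: measurable_funM. Qed.

Lemma gexpE (s : R) (h : R -> R) M : measurable_fun [set: R] h -> (forall x, `|h x| <= M) ->
  gauss_expect s h = (gexp s h)%:E.
Proof.
move=> mh hM; rewrite /gexp fineK//.
apply: (integrable_fin_num measurableT).
exact: (gauss_integrable (measurable_scaled s mh) (fun x => hM (s * x))).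
Qed.

Lemma gauss_dominated (h_ : nat -> R -> R) (f : R -> R) M :
  (forall k, measurable_fun [set: R] (h_ k)) -> (forall k x, `|h_ k x| <= M) ->
  (forall x, h_ k x @[k --> \oo] --> f x) ->
  fine (\int[mu]_x (h_ k x * std_gauss_density x)%:E)%E @[k --> \oo] -->
  fine (\int[mu]_x (f x * std_gauss_density x)%:E)%E.
Proof.
move=> mh hM hf.
have mf : measurable_fun setT f by apply: (measurable_fun_cvg mh) => x _; exact: hf.
have fM x : `|f x| <= M.
  have cn : `|h_ k x| @[k --> \oo] --> `|f x| by apply: cvg_norm; exact: hf.
  rewrite -(cvg_lim _ cn)//; apply: limr_le; last by near=> n; exact: hM.
  by apply/cvg_ex; exists `|f x|.
have K : (\int[mu]_x (h_ k x * std_gauss_density x)%:E)%E @[k --> \oo] -->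
    (fine (\int[mu]_x (f x * std_gauss_density x)%:E)%E)%:E.
  rewrite fineK; last exact: (integrable_fin_num measurableT (gauss_integrable mf fM)).
  apply: (@dominated_cvg _ _ _ mu setT measurableT _ _ (fun x => (M * std_gauss_density x)%:E)) => //.
  - move=> k; apply/measurable_EFinP; apply: measurable_funM; first exact: mh.
    exact: measurable_std_gauss_density.
  - move=> x _; apply: cvg_EFin; first exact: nearW.
    by apply: cvgM; [exact: hf|exact: cvg_cst].
  - exact: integrable_density.
  - move=> k x _; rewrite lee_fin normrM [X in _ * X]ger0_norm ?std_gauss_density_ge0//.
    by rewrite ler_wpM2r ?std_gauss_density_ge0.
exact: (fine_cvg K).
Unshelve. all: by end_near. Qed.

Lemma gexp_cvg (sig : nat -> R) (s : R) (h : R -> R) M : continuous h -> (forall x, `|h x| <= M) ->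
  sig k @[k --> \oo] --> s -> gexp (sig k) h @[k --> \oo] --> gexp s h.
Proof.
move=> ch hM ss; apply: (@gauss_dominated (fun k x => h (sig k * x)) (fun x => h (s * x)) M).
- by move=> k; apply: measurable_scaled; exact: continuous_measurable_fun.
- by move=> k x; exact: hM.
- move=> x; apply: (@cvg_comp _ _ _ (fun k => sig k * x) h _ (nbhs (s * x))); last exact: ch.
  by apply: cvgM => //; exact: cvg_cst.
Qed.

Definition tent (c y : R) : R := Num.max 0 (1 - `|y| / c).

Lemma tent_itv c y : 0 < c -> 0 <= tent c y <= 1.
Proof.
move=> c0; rewrite /tent le_max lexx/= ge_max ler01/= lerBlDr lerDl.
by rewrite divr_ge0// ltW.
Qed.

Lemma tent_lip c y z : 0 < c -> `|tent c y - tent c z| <= c^-1 * `|y - z|.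
Proof.
move=> c0; have ci : 0 < c^-1 by rewrite invr_gt0.
suff H u v : tent c u - tent c v <= c^-1 * `|u - v|.
  by rewrite ler_norml H andbT lerNl opprB distrC H.
have h : `|v| <= `|u| + `|u - v| by have := ler_normB u (u - v); rewrite opprB addrC subrK; lra.
have h' : c^-1 * `|v| <= c^-1 * `|u| + c^-1 * `|u - v| by rewrite -mulrDr ler_wpM2l// ltW.
have n0 : 0 <= c^-1 * `|u - v| by rewrite mulr_ge0// ltW.
rewrite /tent !maxEle ![_ / c]mulrC; do 2 (case: ifPn; rewrite -?ltNge => ?); lra.
Qed.

Lemma lipschitz_continuous (g : R -> R) L : (forall x y, `|g x - g y| <= L * `|x - y|) -> continuous g.
Proof.
move=> gL x; apply/cvgrPdist_lt => e e0.
have L0 : 0 < `|L| + 1 by rewrite ltr_wpDl.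
near=> y; apply: (le_lt_trans (gL x y)).
apply: (@le_lt_trans _ _ ((`|L| + 1) * `|x - y|)).
  by rewrite ler_wpM2r// (le_trans (ler_norm _))// lerDl.
rewrite -ltr_pdivlMl//; near: y; apply: cvgr_dist_lt => //.
by rewrite mulr_gt0// invr_gt0.
Unshelve. all: by end_near. Qed.

(** A Gaussian law with growing standard deviation leaves every bounded set; this excludes unbounded
    variances in [gaussian_limit]. *)
Lemma gexp_tent_small c (sig : nat -> R) : 0 < c -> (forall i, i%:R <= sig i) ->
  gexp (sig k) (tent c) @[k --> \oo] --> 0.
Proof.
move=> c0 hs.
have ct : continuous (tent c) by apply: (@lipschitz_continuous _ c^-1) => x y; exact: tent_lip.
have -> : 0 = fine (\int[mu]_x ((\1_[set (0 : R)%R] x : R) * std_gauss_density x)%:E)%E.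
  have -> : (\int[mu]_x ((\1_[set (0 : R)%R] x : R) * std_gauss_density x)%:E =
     \int[mu]_(x in [set (0 : R)%R]) (std_gauss_density x)%:E)%E.
    rewrite [RHS]integral_mkcond; apply: eq_integral => x _.
    rewrite patchE indicE; case: ifPn => _; first by rewrite mul1r.
    by rewrite mul0r.
  by rewrite integral_set1.
apply: (@gauss_dominated (fun k x => tent c (sig k * x)) _ 1).
- by move=> k; apply: measurable_scaled; exact: continuous_measurable_fun.
- by move=> k x; have /andP[? ?] := tent_itv (sig k * x) c0; rewrite ger0_norm.
- move=> x; have [->|x0] := eqVneq x 0.
    rewrite indicE mem_set//.
    under eq_fun do rewrite mulr0 /tent normr0 mul0r subr0 max_r//.
    exact: cvg_cst.
  rewrite indicE memNset; last by move/eqP; rewrite (negbTE x0).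
  apply: cvg_near_cst; near=> k.
  have xk : c <= k%:R * `|x|.
    rewrite -ler_pdivrMr ?normr_gt0//; near: k; exact: nbhs_infty_ger.
  rewrite /tent max_l// subr_le0 ler_pdivlMr// mul1r normrM.
  apply: (le_trans xk); rewrite ler_wpM2r//.
  by rewrite (le_trans (hs k))// ler_norm.
Unshelve. all: by end_near. Qed.

End Gauss.

(** * Gaussian limits obtained by approximation *)

Section GaussianLimit.
Context {R : realType} {dT} {T : measurableType dT} (P : probability T R).
Variables (Z : nat -> T -> R) (Zk : nat -> nat -> T -> R) (sig : nat -> R).
Hypothesis mZ : forall n, measurable_fun setT (Z n).
Hypothesis mZk : forall k n, measurable_fun setT (Zk k n).
Hypothesis sig0 : forall k, 0 <= sig k.
Hypothesis clt : forall k g M, continuous g -> (forall y, `|g y| <= M) ->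
  Ex P (fun w => g (Zk k n w)) @[n --> \oo] --> gexp (sig k) g.
Hypothesis close : forall e, 0 < e -> exists K, forall k, (K <= k)%N ->
  exists N, forall n, (N <= n)%N -> exists E, [/\ measurable E, prob P (~` E) <= e &
    forall w, E w -> `|Z n w - Zk k n w| <= e].
Hypothesis tight : forall e, 0 < e -> exists B N, forall n, (N <= n)%N ->
  exists E, [/\ measurable E, prob P (~` E) <= e & forall w, E w -> `|Z n w| <= B].

Let bg (g : R -> R) M (f : T -> R) : continuous g -> (forall y, `|g y| <= M) ->
  measurable_fun setT f -> bmeas (fun w => g (f w)).
Proof.
move=> cg gM mf; split; last by exists M.
exact: measurableT_comp (continuous_measurable_fun cg) mf.
Qed.

(** On the event of closeness the Lipschitz bound applies, and off it the bound 2 M; the choice of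
    [e'] balances both. *)
Lemma Ex_close (g : R -> R) L M e : 0 <= L -> (forall x y, `|g x - g y| <= L * `|x - y|) ->
  (forall y, `|g y| <= M) -> 0 < e -> exists K, forall k, (K <= k)%N ->
  exists N, forall n, (N <= n)%N -> `|Ex P (fun w => g (Z n w)) - gexp (sig k) g| <= e.
Proof.
move=> L0 gL gM e0; have cg := lipschitz_continuous gL.
have M0 : 0 <= M by rewrite (le_trans _ (gM 0)).
have LM : 0 < L + 2 * M + 1 by rewrite ltr_wpDl// addr_ge0// mulr_ge0.
pose e' := e / 2 / (L + 2 * M + 1).
have e'0 : 0 < e' by rewrite !divr_gt0.
have [K hK] := close e'0; exists K => k /hK[N hN].
have [N' _ hN'] : \forall n \near \oo, `|gexp (sig k) g - Ex P (fun w => g (Zk k n w))| < e / 2.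
  by have /cvgrPdist_lt := @clt k g M cg gM; apply; rewrite divr_gt0.
exists (maxn N N') => n; rewrite geq_max => /andP[Nn N'n].
have := hN' n N'n; rewrite /= distrC => h1.
have [E [mE pE hE]] := hN n Nn.
have bZ := bg cg gM (mZ n); have bZk := bg cg gM (mZk k n).
have mEC := measurableC mE.
have h2 : `|Ex P (fun w => g (Z n w)) - Ex P (fun w => g (Zk k n w))| <= e / 2.
  rewrite -ExB//; apply: (le_trans (le_norm_Ex P (bmeasB bZ bZk))).
  apply: (@le_trans _ _ (Ex P (fun w => L * e' + 2 * M * \1_(~` E) w))).
    apply: le_Ex; [by apply: bmeas_norm; exact: bmeasB| |].
      by apply: bmeasD; [exact: bmeas_cst|apply: bmeasZ; exact: bmeas_indic].
    move=> w; rewrite indicE; have [Ew|Ew] := pselect (E w).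
      rewrite memNset; last by [].
      rewrite mulr0 addr0 (le_trans (gL _ _))// ler_wpM2l//; exact: hE.
    rewrite mem_set// mulr1 (le_trans (ler_normB _ _))//.
    have := gM (Z n w); have := gM (Zk k n w).
    have : 0 <= L * e' by rewrite mulr_ge0// ltW.
    lra.
  rewrite ExD; [|exact: bmeas_cst|by apply: bmeasZ; exact: bmeas_indic].
  rewrite Ex_cst ExZ; last exact: bmeas_indic.
  rewrite Ex_indic// -/(prob P _).
  have : 2 * M * prob P (~` E) <= 2 * M * e' by rewrite ler_wpM2l// mulr_ge0.
  have : e' * (L + 2 * M + 1) = e / 2 by rewrite divfK// gt_eqF.
  lra.
rewrite (le_trans (ler_distD (Ex P (fun w => g (Zk k n w))) _ _))//.
lra.
Qed.

(** The deviations [sig k] are not known to converge. Tightness of [Z] keeps them bounded, so they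
    have a cluster point [s]. Since [Z n] is close to [Zk k n] for every large k, the expectation of
    any Lipschitz test along [Z] approaches the value at s, for the whole sequence in n. *)
Lemma gaussian_limit : exists2 s, 0 <= s & forall (g : R -> R) L M, 0 <= L ->
  (forall x y, `|g x - g y| <= L * `|x - y|) -> (forall y, `|g y| <= M) ->
  Ex P (fun w => g (Z n w)) @[n --> \oo] --> gexp s g.
Proof.
have [K0 [D sigD]] : exists K D, forall k, (K <= k)%N -> sig k <= D.
  have [B [N hB]] : exists B N, forall n, (N <= n)%N -> exists E, [/\ measurable E,
      prob P (~` E) <= 1 / 4 & forall w, E w -> `|Z n w| <= B] by apply: tight; lra.
  (* With this width the tent is at least 1/2 where |Z| <= B. An event of probability 3/4 then gives
     expectation at least 3/8, and an error 1/8 leaves 1/4. *)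
  pose c := 2 * `|B| + 2; have c0 : 0 < c by rewrite /c ltr_wpDl// mulr_ge0.
  have tM y : `|tent c y| <= 1 by have /andP[? ?] := tent_itv y c0; rewrite ger0_norm.
  have ci0 : 0 <= c^-1 by rewrite invr_ge0 ltW.
  have ct := lipschitz_continuous (fun x y => tent_lip x y c0).
  have [|K hK] := @Ex_close (tent c) c^-1 1 (1 / 8) ci0 (fun x y => tent_lip x y c0) tM; first lra.
  have low k : (K <= k)%N -> 1 / 4 <= gexp (sig k) (tent c).
    move=> /hK[N' hN']; pose n := maxn N N'.
    have := hN' n (leq_maxr _ _); rewrite ler_norml => /andP[h1 h2].
    have [E [mE pE hE]] := hB n (leq_maxl _ _).
    suff : 3 / 8 <= Ex P (fun w => tent c (Z n w)) by lra.
    have pE' : 3 / 4 <= prob P E by move: pE; rewrite probC//; lra.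
    apply: (@le_trans _ _ (1 / 2 * prob P E)); first lra.
    rewrite prob_Ex// -ExZ; last exact: bmeas_indic.
    apply: le_Ex; [by apply: bmeasZ; exact: bmeas_indic|exact: (bg ct tM)|].
    move=> w; rewrite indicE; have [Ew|Ew] := pselect (E w); last first.
      by rewrite memNset// mulr0; case/andP: (tent_itv (Z n w) c0).
    rewrite mem_set// mulr1 /tent le_max; apply/orP; right.
    have := hE w Ew; have := ler_norm B => hB1 hB2.
    have : `|Z n w| / c <= 1 / 2 by rewrite ler_pdivrMr// /c; lra.
    lra.
  exists K; apply: contrapT => /forallNP hD.
  have ch (i : nat) : exists k, (K <= k)%N /\ i%:R <= sig k.
    have /existsNP[k /not_implyP[Kk /negP]] := hD i%:R.
    by rewrite -ltNge => /ltW h; exists k.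
  have [ks hks] := choice ch.
  have := gexp_tent_small c0 (fun i => (hks i).2) => /cvgrPdist_lt /(_ (1 / 4)).
  have q0 : 0 < 1 / 4 :> R by lra.
  move=> /(_ q0)[i _ /(_ i (leqnn i))] /=.
  rewrite sub0r normrN ltNge => /negP; apply.
  by rewrite (le_trans (low _ (hks i).1))// ler_norm.
have [s s0 clus] : exists2 s, 0 <= s & forall e K, 0 < e -> exists2 k, (K <= k)%N & `|sig k - s| < e.
  have := @segment_compact R 0 `|D|; rewrite /compact.
  move=> /(_ (sig k @[k --> \oo]) _)[|s [s01 cl]].
    exists K0 => // k /= Kk; rewrite in_itv/= sig0/=.
    by rewrite (le_trans (sigD k Kk))// ler_norm.
  exists s; first by move: s01; rewrite /= in_itv/= => /andP[].
  move=> e K e0.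
  have [||y [[k Kk <-] yb]] := cl (sig @` [set k | (K <= k)%N]) (ball s e).
  - by exists K => // k Kk; exists k.
  - exact: nbhsx_ballx.
  - by exists k => //; rewrite distrC.
exists s => // g L M L0 gL gM; have cg := lipschitz_continuous gL.
apply/cvgrPdist_le => e e0.
have e2 : 0 < e / 2 by rewrite divr_gt0.
have [K hK] := Ex_close L0 gL gM e2.
have ch i : exists k, (maxn K i <= k)%N /\ `|sig k - s| < i.+1%:R^-1.
  by have [|k k1 k2] := clus i.+1%:R^-1 (maxn K i); [rewrite invr_gt0|exists k].
have [ks hks] := choice ch.
have sks : sig (ks i) @[i --> \oo] --> s.
  apply/cvgrPdist_lt => e' e'0; near=> i; rewrite distrC.
  rewrite (lt_trans (hks i).2)//; near: i; exact: near_infty_natSinv_lt (PosNum e'0).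
have := gexp_cvg cg gM sks => /cvgrPdist_le /(_ _ e2) [i _ /(_ i (leqnn i)) /= hi].
have [|N hN] := hK (ks i); first by have [] := hks i; rewrite geq_max => /andP[].
near=> n; have /hN : (N <= n)%N by near: n; exact: nbhs_infty_ge.
rewrite distrC => h; rewrite (le_trans (ler_distD (gexp (sig (ks i)) g) _ _))//.
lra.
Unshelve. all: by end_near. Qed.

End GaussianLimit.

(** * Finite-dimensional limits *)

Section FiniteDimensional.
Context {R : realType} {dT} {T : measurableType dT} (P : probability T R) (d : nat).
Context (X : nat -> T -> 'I_d -> R) (G : set (('I_d -> R) -> R)) (nG : (('I_d -> R) -> R) -> R).
Hypothesis mX : forall i j, measurable_fun setT (fun w => X i w j).
Hypothesis cF : distF_continuous P X.
Hypothesis hG : function_space G nG.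
Hypothesis hclt : forall f, G f -> (exists M : R, forall x, `|f x| <= M) ->
     (\int[P]_w (f (X 0%N w))%:E = 0)%E ->
     exists2 sigma2 : R, 0 <= sigma2 &
       forall h : R -> R, continuous h -> (exists M : R, forall y, `|h y| <= M) ->
         (fun n : nat => \int[P]_w
             (h ((Num.sqrt n%:R)^-1 * \sum_(1 <= i < n.+1) f (X i w)))%:E)%E
           @ \oo --> gauss_expect (Num.sqrt sigma2) h.
Context (phi : nat -> ('I_d -> nat) -> ('I_d -> R) -> R) (x : R) (good : nat -> nat -> set T).
Context (c1 c2 : R) (eta : nat -> R).
Hypothesis hphi : forall k i, (forall j, (i j <= 2 ^ k)%N) ->
  G (phi k i) /\ forall y, 0 <= phi k i y <= 1.
Hypotheses (x0 : 0 < x) (x1 : x < 1) (c10 : 0 <= c1) (c20 : 0 <= c2).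
Hypothesis mgood : forall n m, measurable (good n m).
Hypothesis pgood : forall n m, prob P (~` good n m) <= eta m.
Hypothesis eta0 : forall e, 0 < e -> exists m, eta m <= e.
Local Notation emp := (emp P X).
Local Notation cell := (cell P X).
Hypothesis approx : forall n m k w t, (2 ^ k <= n)%N -> good n m w ->
  `|emp n (ind t) w - emp n (phi k (cell k t)) w| <= c1 * (2 ^+ m * x ^+ k + (Num.sqrt n%:R)^-1).
Hypothesis bounded : forall n m w t, (0 < n)%N -> good n m w ->
  `|emp n (ind t) w| <= c2 * (2 ^+ m + 1).

Context (K : nat) (t : 'I_K -> ('I_d -> \bar R)) (cc : 'I_K -> R).

Let cell_le' k s j : (cell k s j <= 2 ^ k)%N. Proof. exact/ltnW/cell_lt. Qed.

Definition fdd_comb (k : nat) (y : 'I_d -> R) : R := \sum_(j < K) cc j * phi k (cell k (t j)) y.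

Lemma G_sum (I : Type) (s : seq I) (f : I -> ('I_d -> R) -> R) :
  (forall i, G (f i)) -> G (fun y => \sum_(i <- s) f i y).
Proof.
move=> Gf; case: hG => _ Gc GD _ _; elim: s => [|i s IH].
  rewrite (_ : (fun y => _) = (fun=> 0)); first exact: Gc.
  by apply/funext => y; rewrite big_nil.
rewrite (_ : (fun y => _) = (fun y => f i y + \sum_(i <- s) f i y)); first exact: GD.
by apply/funext => y; rewrite big_cons.
Qed.

Lemma fdd_comb_bound k y : `|fdd_comb k y| <= \sum_(j < K) `|cc j|.
Proof.
rewrite (le_trans (ler_norm_sum _ _ _))//; apply: ler_sum => j _.
have [_ /(_ y)/andP[p0 p1]] := hphi (cell_le' k (t j)).
by rewrite normrM [X in _ * X]ger0_norm// ler_piMr.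
Qed.

Lemma G_fdd_comb k : G (fdd_comb k).
Proof.
case: (hG) => _ _ _ GZ _; apply: G_sum => j; apply: GZ.
by have [] := hphi (cell_le' k (t j)).
Qed.

Lemma obs_fdd_comb k : obs_bmeas X (fdd_comb k).
Proof. by apply: (G_obs mX hG (G_fdd_comb k)) => y; exact: fdd_comb_bound. Qed.

Lemma emp_fdd_comb n k w :
  emp n (fdd_comb k) w = \sum_(j < K) cc j * emp n (phi k (cell k (t j))) w.
Proof.
have op j : obs_bmeas X (phi k (cell k (t j))).
  have [Gp p01] := hphi (cell_le' k (t j)); apply: (G_obs mX hG (M := 1) Gp) => y.
  by have /andP[? ?] := p01 y; rewrite ger0_norm.
have mE : mean P X (fdd_comb k) = \sum_(j < K) cc j * mean P X (phi k (cell k (t j))).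
  rewrite /mean Ex_sum; last by move=> j; apply: bmeasZ; exact: op.
  by apply: eq_bigr => j _; rewrite ExZ//; exact: op.
rewrite /emp mE (eq_bigr (fun i => \sum_(j < K) cc j * (phi k (cell k (t j)) (X i w) - mean P X (phi k (cell k (t j)))))); last first.
  by move=> i _; rewrite /fdd_comb -sumrB; apply: eq_bigr => j _; rewrite mulrBr.
rewrite exchange_big/= mulr_sumr; apply: eq_bigr => j _.
by rewrite -mulr_sumr mulrCA.
Qed.

Lemma emp_clt f M : G f -> (forall y, `|f y| <= M) -> exists2 s : R, 0 <= s &
  forall (g : R -> R) N, continuous g -> (forall y, `|g y| <= N) ->
    Ex P (fun w => g (emp n f w)) @[n --> \oo] --> gexp s g.
Proof.
move=> Gf fM; case: (hG) => _ Gc GD GZ _.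
have bf i : bmeas (fun w => f (X i w)) by exact: (G_obs mX hG Gf fM).
pose fc y := f y + (- mean P X f).
have Gfc : G fc by apply: GD => //; exact: Gc.
have fcM y : `|fc y| <= M + `|mean P X f|.
  by rewrite (le_trans (ler_normD _ _))// normrN lerD2r.
have Efc : (\int[P]_w (fc (X 0%N w))%:E = 0)%E.
  rewrite ExE; last exact: (G_obs mX hG Gfc fcM).
  congr (_%:E); rewrite /fc ExD//; last exact: bmeas_cst.
  by rewrite Ex_cst -/(mean P X f) subrr.
have [s2 s20 hs] := hclt Gfc (ex_intro _ _ fcM) Efc.
exists (Num.sqrt s2); first exact: sqrtr_ge0.
move=> g N cg gN.
have := hs g cg (ex_intro _ _ gN).
rewrite (@gexpE _ _ g N) //; last exact: continuous_measurable_fun.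
exact: fine_cvg.
Qed.

(** A linear combination of indicators is approximated by the same combination of generation-k
    approximants. The latter lies in G, so the assumed central limit theorem applies to it after
    centring. *)
Lemma fdd_emp : exists2 s : R, 0 <= s & forall (g : R -> R) L M, 0 <= L ->
  (forall y z, `|g y - g z| <= L * `|y - z|) -> (forall y, `|g y| <= M) ->
  Ex P (fun w => g (\sum_(j < K) cc j * emp n (ind (t j)) w)) @[n --> \oo] --> gexp s g.
Proof.
pose A := \sum_(j < K) `|cc j|; have A0 : 0 <= A by exact: sumr_ge0.
have hs k : exists s : R, 0 <= s /\
  forall (g : R -> R) N, continuous g -> (forall y, `|g y| <= N) ->
    Ex P (fun w => g (emp n (fdd_comb k) w)) @[n --> \oo] --> gexp s g.
  by have [s s0 h] := emp_clt (G_fdd_comb k) (fdd_comb_bound k); exists s.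
have [sig sigP] := choice hs.
have memp n f : obs_bmeas X f -> measurable_fun setT (emp n f).
  by move=> bf; exact: (bmeas_emp P n bf).1.
apply: (@gaussian_limit _ _ _ P (fun n w => \sum_(j < K) cc j * emp n (ind (t j)) w)
  (fun k n w => emp n (fdd_comb k) w) sig).
- move=> n; apply: measurable_sum => j; apply: measurable_funM => //.
  by apply: memp; exact: obs_ind.
- by move=> k n; apply: memp; exact: obs_fdd_comb.
- by move=> k; have [] := sigP k.
- by move=> k g M; have [_] := sigP k; apply.
- move=> e e0; have [m em] := eta0 e0.
  have B0 : 0 < A * c1 * 2 ^+ m + A * c1 + 1.
    by rewrite ltr_wpDl// addr_ge0// !mulr_ge0// exprn_ge0.
  pose e' := e / (A * c1 * 2 ^+ m + A * c1 + 1); have e'0 : 0 < e' by rewrite divr_gt0.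
  have [k0 _ hk0] : \forall k \near \oo, `|x ^+ k| < e'.
    have := @cvg_expr R x; rewrite ger0_norm ?(ltW x0)// => /(_ x1) /cvgrPdist_lt /(_ _ e'0).
    by under eq_near do rewrite sub0r normrN.
  exists k0 => k k0k.
  have xk : x ^+ k <= e' by have := hk0 k k0k; rewrite /= => /ltW; apply: le_trans; rewrite ler_norm.
  pose N := maxn (2 ^ k) (Num.truncn (e'^-1 ^+ 2)).+1.
  exists N => n Nn; exists (good n m); split=> //.
    by rewrite (le_trans (pgood n m)).
  move=> w gw; rewrite emp_fdd_comb -sumrB.
  have kn : (2 ^ k <= n)%N by rewrite (leq_trans _ Nn)// leq_maxl.
  have sn : (Num.sqrt n%:R)^-1 <= e'.
    rewrite -[leRHS]invrK lef_pV2 ?posrE ?invr_gt0//; last first.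
      by rewrite sqrtr_gt0 ltr0n (leq_trans _ kn)// expn_gt0.
    rewrite -[leLHS]ger0_norm ?invr_ge0 ?(ltW e'0)// -sqrtr_sqr ler_wsqrtr//.
    by rewrite (le_trans (ltW (truncnS_gt _)))// ler_nat (leq_trans _ Nn)// leq_maxr.
  apply: (@le_trans _ _ (A * (c1 * (2 ^+ m * x ^+ k + (Num.sqrt n%:R)^-1)))).
    rewrite /A mulr_suml (le_trans (ler_norm_sum _ _ _))//; apply: ler_sum => j _.
    by rewrite -mulrBr normrM ler_wpM2l//; exact: approx.
  have h1 : A * c1 * 2 ^+ m * x ^+ k <= A * c1 * 2 ^+ m * e'.
    by rewrite ler_wpM2l// !mulr_ge0// exprn_ge0.
  have h2 : A * c1 * (Num.sqrt n%:R)^-1 <= A * c1 * e' by rewrite ler_wpM2l// mulr_ge0.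
  have h3 : e' * (A * c1 * 2 ^+ m + A * c1 + 1) = e by rewrite divfK// gt_eqF.
  have -> : A * (c1 * (2 ^+ m * x ^+ k + (Num.sqrt n%:R)^-1)) =
    A * c1 * 2 ^+ m * x ^+ k + A * c1 * (Num.sqrt n%:R)^-1 by ring.
  rewrite -h3; lra.
- move=> e e0; have [m em] := eta0 e0.
  exists (A * (c2 * (2 ^+ m + 1))), 1%N => n n1; exists (good n m); split=> //.
    by rewrite (le_trans (pgood n m)).
  move=> w gw; rewrite (le_trans (ler_norm_sum _ _ _))// /A mulr_suml.
  by apply: ler_sum => j _; rewrite normrM ler_wpM2l//; exact: bounded.
Qed.

End FiniteDimensional.

(** * Cadlag paths *)

Section CompactifiedLine.
Context {R : realType}.

Lemma phiE_contract (a : \bar R) : phiE a = contract a.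
Proof. by case: a. Qed.

Lemma rho_gt (a t : \bar R) : (a < t)%E -> exists2 delta : R, 0 < delta &
  forall s, rhoE s t < delta -> (a < s)%E.
Proof.
move=> at_; exists (contract t - contract a); first by rewrite subr_gt0 lt_contract.
move=> s; rewrite /rhoE !phiE_contract ltr_norml => /andP[h _].
by rewrite -lt_contract; lra.
Qed.

Lemma rho_lt (a t : \bar R) : (t < a)%E -> exists2 delta : R, 0 < delta &
  forall s, rhoE s t < delta -> (s < a)%E.
Proof.
move=> ta; exists (contract a - contract t); first by rewrite subr_gt0 lt_contract.
move=> s; rewrite /rhoE !phiE_contract ltr_norml => /andP[_ h].
by rewrite -lt_contract; lra.
Qed.

Lemma rhoE_refl (t : \bar R) : rhoE t t = 0.
Proof. by rewrite /rhoE subrr normr0. Qed.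

Lemma finite_delta (I : finType) (Q : I -> R -> Prop) :
  (forall i, exists2 delta : R, 0 < delta & Q i delta) ->
  (forall i (a b : R), a <= b -> Q i b -> Q i a) ->
  exists2 delta : R, 0 < delta & forall i, Q i delta.
Proof.
move=> hQ monQ; have hQ' i : exists delta : R, 0 < delta /\ Q i delta.
  by have [x x0 xQ] := hQ i; exists x.
have [f fP] := choice hQ'.
exists (\big[Order.min/1]_(i : I) f i).
  by apply: (big_ind (fun x : R => 0 < x)) => // [a b a0 b0|i _]; [rewrite lt_min a0|have [] := fP i].
by move=> i; apply: monQ (fP i).2; apply: bigmin_le.
Qed.

(** Near [t] and on one fixed side of it, the comparison with a level [c] has a constant answer.
    Indicators and grid step functions owe their quadrant limits to this. *)
Lemma cmp_quad (c t : \bar R) (up : bool) : exists2 delta : R, 0 < delta &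
  forall s, rhoE s t < delta -> (if up then (t <= s)%E else (s < t)%E) ->
  (c <= s)%E = (if up then (c <= t)%E else (c < t)%E).
Proof.
case: up.
  have [ct|tc] := leP c t; first by exists 1 => // s _ ts; rewrite (le_trans ct).
  have [delta d0 hd] := rho_lt tc; exists delta => // s /hd sc _.
  by rewrite leNgt sc.
have [tc|ct] := leP t c.
  by exists 1 => // s _ st; rewrite leNgt (lt_le_trans st).
have [delta d0 hd] := rho_gt ct; exists delta => // s /hd cs _.
by rewrite ltW.
Qed.

End CompactifiedLine.

Section CadlagPaths.
Context {R : realType} (d : nat).
Local Notation pt := ('I_d -> \bar R).
Implicit Types (x y : pt -> R) (t s : pt).

Lemma quadrantT t : quadrant (fun _ => true) t t.
Proof. by move=> j. Qed.

Lemma cadlag_locally_const y :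
  (forall t Rel, exists l, exists2 delta : R, 0 < delta & forall s, quadrant Rel t s ->
     (forall j, rhoE (s j) (t j) < delta) -> y s = l) -> cadlag y.
Proof.
move=> h t; split=> [Rel|].
  have [l [delta d0 hd]] := h t Rel; exists l => e e0; exists delta => // s qs rs.
  by rewrite (hd s qs rs) subrr normr0.
have [l [delta d0 hd]] := h t (fun _ => true) => e e0; exists delta => // s qs rs.
rewrite (hd s qs rs) (hd t (quadrantT t)) ?subrr ?normr0// => j.
by rewrite rhoE_refl.
Qed.

Lemma path_continuous_cadlag y : path_continuous y -> cadlag y.
Proof.
move=> cy t; have H Rel : quad_lim y Rel t (y t).
  by move=> e e0; have [delta d0 hd] := cy t e e0; exists delta => // s _; exact: hd.
by split=> [Rel|]; [exists (y t)|]; exact: H.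
Qed.

Lemma quad_limD x y Rel t a b : quad_lim x Rel t a -> quad_lim y Rel t b ->
  quad_lim (fun s => x s + y s) Rel t (a + b).
Proof.
move=> hx hy e e0; have e2 : 0 < e / 2 by rewrite divr_gt0.
have [dx dx0 hdx] := hx _ e2; have [dy dy0 hdy] := hy _ e2.
exists (Num.min dx dy); first by rewrite lt_min dx0.
move=> s qs rs; have h1 : `|x s - a| < e / 2.
  by apply: hdx => // j; have := rs j; rewrite lt_min => /andP[].
have h2 : `|y s - b| < e / 2.
  by apply: hdy => // j; have := rs j; rewrite lt_min => /andP[].
rewrite opprD addrACA (le_lt_trans (ler_normD _ _))//; lra.
Qed.

Lemma quad_limZ c x Rel t a : quad_lim x Rel t a -> quad_lim (fun s => c * x s) Rel t (c * a).
Proof.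
move=> hx e e0; have c0 : 0 < `|c| + 1 by rewrite ltr_wpDl.
have [|dx dx0 hdx] := hx (e / (`|c| + 1)); first by rewrite divr_gt0.
exists dx => // s qs rs; rewrite -mulrBr normrM.
have := hdx s qs rs; rewrite ltr_pdivlMr// => h.
by rewrite (le_lt_trans _ h)// mulrC ler_wpM2l// lerDl.
Qed.

Lemma cadlagD x y : cadlag x -> cadlag y -> cadlag (fun s => x s + y s).
Proof.
move=> hx hy t; have [h1 h2] := hx t; have [h3 h4] := hy t; split=> [Rel|].
  by have [a ha] := h1 Rel; have [b hb] := h3 Rel; exists (a + b); exact: quad_limD.
exact: quad_limD.
Qed.

Lemma cadlagZ c x : cadlag x -> cadlag (fun s => c * x s).
Proof.
move=> hx t; have [h1 h2] := hx t; split=> [Rel|]; last exact: quad_limZ.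
by have [a ha] := h1 Rel; exists (c * a); exact: quad_limZ.
Qed.

Lemma cadlag_sum (I : Type) (r : seq I) (F : I -> pt -> R) : (forall i, cadlag (F i)) ->
  cadlag (fun s => \sum_(i <- r) F i s).
Proof.
move=> hF; elim: r => [|i r IH].
  under eq_fun do rewrite big_nil.
  by apply: cadlag_locally_const => t Rel; exists 0, 1.
by under eq_fun do rewrite big_cons; exact: cadlagD.
Qed.

Lemma ind_cadlag (v : 'I_d -> R) : cadlag (fun t => ind t v).
Proof.
apply: cadlag_locally_const => t Rel.
have [delta d0 hd] := @finite_delta R 'I_d (fun j delta => forall s : \bar R, rhoE s (t j) < delta ->
    (if Rel j then (t j <= s)%E else (s < t j)%E) ->
    ((v j)%:E <= s)%E = (if Rel j then ((v j)%:E <= t j)%E else ((v j)%:E < t j)%E))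
  (fun j => cmp_quad _ _ _) (fun j a b ab h u sa => h u (lt_le_trans sa ab)).
exists (`[< forall j, if Rel j then ((v j)%:E <= t j)%E else ((v j)%:E < t j)%E >])%:R.
exists delta => // s qs rs; rewrite indE; congr ((nat_of_bool _)%:R).
by apply: asbool_equiv_eq; split=> h j; have := h j; rewrite /= (hd j _ (rs j) (qs j)).
Qed.

(** The identity is an admissible time change, so the Skorokhod distance is at most the uniform
    one. *)
Lemma skod_le x y e : (forall t, `|x t - y t| <= e) -> (skod x y <= e%:E)%E.
Proof.
move=> xy.
have e0 : 0 <= e by apply: le_trans (xy (fun=> 0%E)).
set M := maxe (ereal_sup [set c | exists (j : 'I_d) (u : \bar R), c = (rhoE u u)%:E])
  (ereal_sup [set c | exists t : pt, c = (`|x t - y t|)%:E]).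
apply: (@le_trans _ _ M).
  apply: ereal_inf_lbound; exists (fun _ u => u); split=> //.
  by move=> j; split=> // v; exists v.
rewrite /M ge_max; apply/andP; split; apply: ge_ereal_sup.
  by move=> _ [j [u ->]]; rewrite rhoE_refl lee_fin.
by move=> _ [t ->]; rewrite lee_fin.
Qed.

Lemma test_near (h : (pt -> R) -> R) x e : D_test_function h -> cadlag x -> 0 < e ->
  exists2 delta : R, 0 < delta & forall y, cadlag y -> (forall t, `|y t - x t| <= delta) ->
  `|h y - h x| < e.
Proof.
move=> [_ hh] cx e0; have [delta d0 hd] := hh x cx e e0.
exists (delta / 2); first by rewrite divr_gt0.
move=> y cy yx; apply: hd => //; apply: (@le_lt_trans _ _ (delta / 2)%:E).
  by apply: skod_le => t; rewrite distrC.
by rewrite lte_fin; lra.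
Qed.

End CadlagPaths.

(** * Quantile cells and the compactified topology *)

Section CellTopology.
Context {R : realType} {dT} {T : measurableType dT} (P : probability T R) (d : nat).
Context (X : nat -> T -> 'I_d -> R).
Hypothesis mX : forall i j, measurable_fun setT (fun w => X i w j).
Hypothesis cF : distF_continuous P X.
Local Notation cell := (cell P X).
Local Notation qt := (qt P X).
Implicit Types (s t : 'I_d -> \bar R).

Definition adjacent (k : nat) s t :=
  forall j, (cell k s j <= (cell k t j).+1)%N && (cell k t j <= (cell k s j).+1)%N.

Lemma eq_cell_adjacent k s t : cell k s = cell k t -> adjacent k s t.
Proof. by move=> st j; rewrite st leqnSn. Qed.

(** The quantile one level below the cell of [t] is strictly below [t], and the one at its upper end
    is strictly above [t] unless the cell is the last one. Strict inequalities persist nearby. *)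
Lemma cell_nbhd k t : exists2 delta : R, 0 < delta &
  forall s, (forall j, rhoE (s j) (t j) < delta) -> adjacent k s t.
Proof.
have k0 : 0 < (2 ^+ k)^-1 :> R by rewrite invr_gt0 exprn_gt0.
have [j|j a b ab h s sj|delta d0 hd] := @finite_delta R 'I_d (fun j delta => forall s,
    rhoE (s j) (t j) < delta ->
    (cell k s j <= (cell k t j).+1)%N && (cell k t j <= (cell k s j).+1)%N); last first.
- by exists delta => // s rs j; exact: hd.
- by apply: h; exact: lt_le_trans ab.
set i := cell k t j; have ik : (i < 2 ^ k)%N by exact: cell_lt.
have [d1 d10 h1] : exists2 delta : R, 0 < delta & forall s, rhoE (s j) (t j) < delta -> (i <= (cell k s j).+1)%N.
  have [i0|i0] := posnP i; first by exists 1 => // s _; rewrite i0.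
  have lt1 : (qt j (i.-1%:R / 2 ^+ k) < t j)%E.
    apply: lt_le_trans (cell_le mX cF k t j); apply: (qt_lt mX cF).
    - by rewrite ltr_pM2r// ltr_nat prednK.
    - by rewrite mulr_gt0// ltr0n.
    - by rewrite ltr_pdivrMr ?exprn_gt0// mul1r -natrX ltr_nat (leq_ltn_trans (leq_pred _)).
  have [delta d0 hd] := rho_gt lt1; exists delta => // s /hd/ltW.
  rewrite -(cell_geP mX cF); last by rewrite (leq_ltn_trans (leq_pred _)).
  by rewrite -ltnS prednK.
have [d2 d20 h2] : exists2 delta : R, 0 < delta & forall s, rhoE (s j) (t j) < delta -> (cell k s j <= i.+1)%N.
  have [iE|lt2] := cell_gt mX cF k t j.
    by exists 1 => // s _; rewrite -/i in iE; rewrite iE ltnW// cell_lt.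
  have [delta d0 hd] := rho_lt lt2; exists delta => // s /hd st.
  rewrite leqNgt; apply/negP => /ltnW h.
  have ik' : (i.+1 < 2 ^ k)%N by rewrite (leq_ltn_trans h)// cell_lt.
  by move: h; rewrite cell_geP// leNgt st.
exists (Num.min d1 d2); first by rewrite lt_min d10.
by move=> s; rewrite lt_min => /andP[/h1 -> /h2 ->].
Qed.

Lemma cell_quad k t Rel : exists v, exists2 delta : R, 0 < delta & forall s, quadrant Rel t s ->
  (forall j, rhoE (s j) (t j) < delta) -> cell k s = v.
Proof.
pose q j (i : 'I_(2 ^ k)) := qt j ((val i)%:R / 2 ^+ k).
have [delta d0 hd] := @finite_delta R ('I_d * 'I_(2 ^ k))%type (fun p delta => forall u : \bar R,
    rhoE u (t p.1) < delta -> (if Rel p.1 then (t p.1 <= u)%E else (u < t p.1)%E) ->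
    (q p.1 p.2 <= u)%E = (if Rel p.1 then (q p.1 p.2 <= t p.1)%E else (q p.1 p.2 < t p.1)%E))
  (fun p => cmp_quad _ _ _) (fun p a b ab h u sa => h u (lt_le_trans sa ab)).
exists (fun j => \max_(i < 2 ^ k | if Rel j then (q j i <= t j)%E else (q j i < t j)%E) i).
exists delta => // s qs rs; apply/funext => j; rewrite /cell; apply: eq_bigl => i.
exact: (hd (j, i) _ (rs j) (qs j)).
Qed.

Definition step (k : nat) (z : ('I_d -> nat) -> R) t : R := z (cell k t).

Lemma step_cadlag k z : cadlag (step k z).
Proof.
apply: cadlag_locally_const => t Rel; have [v [delta d0 hd]] := cell_quad k t Rel.
by exists (z v), delta => // s qs rs; rewrite /step hd.
Qed.

(** Cells need not shrink, as a marginal may be flat; what counts is that nearby points lie in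
    adjacent cells of any prescribed generation. *)
Lemma cell_dist_continuous (y : ('I_d -> \bar R) -> R) :
  (forall e, 0 < e -> exists k, forall s t, adjacent k s t -> `|y s - y t| < e) -> path_continuous y.
Proof.
move=> hy t e e0; have [k hk] := hy e e0; have [delta d0 hd] := cell_nbhd k t.
by exists delta => // s rs; apply: hk; exact: hd.
Qed.

Lemma ind_adjacent k s t : adjacent k s t ->
  bracket P X (fun j => ((cell k t j)%:R - 1) / 2 ^+ k) (fun j => ((cell k t j)%:R + 2) / 2 ^+ k) (ind s).
Proof.
move=> st; have k0 : 0 <= (2 ^+ k)^-1 :> R by rewrite invr_ge0 exprn_ge0.
apply: (bracket_sub mX cF _ _ (ind_cell mX cF k s)) => j; have /andP[h1 h2] := st j.
  by rewrite ler_wpM2r// lerBlDr natr1 ler_nat.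
by rewrite ler_wpM2r// -natrD ler_nat addn2 ltnS.
Qed.

(** The hypothesis [distF_continuous] concerns finite points. At infinite ones continuity comes from
    the grid: between adjacent cells F changes by at most 3 d / 2^k. *)
Lemma distF_path_continuous : path_continuous (distF P X).
Proof.
apply: cell_dist_continuous => e e0.
have [k hk] : exists k, 3 * d%:R / 2 ^+ k < e.
  exists (Num.truncn (3 * d%:R / e)).+1; rewrite ltr_pdivrMr ?exprn_gt0// [e * _]mulrC -ltr_pdivrMr//.
  by rewrite (lt_le_trans (truncnS_gt _))// -natrX ler_nat ltnW// ltn_expl.
exists k => s t st; apply: le_lt_trans hk.
have distE u : distF P X u = mean P X (ind u).
  rewrite /distF /mean (_ : (fun w => _) = \1_[set w | leRd (X 0%N w) u]).
    by rewrite Ex_indic//; exact: measurable_leRd.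
  by apply/funext => w; rewrite indE indicE; congr (_%:R).
have k0 : 0 <= (2 ^+ k)^-1 :> R by rewrite invr_ge0 exprn_ge0.
have os : obs_bmeas X (ind s) by exact: obs_ind.
have ot : obs_bmeas X (ind t) by exact: obs_ind.
rewrite !distE -meanB//.
have b1 := ind_adjacent st; have b2 := ind_adjacent (eq_cell_adjacent (erefl (cell k t))).
apply: (@le_trans _ _ (mean P X (fun y => `|ind s y - ind t y|))).
  by apply: le_norm_Ex; exact: bmeasB.
apply: (le_trans (mean_bracket_diff mX cF _ os ot b1 b2)).
  by move=> j; rewrite ler_wpM2r//; lra.
apply: (@le_trans _ _ (\sum_(j < d) 3 / 2 ^+ k)).
  by apply: ler_sum => j _; rewrite -mulrBl ler_wpM2r//; lra.
by rewrite sumr_const card_ord -[leLHS]mulr_natl; lra.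
Qed.

Lemma Un_cadlag n w : cadlag (Un P X n w).
Proof.
rewrite /Un; apply: cadlagZ; apply: cadlag_sum => i.
under eq_fun do rewrite -mulN1r.
apply: cadlagD; first exact: ind_cadlag.
by apply: cadlagZ; apply: path_continuous_cadlag; exact: distF_path_continuous.
Qed.

Definition grid (k : nat) (i : 'I_d -> nat) : 'I_d -> \bar R := fun j => qt j ((i j)%:R / 2 ^+ k).

Lemma cell_grid k i : (forall j, (i j < 2 ^ k)%N) -> cell k (grid k i) = i.
Proof.
move=> ik; apply/funext => j; apply/eqP; rewrite eqn_leq.
have k0 : 0 < (2 ^+ k)^-1 :> R by rewrite invr_gt0 exprn_gt0.
apply/andP; split; last by rewrite cell_geP.
rewrite leqNgt; apply/negP => h.
have := cell_le mX cF k (grid k i) j; rewrite /grid leNgt => /negP; apply.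
apply: (qt_lt mX cF).
- by rewrite ltr_pM2r// ltr_nat.
- by rewrite mulr_gt0// ltr0n (leq_ltn_trans _ h).
- by rewrite ltr_pdivrMr ?exprn_gt0// mul1r -natrX ltr_nat.
Qed.

End CellTopology.

(** * Limit process *)

Lemma inv_sqrt_cvg {R : realType} : (Num.sqrt n%:R)^-1 @[n --> \oo] --> (0 : R).
Proof.
apply/cvgrPdist_le => e e0; exists (Num.truncn (e ^- 2)).+1 => // n /= hn.
rewrite sub0r normrN ger0_norm ?invr_ge0 ?sqrtr_ge0//.
have n0 : 0 < n%:R :> R by rewrite ltr0n (leq_trans _ hn).
rewrite -[leRHS]invrK lef_pV2 ?posrE ?sqrtr_gt0 ?invr_gt0//.
rewrite -(ger0_norm (ltW (_ : 0 < e^-1))) ?invr_gt0// -sqrtr_sqr ler_sqrt ?(ltW n0)//.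
rewrite exprVn; apply: (le_trans (ltW (truncnS_gt _))).
by rewrite ler_nat.
Qed.

Section LimitProcess.
Context {R : realType} {dT} {T : measurableType dT} (P : probability T R) (d : nat).
Context (X : nat -> T -> 'I_d -> R).
Hypothesis mX : forall i j, measurable_fun setT (fun w => X i w j).
Hypothesis cF : distF_continuous P X.
Context (V : set_system nat) (UV : UltraFilter V) (oV : \oo `<=` V).
Local Notation pt := ('I_d -> \bar R).
Local Notation L := (@loebT _ T V UV).
Local Notation Q := (loeb_prob P UV oV).
Local Notation adjacent := (adjacent P X).
Context (U : nat -> T -> pt -> R) (good : nat -> nat -> set T) (eta : nat -> R) (c x : R).
Hypothesis mU : forall n t, measurable_fun setT (fun w => U n w t).
Hypothesis U0 : forall w t, U 0%N w t = 0.
Hypothesis mgood : forall n m, measurable (good n m).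
Hypothesis ndgood : forall n m, good n m `<=` good n m.+1.
Hypothesis pgood : forall n m, prob P (~` good n m) <= eta m.
Hypothesis eta0 : forall e, 0 < e -> exists m, eta m <= e.
Hypotheses (c0 : 0 <= c) (x0 : 0 < x) (x1 : x < 1).
Hypothesis equic : forall n m k w s t, (2 ^ k <= n)%N -> good n m w -> adjacent k s t ->
  `|U n w s - U n w t| <= c * (2 ^+ m * x ^+ k + (Num.sqrt n%:R)^-1).
Hypothesis bounded : forall n m w t, (0 < n)%N -> good n m w -> `|U n w t| <= c * (2 ^+ m + 1).

Definition ugood (m : nat) : set L := internal (fun n => good n m).

(* Off the good events, which form a null set, the path is set to 0 so that
   every path is continuous. *)
Definition W (t : pt) (w : L) : R :=
  if `[< exists m, ugood m w >] then ulim V (fun n => U n (w n) t) else 0.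

Let bounded' n m w t : good n m w -> `|U n w t| <= c * (2 ^+ m + 1).
Proof.
case: n => [_|n]; last exact: bounded.
by rewrite U0 normr0 mulr_ge0// addr_ge0// exprn_ge0.
Qed.

Lemma measurable_ugood m : measurable (ugood m).
Proof. exact: measurable_internal. Qed.

Lemma le_ugood m1 m2 : (m1 <= m2)%N -> ugood m1 `<=` ugood m2.
Proof.
move=> /subnK <-; elim: (m2 - m1)%N => // k IH w /IH.
by rewrite addSn; apply: filterS => n; exact: ndgood.
Qed.

Lemma prob_ugood m : prob Q (~` ugood m) <= eta m.
Proof.
rewrite /ugood internalC /prob /= [X in fine X](loeb_measure_internal P UV oV)/=; last first.
  by move=> n; exact: measurableC.
have mC n : measurable (~` good n m) by exact: measurableC.
apply: (ulim_le (prob_ulim_cvg UV mC)).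
by apply: filterS (@filterT _ V _) => n _; exact: pgood.
Qed.

Lemma W_cvg m w t : ugood m w -> U n (w n) t @[n --> V] --> W t w.
Proof.
move=> gw; rewrite /W; case: asboolP => [_|[]]; last by exists m.
apply: (@ulim_cvg _ _ _ _ (c * (2 ^+ m + 1))).
by apply: filterS gw => n; exact: bounded'.
Qed.

Lemma W_bounded m w t : ugood m w -> `|W t w| <= c * (2 ^+ m + 1).
Proof.
move=> gw; have h : `|U n (w n) t| @[n --> V] --> `|W t w|.
  by apply: cvg_norm; exact: W_cvg gw.
apply: (ulim_le h).
by apply: filterS gw => n; exact: bounded'.
Qed.

Let sqrt_cvg : (Num.sqrt n%:R)^-1 @[n --> V] --> (0 : R).
Proof. by move=> A /inv_sqrt_cvg /oV. Qed.

Lemma W_equicont m k w s t : ugood m w -> adjacent k s t ->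
  `|W s w - W t w| <= c * (2 ^+ m * x ^+ k).
Proof.
move=> gw st; rewrite -subr_le0.
have h : `|U n (w n) s - U n (w n) t| - c * (2 ^+ m * x ^+ k + (Num.sqrt n%:R)^-1) @[n --> V] -->
    `|W s w - W t w| - c * (2 ^+ m * x ^+ k + 0).
  apply: cvgB; first by apply: cvg_norm; apply: cvgB; exact: W_cvg gw.
  by apply: cvgM; [exact: cvg_cst|apply: cvgD; [exact: cvg_cst|exact: sqrt_cvg]].
rewrite addr0 in h; apply: (ulim_le h).
have Vk : V [set n | (2 ^ k <= n)%N] by apply: oV; exists (2 ^ k)%N.
by apply: filterS (filterI Vk gw) => n [kn gn]/=; rewrite subr_le0 equic.
Qed.

Lemma geo_lt (a e : R) : 0 <= a -> 0 < e -> exists k, a * x ^+ k < e.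
Proof.
move=> a0 e0; have : a * x ^+ k @[k --> \oo] --> a * 0.
  by apply: cvgM; [exact: cvg_cst|apply: cvg_expr; rewrite gtr0_norm].
rewrite mulr0 => /cvgr_lt/(_ _ e0)[k _ hk].
by exists k; apply: hk => /=.
Qed.

Lemma W_path_continuous w : path_continuous (fun t => W t w).
Proof.
have [[m gw]|nw] := pselect (exists m, ugood m w); last first.
  move=> t e e0; exists 1 => // s _; rewrite /W.
  by case: asboolP => // _; rewrite subrr normr0.
apply: (cell_dist_continuous mX cF) => e e0.
have [|k hk] := @geo_lt (c * 2 ^+ m) e _ e0; first by rewrite mulr_ge0// exprn_ge0.
exists k => s t st; apply: le_lt_trans hk; rewrite -mulrA.
exact: W_equicont gw st.
Qed.

(** [U n] has no uniform bound, so [W] is written as the limit in m of the standard parts of the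
    truncations to [good n m]. At each point this sequence is eventually constant: equal to [W] on a
    good path, and 0 otherwise. *)
Lemma measurable_W t : measurable_fun setT (W t).
Proof.
pose f m n w : R := \1_(good n m) w * U n w t.
have mf m n : measurable_fun setT (f m n).
  by apply: measurable_funM => //; exact: measurable_indic.
have fM m n w : `|f m n w| <= c * (2 ^+ m + 1).
  rewrite /f indicE; have [gw|gw] := boolP (w \in good n m).
    by rewrite mul1r bounded'//; exact: set_mem.
  by rewrite mul0r normr0 mulr_ge0// addr_ge0// exprn_ge0.
apply: (measurable_fun_cvg (fun m => st_measurable (UV := UV) (mf m) (fM m))) => w _.
have [[m0 gw]|nw] := pselect (exists m, ugood m w).
  apply: cvg_near_cst; exists m0 => // m /= /le_ugood/(_ _ gw) gm.
  rewrite /st /W asboolT; last by exists m0.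
  apply: ulim_near; apply: filterS gm => n gn /=.
  by rewrite /f indicE mem_set// mul1r.
apply: cvg_near_cst; exists 0%N => // m _.
rewrite /st /W asboolF//; apply: ulimE; apply: cvg_near_cst.
apply: filterS (_ : V [set n | ~ good n m (w n)]) => [n /= gn|].
  by rewrite /f indicE memNset// mul0r.
by apply: (@ultraC _ UV [set n | good n m (w n)]) => gw; apply: nw; exists m.
Qed.

Definition lin (l : seq (R * pt)) (z : pt -> R) : R := \sum_(p <- l) p.1 * z p.2.

Lemma lin_cons a t l z : lin ((a, t) :: l) z = a * z t + lin l z.
Proof. by rewrite /lin big_cons. Qed.

Lemma measurable_lin {dS} {S : measurableType dS} (Y : S -> pt -> R) l :
  (forall t, measurable_fun setT (fun w => Y w t)) -> measurable_fun setT (fun w => lin l (Y w)).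
Proof.
move=> mY; elim: l => [|[a t] l IH].
  by under eq_fun do rewrite /lin big_nil; exact: measurable_cst.
under eq_fun do rewrite lin_cons.
by apply: measurable_funD => //; apply: measurable_funM => //; exact: measurable_cst.
Qed.

Lemma lin_cvg m w l : ugood m w -> lin l (U n (w n)) @[n --> V] --> lin l (fun t => W t w).
Proof.
move=> gw; elim: l => [|[a t] l IH].
  by under eq_fun do rewrite /lin big_nil; rewrite /lin big_nil; exact: cvg_cst.
under eq_fun do rewrite lin_cons; rewrite lin_cons.
by apply: cvgD => //; apply: cvgM; [exact: cvg_cst|exact: W_cvg gw].
Qed.

(** By continuity of [g], the standard part of g(lin l U_n) equals g(lin l W) on every [ugood m];
    the complements have arbitrarily small probability, so [Ex_st] gives the limit. *)
Lemma Ex_W l (g : R -> R) M : continuous g -> (forall y, `|g y| <= M) ->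
  Ex P (fun w => g (lin l (U n w))) @[n --> V] --> Ex Q (fun w => g (lin l (fun t => W t w))).
Proof.
move=> cg gM; have mg : measurable_fun setT g by exact: continuous_measurable_fun.
pose f n w := g (lin l (U n w)).
have mf n : measurable_fun setT (f n).
  by apply: (measurableT_comp mg); exact: measurable_lin.
have fM n w : `|f n w| <= M by exact: gM.
rewrite (_ : Ex Q _ = Ex Q (st f)); first exact: Ex_st.
have M0 : 0 <= M by exact: le_trans (gM 0).
have bW : bmeas (fun w => g (lin l (fun t => W t w))).
  split; last by exists M => w.
  by apply: (measurableT_comp mg); apply: measurable_lin => t; exact: measurable_W.
have bst : bmeas (st (UV := UV) f) by exact: st_bmeas fM.
apply/eqP; rewrite -subr_eq0 -ExB// -normr_le0; apply/ler_addgt0Pl => e e0; rewrite addr0.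
have [|m hm] := eta0 (e := e / (M + M + 1)); first by rewrite divr_gt0// ltr_wpDl// addr_ge0.
have mC : measurable (~` ugood m) by apply: measurableC; exact: measurable_ugood.
apply: (le_trans (le_norm_Ex _ _)); first exact: bmeasB.
apply: (@le_trans _ _ (Ex Q (fun w => (M + M) * \1_(~` ugood m) w))).
  apply: le_Ex; first by apply: bmeas_norm; exact: bmeasB.
    by apply: bmeasZ; exact: bmeas_indic.
  move=> w; rewrite indicE; have [gw|gw] := pselect (ugood m w).
    rewrite (_ : st f w = g (lin l (fun t => W t w))).
      by rewrite subrr normr0 mulr_ge0// addr_ge0.
    by apply: ulimE; apply: continuous_cvg; [exact: cg|exact: lin_cvg gw].
  rewrite mem_set// mulr1 (le_trans (ler_normB _ _))// lerD//.
  exact: (st_bound fM).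
rewrite ExZ; last exact: bmeas_indic.
rewrite -prob_Ex// (le_trans (ler_wpM2l _ (le_trans (prob_ugood m) hm)))//; first by rewrite addr_ge0.
rewrite mulrCA ler_piMr ?(ltW e0)// ler_pdivrMr ?mul1r ?lerDl//.
by rewrite ltr_wpDl// addr_ge0.
Qed.

End LimitProcess.

(** * Approximation of test functions *)

Section SineChart.
Context {R : realType}.
Implicit Types (a b u : R).

Lemma sin_slope a b : a <= b -> exists2 c, a <= c <= b & sin b - sin a = cos c * (b - a).
Proof.
move=> ab; have hc : {within `[a, b], continuous (@sin R)}.
  by apply: continuous_subspaceT => y; exact: continuous_sin.
have hd z : z \in `]a, b[%R -> is_derive z 1 (@sin R) (cos z) by move=> _; exact: is_derive_sin.
have [c cab ->] := MVT_segment ab hd hc.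
by exists c => //; move: cab; rewrite in_itv.
Qed.

Lemma sin_lip a b : `|sin a - sin b| <= `|a - b|.
Proof.
wlog ab : a b / a <= b.
  by move=> h; have [/h//|/ltW/h] := leP a b; rewrite distrC [leRHS]distrC.
have [c _ e] := sin_slope ab.
rewrite distrC [leRHS]distrC e normrM ler_piMl// ler_norml.
by rewrite cos_geN1 cos_le1.
Qed.

(** The mean value theorem with cos >= 1/2 on [-1, 1], which follows from cos c = 1 - 2 sin^2(c/2)
    and |sin u| <= |u|. It makes the chart invertible there with Lipschitz inverse. *)
Lemma sin_expand a b : `|a| <= 1 -> `|b| <= 1 -> `|a - b| <= 2 * `|sin a - sin b|.
Proof.
wlog ab : a b / a <= b.
  move=> h a1 b1; have [ab|/ltW ab] := leP a b; first exact: h.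
  by rewrite distrC [X in 2 * X]distrC; exact: h.
move=> a1 b1; have [c /andP[ac cb] e] := sin_slope ab.
have c2 : cos c >= 2^-1.
  have -> : c = c / 2 + c / 2 by field.
  have := sin_lip (c / 2) 0; rewrite sin0 !subr0 => h.
  have c1 : `|c / 2| <= 2^-1.
    move: a1 b1; rewrite !ler_norml => /andP[h1 h2] /andP[h3 h4].
    by apply/andP; split; lra.
  rewrite cosD; have := cos2Dsin2 (c / 2) => hcs.
  have h4 : sin (c / 2) ^+ 2 <= 4^-1.
    rewrite -real_normK ?num_real// (@le_trans _ _ (2^-1 ^+ 2))//; last by lra.
    by rewrite ler_sqr ?nnegrE// (le_trans h).
  rewrite -!expr2; lra.
rewrite distrC [X in 2 * X]distrC e normrM mulrA ler_peMl// ger0_norm; lra.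
Qed.

(** Values in [0, 1] are admissible arguments of Bernstein operators; with a sine, unlike a
    truncation, polynomials in the chart stay in the span of cosines of linear forms. *)
Definition chart u : R := (1 + sin u) / 2.

Lemma chart_itv u : 0 <= chart u <= 1.
Proof.
by have := sin_geN1 u; have := sin_le1 u => h1 h2; rewrite /chart; apply/andP; split; lra.
Qed.

End SineChart.

(** * Bernstein operators in several variables *)

Section Bernstein.
Context {R : realType} (N : nat).
Implicit Types (u : R) (us : seq R).

(** The expectation of f(S) for S binomial with parameters [n] and [u], by conditioning on one
    trial. The argument of [f] is the count, not the frequency. *)
Fixpoint bern (n : nat) (f : nat -> R) u : R :=
  if n is m.+1 then u * bern m (fun j => f j.+1) u + (1 - u) * bern m f u else f 0%N.

Lemma le_bern n f g u : 0 <= u <= 1 -> (forall j, f j <= g j) -> bern n f u <= bern n g u.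
Proof.
move=> /andP[u0 u1]; elim: n f g => [|n IH] f g fg; first exact: fg.
by apply: lerD; apply: ler_wpM2l; rewrite ?subr_ge0//; apply: IH => j; exact: fg.
Qed.

(** Variance plus squared bias. The centre [a] is arbitrary because a success in the conditioned
    trial moves it to a - 1. *)
Lemma bern_sqr n u a b K :
  bern n (fun j => b + K * (j%:R - a) ^+ 2) u = b + K * (n%:R * (u * (1 - u)) + (n%:R * u - a) ^+ 2).
Proof.
elim: n a => [|n IH] a /=; first by ring.
rewrite IH; under [X in u * bern n X _]eq_fun => j do rewrite -natr1 -addrA -[1 - a]opprB.
by rewrite IH -natr1; ring.
Qed.

(** The expectation over independent binomial counts, one for each entry of [us]. *)
Fixpoint mbern us (F : seq nat -> R) : R :=
  if us is u :: us' then bern N (fun j => mbern us' (fun v => F (j :: v))) u else F [::].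

Definition unit_seq us := forall u, u \in us -> 0 <= u <= 1.

Lemma le_mbern us F G : unit_seq us -> (forall v, size v = size us -> F v <= G v) ->
  mbern us F <= mbern us G.
Proof.
elim: us F G => [|u us IH] F G us01 FG; first exact: FG.
apply: le_bern => [|j]; first by apply: us01; rewrite inE eqxx.
apply: IH => [u' u'us|v vs]; first by apply: us01; rewrite inE u'us orbT.
by apply: FG; rewrite /= vs.
Qed.

Definition spread us (v : seq nat) : R := \sum_(p <- zip us v) (p.2%:R - N%:R * p.1) ^+ 2.

Lemma mbern_spread us a K :
  mbern us (fun v => a + K * spread us v) = a + K * \sum_(u <- us) N%:R * (u * (1 - u)).
Proof.
elim: us a => [|u us IH] a /=; first by rewrite /spread /= !big_nil.
have -> : (fun j => mbern us (fun v => a + K * spread (u :: us) (j :: v))) =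
    (fun j => (a + K * \sum_(u <- us) N%:R * (u * (1 - u))) + K * (j%:R - N%:R * u) ^+ 2).
  apply/funext => j; rewrite addrAC -IH; congr mbern; apply/funext => v.
  by rewrite /spread /= big_cons/=; ring.
by rewrite bern_sqr big_cons; ring.
Qed.

Lemma norm_mbern_le us F M : unit_seq us -> (forall v, `|F v| <= M) -> `|mbern us F| <= M.
Proof.
move=> us01 FM; have cst a : a = mbern us (fun v => a + 0 * spread us v).
  by rewrite mbern_spread mul0r addr0.
rewrite ler_norml {1}(cst (- M)) {2}(cst M); apply/andP; split; apply: le_mbern => // v _;
  by have := FM v; rewrite mul0r addr0 ler_norml => /andP[].
Qed.

Lemma spread_ge us v i a : size v = size us -> (i < size us)%N -> 0 <= a ->
  a < `|(nth 0%N v i)%:R - N%:R * nth 0 us i| -> a ^+ 2 <= spread us v.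
Proof.
move=> vs iu a0 ai.
have iz : (i < size (zip us v))%N by rewrite size_zip vs minnn.
rewrite /spread (big_nth (0, 0%N)) big_mkord (bigD1 (Ordinal iz))//= nth_zip//=.
rewrite ler_wpDr//; first by apply: sumr_ge0 => j _; exact: sqr_ge0.
by rewrite -[leRHS]real_normK ?num_real// ler_sqr ?nnegrE// ltW.
Qed.

(** Chebyshev's inequality: if some count is further than [a] from its mean, then [spread] exceeds
    a^2, so |F - C| <= b + (M / a^2) spread holds pointwise. The operator is monotone, and the mean
    of the spread is a sum of variances N u (1 - u) <= N. *)
Lemma mbern_approx us F C b M a : unit_seq us -> 0 < a -> 0 <= M -> 
  (forall v, size v = size us -> `|F v - C| <= b + M) ->
  (forall v, size v = size us ->
     (forall i, (i < size us)%N -> `|(nth 0%N v i)%:R - N%:R * nth 0 us i| <= a) -> `|F v - C| <= b) ->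
  `|mbern us F - C| <= b + M / a ^+ 2 * ((size us)%:R * N%:R).
Proof.
move=> us01 a0 M0 FM Fb; set K := M / a ^+ 2.
have K0 : 0 <= K by rewrite divr_ge0// exprn_ge0// ltW.
have sum_le : \sum_(u <- us) N%:R * (u * (1 - u)) <= (size us)%:R * N%:R :> R.
  elim: us us01 {FM Fb} => [|u us IH] us01; first by rewrite big_nil mul0r.
  rewrite big_cons /= -natr1 mulrDl mul1r addrC lerD//.
    by apply: IH => u' u'us; apply: us01; rewrite inE u'us orbT.
  have /andP[u0 u1] : 0 <= u <= 1 by apply: us01; rewrite inE eqxx.
  by rewrite ler_piMr// mulr_ile1// ?subr_ge0// gerBl.
have key v : size v = size us -> `|F v - C| <= b + K * spread us v.
  move=> vs; have s0 : 0 <= spread us v by apply: sumr_ge0 => p _; exact: sqr_ge0.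
  have [h|h] := pselect (forall i, (i < size us)%N -> `|(nth 0%N v i)%:R - N%:R * nth 0 us i| <= a).
    by rewrite (le_trans (Fb v vs h))// lerDl mulr_ge0.
  have /existsNP[i /not_implyP[iu /negP]] := h; rewrite -ltNge => hi.
  rewrite (le_trans (FM v vs))// lerD2l /K mulrAC ler_pdivlMr ?exprn_gt0// ler_wpM2l//.
  exact: spread_ge iu (ltW a0) hi.
have step2 : b + K * \sum_(u <- us) N%:R * (u * (1 - u)) <= b + K * ((size us)%:R * N%:R).
  by rewrite lerD2l ler_wpM2l.
rewrite ler_norml; apply/andP; split.
  rewrite lerBrDr (le_trans _ (_ : mbern us (fun v => (C - b) + (- K) * spread us v) <= _))//.
    by rewrite mbern_spread; move: step2; lra.
  apply: le_mbern => // v vs; have := key v vs; rewrite ler_norml => /andP[h _].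
  by rewrite mulNr; lra.
rewrite lerBlDr (le_trans (_ : _ <= mbern us (fun v => (C + b) + K * spread us v)))//.
  apply: le_mbern => // v vs; have := key v vs; rewrite ler_norml => /andP[_ h].
  by lra.
by rewrite mbern_spread; move: step2; lra.
Qed.

End Bernstein.

(** * Trigonometric functionals of a path *)

Section TrigFunctionals.
Context {R : realType} (d : nat).
Local Notation pt := ('I_d -> \bar R).

Inductive trig : ((pt -> R) -> R) -> Prop :=
| trig_cos l b a : trig (fun z => a * cos (lin l z + b))
| trig_add f g : trig f -> trig g -> trig (fun z => f z + g z).

Lemma trig_scale a f : trig f -> trig (fun z => a * f z).
Proof.
elim=> [l b c|{}f g _ hf _ hg].
  by under eq_fun do rewrite mulrA; exact: trig_cos.
by under eq_fun do rewrite mulrDr; exact: trig_add.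
Qed.

Lemma trig_cst a : trig (fun=> a).
Proof.
rewrite (_ : (fun=> a) = (fun z => a * cos (lin [::] z + 0))); first exact: trig_cos.
by apply/funext => z; rewrite /lin big_nil addr0 cos0 mulr1.
Qed.

(** The product-to-sum formula, with sines written as cosines shifted by pi/2. *)
Lemma trig_sin c t f : trig f -> trig (fun z => sin (c * z t) * f z).
Proof.
elim=> [l b a|{}f g _ hf _ hg].
  rewrite (_ : (fun z => _) = (fun z => a / 2 * cos (lin ((c, t) :: l) z + (b - pi / 2)) +
      (- a / 2) * cos (lin ((- c, t) :: l) z + (b - pi / 2)))).
    by apply: trig_add; exact: trig_cos.
  apply/funext => z; rewrite !lin_cons; set u := c * z t; set q := lin l z.
  rewrite !mulNr -/u !addrA !cosBpihalf -!addrA !(sinD _ (q + b)) sinN cosN.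
  by field.
by under eq_fun do rewrite mulrDr; exact: trig_add.
Qed.

Lemma trig_chart c t f : trig f -> trig (fun z => chart (c * z t) * f z).
Proof.
move=> hf; rewrite (_ : (fun z => _) = (fun z => 2^-1 * f z + 2^-1 * (sin (c * z t) * f z))).
  by apply: trig_add; apply: trig_scale => //; exact: trig_sin.
by apply/funext => z; rewrite /chart; field.
Qed.

Lemma trig_bern n c t (f : nat -> (pt -> R) -> R) : (forall j, trig (f j)) ->
  trig (fun z => bern n (fun j => f j z) (chart (c * z t))).
Proof.
elim: n f => [|n IH] f hf; first exact: hf.
rewrite (_ : (fun z => _) = (fun z => chart (c * z t) * bern n (fun j => f j.+1 z) (chart (c * z t)) +
   (bern n (fun j => f j z) (chart (c * z t)) +
     (- 1) * (chart (c * z t) * bern n (fun j => f j z) (chart (c * z t)))))).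
  apply: trig_add; first by apply: trig_chart; exact: (IH (fun j => f j.+1)).
  by apply: trig_add; [exact: IH|apply: trig_scale; apply: trig_chart; exact: IH].
by apply/funext => z /=; ring.
Qed.

Lemma trig_mbern N c (ts : seq pt) F :
  trig (fun z => mbern N [seq chart (c * z t) | t <- ts] F).
Proof.
elim: ts F => [|t ts IH] F; first exact: trig_cst.
by apply: trig_bern => j; exact: IH.
Qed.

End TrigFunctionals.

(** * Uniform approximation on equicontinuous families *)

Section UniformApproximation.
Context {R : realType} {dT} {T : measurableType dT} (P : probability T R) (d : nat).
Context (X : nat -> T -> 'I_d -> R).
Hypothesis mX : forall i j, measurable_fun setT (fun w => X i w j).
Hypothesis cF : distF_continuous P X.
Local Notation pt := ('I_d -> \bar R).
Local Notation cell := (cell P X).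
Local Notation adjacent := (adjacent P X).
Context (B : R) (om : nat -> R).
Hypothesis om0 : forall e, 0 < e -> exists k, om k <= e.

(** The modulus is required up to generation [N] only and with slack 1/(N+1): on a good event the
    jumping paths of the empirical process meet this once n is large, and the limit paths meet it
    for all [N]. *)
Definition eqfam (N : nat) : set (pt -> R) :=
  [set x | [/\ cadlag x, forall t, `|x t| <= B & forall k s t, (k <= N)%N -> adjacent k s t ->
     `|x s - x t| <= om k + N.+1%:R^-1]].

Lemma le_eqfam N1 N2 : (N1 <= N2)%N -> eqfam N2 `<=` eqfam N1.
Proof.
move=> N12 x [cx xB hx]; split=> // k s t kN st.
rewrite (le_trans (hx k s t (leq_trans kN N12) st))// lerD2l lef_pV2 ?posrE// ler_nat.
by rewrite ltnS.
Qed.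

Lemma small_inv (e : R) : 0 < e -> exists n, forall m, (n <= m)%N -> m.+1%:R^-1 <= e.
Proof.
move=> e0; exists (Num.truncn e^-1) => m nm.
rewrite invf_ple ?posrE// (le_trans (ltW (truncnS_gt _)))// ler_nat ltnS.
exact: nm.
Qed.

Lemma grid_cell k t : cell k (grid P X k (cell k t)) = cell k t.
Proof. by apply: (cell_grid mX cF) => j; exact: cell_lt. Qed.

(* A sequence of counterexamples would converge uniformly along an ultrafilter
   to a continuous path, where h is continuous. *)
Lemma test_uniform h e : D_test_function h -> 0 < e -> exists2 delta : R, 0 < delta &
  exists N, forall x y, eqfam N x -> cadlag y -> (forall t, `|y t - x t| <= delta) ->
    `|h y - h x| < e.
Proof.
move=> hh e0; apply: contrapT => H.
have /choice[xy hxy] n : exists xy : (pt -> R) * (pt -> R), [/\ eqfam n xy.1, cadlag xy.2,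
    forall t, `|xy.2 t - xy.1 t| <= n.+1%:R^-1 & e <= `|h xy.2 - h xy.1|].
  apply: contrapT => K; apply: H; exists n.+1%:R^-1; first by rewrite invr_gt0.
  exists n => x y ex cy yx; rewrite ltNge; apply/negP => le.
  by apply: K; exists (x, y).
have [V [UV oV]] := ultraFilterLemma (eventually_filter : ProperFilter \oo).
pose x n := (xy n).1; pose y n := (xy n).2; pose z t := ulim V (fun n => x n t).
have xz t : x n t @[n --> V] --> z t.
  apply: (@ulim_cvg _ _ _ _ B); apply: filterS (@filterT _ V _) => n _ /=.
  by have [[_ h1 _] _ _ _] := hxy n; exact: h1.
have inv0 : n.+1%:R^-1 @[n --> V] --> (0 : R).
  apply: cvg_trans (cvg_harmonic (R := R)) => A /=.
  exact: oV.
have zadj k s t : adjacent k s t -> `|z s - z t| <= om k.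
  move=> st; have c1 : `|x n s - x n t| - n.+1%:R^-1 @[n --> V] --> `|z s - z t| - 0.
    by apply: cvgB => //; apply: cvg_norm; apply: cvgB; exact: xz.
  rewrite subr0 in c1; apply: (ulim_le c1).
  have Vk : V [set n | (k <= n)%N] by apply: oV; exists k.
  apply: filterS Vk => n /= kn; have [[_ _ h1] _ _ _] := hxy n.
  by rewrite lerBlDr h1.
have cz : cadlag z.
  apply: path_continuous_cadlag; apply: (cell_dist_continuous mX cF) => a a0.
  have [|k hk] := @om0 (a / 2); first by rewrite divr_gt0.
  exists k => s t st; apply: (le_lt_trans (zadj _ _ _ st)); apply: (le_lt_trans hk).
  by rewrite ltr_pdivrMr// ltr_pMr// ltr1n.
have [|delta d0 hd] := test_near hh cz (_ : 0 < e / 2); first by rewrite divr_gt0.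
have d8 : 0 < delta / 8 by rewrite divr_gt0.
have [k hk] := om0 d8.
(* Convergence at the finitely many grid points is enough: the moduli of [x n] and [z] carry it from
   a grid point to its whole cell, so it is uniform. *)
have Vgrid : V [set n | forall f : {ffun 'I_d -> 'I_(2 ^ k)},
    `|x n (grid P X k (fun j => f j)) - z (grid P X k (fun j => f j))| <= delta / 8].
  apply: filter_forall => f.
  by have /cvgrPdist_le/(_ _ d8) := xz (grid P X k (fun j => f j)); apply: filterS => n; rewrite distrC.
have Vk : V [set n | (k <= n)%N] by apply: oV; exists k.
have [N hN] := small_inv d8.
have VN : V [set n | (N <= n)%N] by apply: oV; exists N.
have : V (set0 : set nat); last by apply: filter_not_empty.
apply: filterS (filterI Vgrid (filterI Vk VN)) => n [/= hg [kn Nn]].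
have [[cx xB xo] cy yx] := hxy n; rewrite leNgt => /negP; apply.
have xz4 t : `|x n t - z t| <= delta / 2.
  pose f : {ffun 'I_d -> 'I_(2 ^ k)} := [ffun j => Ordinal (cell_lt P X k t j)].
  set g := grid P X k (fun j => f j).
  have cg : cell k g = cell k t.
    rewrite /g (_ : (fun j => _) = cell k t) ?grid_cell//.
    by apply/funext => j; rewrite ffunE.
  have a1 : `|x n t - x n g| <= delta / 8 + delta / 8.
    rewrite (le_trans (xo k t g kn _)) ?lerD// ?hN//.
    exact: eq_cell_adjacent.
  have a2 : `|z g - z t| <= delta / 8.
    by rewrite (le_trans _ hk)// zadj//; exact: eq_cell_adjacent.
  have := hg f; rewrite -/g => a3.
  rewrite (_ : x n t - z t = (x n t - x n g) + (x n g - z g) + (z g - z t)); last by ring.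
  rewrite (le_trans (ler_normD _ _))// (le_trans (lerD (ler_normD _ _) (lexx _)))//.
  by clear -a1 a2 a3; lra.
have b1 : `|h (x n) - h z| < e / 2.
  by apply: hd => // t; rewrite (le_trans (xz4 t))// ler_piMr ?(ltW d0)//; lra.
have b2 : `|h (y n) - h z| < e / 2.
  apply: hd => // t; rewrite (_ : y n t - z t = (y n t - x n t) + (x n t - z t)); last by ring.
  have := le_trans (yx t) (hN n Nn); have := xz4 t; rewrite -/(x n) -/(y n) => c1 c2.
  by rewrite (le_trans (ler_normD _ _))//; clear -c1 c2 d0; lra.
rewrite -/(x n) -/(y n) (_ : h (y n) - h (x n) = (h (y n) - h z) - (h (x n) - h z)); last by ring.
by rewrite (le_lt_trans (ler_normB _ _))//; clear -b1 b2; lra.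
Qed.

(** [F] maps counts to values at the grid points, rebuilds a step path and applies [h]. If each
    frequency is close to the chart of the true grid value, the step path is uniformly close to x
    and [test_uniform] applies; other counts are handled by [mbern_approx]. Being an average of
    values of [h], the approximation keeps the bound [M]. *)
Lemma trig_approx h M e : D_test_function h -> (forall z, `|h z| <= M) -> 0 < e -> 0 <= B ->
  exists f, [/\ trig f, forall z, `|f z| <= M &
    exists N, forall x, eqfam N x -> `|h x - f x| <= e].
Proof.
move=> hh hM e0 B0.
have M0 : 0 <= M by exact: le_trans (hM (fun=> 0)).
have e2 : 0 < e / 2 by rewrite divr_gt0.
have [delta d0 [N1 hN1]] := test_uniform hh e2.
have d4 : 0 < delta / 4 by rewrite divr_gt0.
have [k hk] := om0 d4; have [N2 hN2] := small_inv d4.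
pose N := maxn N1 (maxn k N2).
have B1 : 0 < B + 1 by rewrite ltr_wpDl.
(* Two chart values within 2 a have sines within 4 a, arguments within 8 a and path values within 8
   a (B + 1) = delta / 2. *)
pose a := delta / (16 * (B + 1)).
have a0 : 0 < a by rewrite divr_gt0// mulr_gt0.
pose s y := chart ((B + 1)^-1 * y).
have s_inv y1 y2 : `|y1| <= B -> `|y2| <= B -> `|s y1 - s y2| <= 2 * a -> `|y1 - y2| <= delta / 2.
  move=> h1 h2 h3; have := @sin_expand R ((B + 1)^-1 * y1) ((B + 1)^-1 * y2).
  have le1 y' : `|y'| <= B -> `|(B + 1)^-1 * y'| <= 1.
    move=> y'B; rewrite normrM gtr0_norm ?invr_gt0// ler_pdivrMl// mulr1 (le_trans y'B)//.
    by rewrite lerDl.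
  move=> /(_ (le1 _ h1) (le1 _ h2)).
  rewrite -mulrBr normrM gtr0_norm ?invr_gt0// ler_pdivrMl// => h4.
  apply: (le_trans h4).
  have h5 : `|sin ((B + 1)^-1 * y1) - sin ((B + 1)^-1 * y2)| <= 4 * a.
    rewrite (_ : sin _ - sin _ = 2 * (s y1 - s y2)); last by rewrite /s /chart; field.
    by rewrite normrM ger0_norm//; lra.
  apply: (@le_trans _ _ ((B + 1) * (2 * (4 * a)))).
    by rewrite ler_pM2l// ler_wpM2l.
  rewrite le_eqVlt; apply/orP; left; apply/eqP; rewrite /a; field.
  by rewrite gt_eqF.
pose C := enum {ffun 'I_d -> 'I_(2 ^ k)}.
pose K := size C.
have [m [m0 hm]] : exists m : nat, (0 < m)%N /\ (M + M) * K%:R / (m%:R * a ^+ 2) <= e / 2.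
  pose b := (M + M) * K%:R / a ^+ 2.
  exists (Num.truncn (b / (e / 2))).+1; split=> //.
  rewrite invfM [_^-1 * _]mulrC mulrA -/b ler_pdivrMr// mulrC -ler_pdivrMr//.
  exact/ltW/truncnS_gt.
(* [zz j] decodes the count j: a value in [-B, B] whose chart is within [a] of j/m, if there is one.
   Otherwise the value is arbitrary, and 0 is used. *)
have /choice[zz hzz] (j : nat) : exists y, (exists y', `|y'| <= B /\ `|j%:R / m%:R - s y'| <= a) ->
    `|y| <= B /\ `|j%:R / m%:R - s y| <= a.
  have [[y' hy']|ny] := pselect (exists y', `|y'| <= B /\ `|j%:R / m%:R - s y'| <= a).
    by exists y'.
  by exists 0.
pose idx (c : 'I_d -> nat) := find (fun f : {ffun 'I_d -> 'I_(2 ^ k)} => [forall j, f j == c j :> nat]) C.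
have idxP t : (idx (cell k t) < K)%N /\ forall f0, (fun j => nat_of_ord (nth f0 C (idx (cell k t)) j)) = cell k t.
  have hh' : has (fun f : {ffun 'I_d -> 'I_(2 ^ k)} => [forall j, f j == cell k t j :> nat]) C.
    apply/hasP; exists [ffun j => Ordinal (cell_lt P X k t j)]; first by rewrite mem_enum.
    by apply/forallP => j; rewrite ffunE.
  split; first by rewrite -has_find.
  by move=> f0; have /forallP h1 := nth_find f0 hh'; apply/funext => j; exact/eqP/h1.
pose ts := [seq grid P X k (fun j => nat_of_ord (f j)) | f : {ffun 'I_d -> 'I_(2 ^ k)} <- C].
pose F v := h (step P X k (fun c => zz (nth 0%N v (idx c)))).
exists (fun z => mbern m [seq chart ((B + 1)^-1 * z t) | t <- ts] F).
have unit_us z : unit_seq [seq chart ((B + 1)^-1 * z t) | t <- ts].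
  by move=> u /mapP[t _ ->]; exact: chart_itv.
split; [exact: trig_mbern|move=> z|].
  by apply: norm_mbern_le => [|v]; [exact: unit_us|exact: hM].
exists N => x ex; rewrite distrC.
have exN1 : eqfam N1 x by apply: le_eqfam ex; rewrite leq_maxl.
have [cx xB xo] := ex.
set us := [seq chart _ | t <- ts].
have sus : size us = K by rewrite size_map /ts size_map /K.
have m0' : 0 < m%:R :> R by rewrite ltr0n.
have ma0 : 0 < m%:R * a by rewrite mulr_gt0.
apply: (@le_trans _ _ (e / 2 + (M + M) / (m%:R * a) ^+ 2 * ((size us)%:R * m%:R))); last first.
  rewrite sus (_ : (M + M) / (m%:R * a) ^+ 2 * (K%:R * m%:R) = (M + M) * K%:R / (m%:R * a ^+ 2)).
    by lra.
  by field; rewrite !gt_eqF.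
apply: mbern_approx => //.
- exact: unit_us.
- exact: addr_ge0.
- move=> v _; rewrite (le_trans (ler_normB _ _))// ler_wpDl ?(ltW e2)//.
  by apply: lerD; exact: hM.
move=> v vs hv; apply/ltW; apply: hN1 => //; first exact: step_cadlag.
move=> t; have [iK iE] := idxP t; rewrite /step; set i := idx (cell k t) in iK iE *.
pose g := grid P X k (cell k t).
have ui : nth 0 us i = s (x g).
  rewrite /us /ts -map_comp (nth_map [ffun j => Ordinal (cell_lt P X k t j)])//=.
  by rewrite iE.
have := hv i; rewrite sus ui => /(_ iK) hvi.
have near : `|(nth 0%N v i)%:R / m%:R - s (x g)| <= a.
  rewrite (_ : _ - _ = m%:R^-1 * ((nth 0%N v i)%:R - m%:R * s (x g))); last first.
    by field; rewrite gt_eqF.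
  by rewrite normrM gtr0_norm ?invr_gt0// ler_pdivrMl.
have [|zB zn] := hzz (nth 0%N v i); first by exists (x g).
have xg : `|x g - zz (nth 0%N v i)| <= delta / 2.
  apply: s_inv => //; rewrite (_ : s _ - s _ =
    ((nth 0%N v i)%:R / m%:R - s (zz (nth 0%N v i))) - ((nth 0%N v i)%:R / m%:R - s (x g))); last by ring.
  by rewrite (le_trans (ler_normB _ _))//; clear -zn near; lra.
have kN : (k <= N)%N by rewrite /N !leq_max leqnn orbT.
have tg : `|x t - x g| <= delta / 2.
  rewrite (le_trans (xo k t g kN _))//; first by apply: eq_cell_adjacent; rewrite grid_cell.
  have N2N : (N2 <= N)%N by rewrite /N !leq_max leqnn !orbT.
  rewrite (_ : delta / 2 = delta / 4 + delta / 4); last by field.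
  exact: lerD hk (hN2 N N2N).
rewrite (_ : zz _ - x t = - ((x t - x g) + (x g - zz (nth 0%N v i)))); last by ring.
by rewrite normrN (le_trans (ler_normD _ _))//; clear -xg tg; lra.
Qed.

End UniformApproximation.

(** * Integrals of functions that need not be measurable *)

Section NonmeasurableIntegral.
Context {R : realType} {dT} {T : measurableType dT} (P : probability T R).

Import HBNNSimple.

(* The integral is defined as a supremum over simple functions, hence it is
   monotone even on functions that are not measurable. *)
Lemma le_integral_any (f g : T -> R) : (forall w, f w <= g w) ->
  (\int[P]_w (f w)%:E <= \int[P]_w (g w)%:E)%E.
Proof.
move=> fg; rewrite /integral !patch_setT; apply: leeB; apply: le_ereal_sup => _ [s sf <-];
  exists s => // w; apply: (le_trans (sf w)).
  by rewrite !funeposE -!EFin_max lee_fin ge_max !le_max fg lexx orbT.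
by rewrite !funenegE -!EFinN -!EFin_max lee_fin ge_max !le_max lerN2 fg lexx orbT.
Qed.

Lemma integral_approx (f g b : T -> R) : bmeas g -> bmeas b ->
  (forall w, `|f w - g w| <= b w) ->
  exists c : R, (\int[P]_w (f w)%:E = c%:E)%E /\ `|c - Ex P g| <= Ex P b.
Proof.
move=> bg bb fg.
have h1 : ((Ex P g - Ex P b)%:E <= \int[P]_w (f w)%:E)%E.
  rewrite -ExB// -ExE; last exact: bmeasB.
  by apply: le_integral_any => w; have := fg w; rewrite ler_norml => /andP[? _]; lra.
have h2 : (\int[P]_w (f w)%:E <= (Ex P g + Ex P b)%:E)%E.
  rewrite -ExD// -ExE; last exact: bmeasD.
  by apply: le_integral_any => w; have := fg w; rewrite ler_norml => /andP[_ ?]; lra.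
have fin : (\int[P]_w (f w)%:E)%E \is a fin_num.
  by rewrite fin_numE -ltNye -ltey (lt_le_trans _ h1) ?ltNyr// (le_lt_trans h2) ?ltry.
exists (fine (\int[P]_w (f w)%:E)%E); rewrite fineK//; split=> //.
move: h1 h2; rewrite -(fineK fin) !lee_fin => h1 h2.
by rewrite ler_norml; apply/andP; split; lra.
Qed.

End NonmeasurableIntegral.

(** * Weak convergence from convergence of cosines *)

Section WeakConvergence.
Context {R : realType} {dT dQ} {T : measurableType dT} {S : measurableType dQ}.
Context (P : probability T R) (Q : probability S R) (d : nat).
Local Notation pt := ('I_d -> \bar R).
Context (U : nat -> T -> pt -> R) (Y : S -> pt -> R).
Hypothesis mU : forall n t, measurable_fun setT (fun w => U n w t).
Hypothesis mY : forall t, measurable_fun setT (fun w => Y w t).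
Hypothesis cos_cvg : forall l b, Ex P (fun w => cos (lin l (U n w) + b)) @[n --> \oo] -->
  Ex Q (fun w => cos (lin l (Y w) + b)).

Lemma trig_bmeas {dS'} {S' : measurableType dS'} (Z : S' -> pt -> R) f :
  (forall t, measurable_fun setT (fun w => Z w t)) -> trig f -> bmeas (fun w => f (Z w)).
Proof.
move=> mZ; elim=> [l b a|{}f g _ hf _ hg]; last exact: bmeasD.
apply: bmeasZ; split; last by exists 1 => w; rewrite ler_norml cos_geN1 cos_le1.
apply: (measurableT_comp (f := cos)).
  by apply: continuous_measurable_fun; exact: continuous_cos.
by apply: measurable_funD => //; exact: measurable_lin.
Qed.

Lemma trig_cvg f : trig f -> Ex P (fun w => f (U n w)) @[n --> \oo] --> Ex Q (fun w => f (Y w)).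
Proof.
elim=> [l b a|{}f g tf hf tg hg].
  have bc (dS' : measure_display) (S' : measurableType dS') (Z : S' -> pt -> R) :
      (forall t, measurable_fun setT (fun w => Z w t)) -> bmeas (fun w => cos (lin l (Z w) + b)).
    move=> mZ; have := trig_bmeas mZ (trig_cos l b 1).
    by under eq_fun do rewrite mul1r.
  under eq_fun do rewrite (ExZ P a (bc _ _ _ (mU _))).
  rewrite (ExZ Q a (bc _ _ _ mY)).
  by apply: cvgM; [exact: cvg_cst|exact: cos_cvg].
under eq_fun do rewrite (ExD P (trig_bmeas (mU _) tf) (trig_bmeas (mU _) tg)).
rewrite (ExD Q (trig_bmeas mY tf) (trig_bmeas mY tg)).
exact: cvgD.
Qed.

(** The approximation of [h] by [f] is good only on events of large probability. Off them the
    difference is at most 2 M, which is why [f] must obey the same bound as [h]. *)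
Lemma integral_test_cvg (h : (pt -> R) -> R) M : (forall z, `|h z| <= M) ->
  (forall e, 0 < e -> exists f A B, [/\ trig f /\ forall z, `|f z| <= M,
     [/\ measurable B, prob Q (~` B) <= e & forall w, B w -> `|h (Y w) - f (Y w)| <= e],
     forall n, measurable (A n) /\ prob P (~` A n) <= e &
     exists N, forall n w, (N <= n)%N -> A n w -> `|h (U n w) - f (U n w)| <= e]) ->
  (fun n => \int[P]_w (h (U n w))%:E)%E @ \oo --> (\int[Q]_w (h (Y w))%:E)%E.
Proof.
move=> hM happ; have M0 : 0 <= M by exact: le_trans (hM (fun=> 0)).
have hfin (dS' : measure_display) (S' : measurableType dS') (P' : probability S' R) (Z : S' -> pt -> R) :
    (\int[P']_w (h (Z w))%:E = (fine (\int[P']_w (h (Z w))%:E))%:E)%E.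
  have [||w|c [-> _]//] := @integral_approx _ _ _ P' (fun w => h (Z w)) (fun=> 0) (fun=> M).
  - exact: bmeas_cst.
  - exact: bmeas_cst.
  by rewrite subr0.
have close (dS' : measure_display) (S' : measurableType dS') (P' : probability S' R) (Z : S' -> pt -> R) f C e :
    (forall t, measurable_fun setT (fun w => Z w t)) -> trig f -> (forall z, `|f z| <= M) ->
    measurable C -> prob P' (~` C) <= e -> 0 < e -> (forall w, C w -> `|h (Z w) - f (Z w)| <= e) ->
    `|fine (\int[P']_w (h (Z w))%:E)%E - Ex P' (fun w => f (Z w))| <= e + (M + M) * e.
  move=> mZ tf fM mC Ce e0 hf; have mC' : measurable (~` C) by exact: measurableC.
  have b1 : bmeas (fun w => e + (M + M) * \1_(~` C) w).
    by apply: bmeasD; [exact: bmeas_cst|apply: bmeasZ; exact: bmeas_indic].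
  have [w|c [-> hc]] := @integral_approx _ _ _ P' (fun w => h (Z w)) _ _ (trig_bmeas mZ tf) b1.
    rewrite indicE; have [Cw|nCw] := pselect (C w).
      by rewrite memNset ?mulr0 ?addr0 ?hf// => /(_ Cw).
    by rewrite mem_set// mulr1 ler_wpDl ?(ltW e0)// (le_trans (ler_normB _ _))// lerD.
  rewrite /= (le_trans hc)// ExD; [|exact: bmeas_cst|by apply: bmeasZ; exact: bmeas_indic].
  rewrite Ex_cst lerD2l ExZ ?ler_wpM2l ?addr_ge0//; last exact: bmeas_indic.
  by rewrite -prob_Ex.
rewrite [X in _ --> X]hfin; apply/fine_cvgP; split.
  by apply: nearW => n; rewrite hfin.
apply/cvgrPdist_le => e e0.
pose e' := e / (3 + (M + M) + (M + M)).
have D0 : 0 < 3 + (M + M) + (M + M) by lra.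
have e'0 : 0 < e' by rewrite divr_gt0.
have [f [A [B [[tf fM] [mB pB hB] hA [N hN]]]]] := happ _ e'0.
have /cvgrPdist_le/(_ _ e'0)[N' _ hN'] := trig_cvg tf.
exists (maxn N N') => // n /=; rewrite geq_max => /andP[Nn N'n].
have hY := close _ _ Q Y f B e' mY tf fM mB pB e'0 hB.
have hU := close _ _ P (U n) f (A n) e' (mU n) tf fM (hA n).1 (hA n).2 e'0 (fun w => hN n w Nn).
have hYU := hN' n N'n; rewrite /= in hYU.
set a := fine _; set b := fine _; rewrite -/a in hY; rewrite -/b in hU.
set c := Ex Q _ in hY hYU; set c' := Ex P _ in hU hYU.
have eE : e = 3 * e' + (M + M) * e' + (M + M) * e' by rewrite /e'; field; rewrite gt_eqF.
rewrite (_ : a - b = (a - c) + (c - c') + - (b - c')); last by ring.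
rewrite (le_trans (ler_normD _ _))// normrN (le_trans (lerD (ler_normD _ _) (lexx _)))//.
by rewrite eE; lra.
Qed.

End WeakConvergence.

(** * Identification of Gaussian laws *)

Section GaussianLaw.
Context {R : realType}.

Lemma gauss_indic (s : R) (A : set R) : measurable A ->
  normal_prob 0 1 ((fun x : R => s * x) @^-1` A) = gauss_expect s \1_A.
Proof.
move=> mA; rewrite /normal_prob integral_mkcond /gauss_expect; apply: eq_integral => x _.
rewrite patchE -std_gauss_densityE indicE; have [sA|sA] := pselect (A (s * x)).
  by rewrite !mem_set// mul1r.
by rewrite !memNset// mul0r.
Qed.

Definition clip (u : R) : R := Num.min 1 (Num.max 0 u).

Lemma clip_itv u : 0 <= clip u <= 1.
Proof. by rewrite /clip le_min ge_min !le_max ge_max !lexx ler01. Qed.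

Lemma clip_lip u v : `|clip u - clip v| <= `|u - v|.
Proof.
wlog uv : u v / v <= u.
  by move=> h; have [/h|/ltW/h] := leP v u; rewrite // distrC [leRHS]distrC.
rewrite [leRHS]ger0_norm ?subr_ge0// ler_norml /clip !minEle !maxEle.
by apply/andP; split; repeat case: ifPn; rewrite -?ltNge => *; lra.
Qed.

Lemma ramp_cvg a y : clip (k%:R * (a - y)) @[k --> \oo] --> (\1_(`]-oo, a[%classic) y : R).
Proof.
rewrite indicE; have [ya|ay] := ltP y a.
  rewrite mem_set; last by rewrite /= in_itv.
  apply: cvg_near_cst; exists (Num.truncn (a - y)^-1).+1 => // k /= hk.
  have ay0 : 0 < a - y by rewrite subr_gt0.
  have h : 1 <= k%:R * (a - y).
    rewrite -ler_pdivrMr// mul1r (le_trans (ltW (truncnS_gt _)))// ler_nat.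
    exact: hk.
  by rewrite /clip (max_idPr _) ?(le_trans ler01 h)// (min_idPl _).
rewrite memNset; last by rewrite /= in_itv/= ltNge ay.
apply: cvg_near_cst; apply: nearW => k.
rewrite /clip (max_idPl _) ?(min_idPr _)//.
by rewrite mulr_ge0_le0// subr_le0.
Qed.

(** Lipschitz ramps converge pointwise to the indicators of open half-lines, so both laws agree on a
    generating family stable under intersection. *)
Lemma gaussian_law {dS} {S : measurableType dS} (Q : probability S R) (Z : S -> R) (s : R) :
  measurable_fun setT Z ->
  (forall (g : R -> R) L M, 0 <= L -> (forall y z, `|g y - g z| <= L * `|y - z|) ->
     (forall y, `|g y| <= M) -> Ex Q (fun w => g (Z w)) = gexp s g) ->
  forall A, measurable A -> Q (Z @^-1` A) = gauss_expect s \1_A.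
Proof.
move=> mZ hg A mA; rewrite -gauss_indic//.
have ms : measurable_fun setT (fun x : R => s * x) by exact: measurable_funM.
pose G1 : probability R R := law Q mZ; pose G2 : probability R R := law (normal_prob 0 1) ms.
rewrite -[LHS]/(G1 A) -[RHS]/(G2 A).
(* [setT] is added so that the constant sequence [setT] can serve as the countable cover required
   for uniqueness. *)
pose G : set (set R) := @RGenInftyO.G R `|` [set setT].
have mray a : measurable (`]-oo, a[%classic : set R) by exact: measurable_itv.
have ray a : G1 `]-oo, a[%classic = G2 `]-oo, a[%classic.
  have -> : G2 `]-oo, a[%classic = gauss_expect s \1_(`]-oo, a[%classic) by exact: gauss_indic.
  rewrite (@gexpE _ _ _ 1)//; last first.
    by move=> y; rewrite indicE; case: (_ \in _); rewrite ?normr1 ?normr0.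
  have -> : G1 `]-oo, a[%classic = (Ex Q (fun w => \1_(`]-oo, a[%classic) (Z w)))%:E.
    by rewrite -Ex_law ?Ex_indic ?probE//; exact: bmeas_indic.
  congr EFin; pose g k (y : R) := clip (k%:R * (a - y)).
  have g1 k y : `|g k y| <= 1 by have /andP[? ?] := clip_itv (k%:R * (a - y)); rewrite ger0_norm.
  have glip k y z : `|g k y - g k z| <= k%:R * `|y - z|.
    rewrite (le_trans (clip_lip _ _))// -mulrBr normrM ger0_norm// ler_wpM2l//.
    by rewrite (_ : a - y - (a - z) = - (y - z)) ?normrN//; ring.
  have mg k : measurable_fun setT (g k).
    by apply: continuous_measurable_fun; exact: lipschitz_continuous (glip k).
  have [_ c1] := @Ex_dominated _ _ _ Q (fun k w => g k (Z w)) _ 1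
    (fun k => measurableT_comp (mg k) mZ) (fun k w => g1 k _) (fun w => @ramp_cvg a (Z w)).
  have c2 := @gauss_dominated _ (fun k y => g k (s * y)) _ 1
    (fun k => measurable_scaled s (mg k)) (fun k y => g1 k _) (fun y => @ramp_cvg a (s * y)).
  have e : (fun k => Ex Q (fun w => g k (Z w))) =
      (fun k => fine (\int[lebesgue_measure]_x (g k (s * x) * std_gauss_density x)%:E)%E).
    by apply/funext => k; rewrite (hg (g k) k%:R 1)//; exact: glip.
  by rewrite e in c1; rewrite -(cvg_lim _ c1)// (cvg_lim _ c2).
apply: (@measure_unique _ R R G (fun=> setT)) => //.
- apply: (etrans (@RGenInftyO.measurableE R)); rewrite eqEsubset; split.
    apply: smallest_sub; first exact: smallest_sigma_algebra.
    by move=> B GB; apply: sub_gen_smallest; left.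
  apply: smallest_sub; first exact: smallest_sigma_algebra.
  move=> B [GB|->]; first exact: sub_gen_smallest.
  exact: (@measurableT _ (g_sigma_algebraType (@RGenInftyO.G R))).
- move=> B C [[b ->]|->] [[c ->]|->].
  + left; exists (Num.min b c); rewrite eqEsubset; split=> y /=; rewrite !in_itv/= lt_min.
      by move=> [-> ->].
    by move=> /andP[].
  + by rewrite setIT; left; exists b.
  + by rewrite setTI; left; exists c.
  + by rewrite setIT; right.
- by move=> n; right.
- by rewrite bigcup_const//; exists 0%N.
- by move=> B [[b ->]|->]; [exact: ray|exact: etrans (probability_setT G1) (esym (probability_setT G2))].
- by move=> _; rewrite (le_lt_trans (probability_le1 G1 measurableT))// ltry.
Qed.

End GaussianLaw.

(** * Convergence *)

Section EmpiricalLimit.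
Context {R : realType} {dT} {T : measurableType dT} (P : probability T R) (d : nat).
Context (X : nat -> T -> 'I_d -> R).
Hypothesis mX : forall i j, measurable_fun setT (fun w => X i w j).
Hypothesis cF : distF_continuous P X.
Context (good : nat -> nat -> set T) (eta : nat -> R) (c x : R).
Hypothesis mgood : forall n m, measurable (good n m).
Hypothesis ndgood : forall n m, good n m `<=` good n m.+1.
Hypothesis pgood : forall n m, prob P (~` good n m) <= eta m.
Hypothesis eta0 : forall e, 0 < e -> exists m, eta m <= e.
Hypotheses (c0 : 0 <= c) (x0 : 0 < x) (x1 : x < 1).
Local Notation U := (Un P X).
Hypothesis equic : forall n m k w s t, (2 ^ k <= n)%N -> good n m w -> adjacent P X k s t ->
  `|U n w s - U n w t| <= c * (2 ^+ m * x ^+ k + (Num.sqrt n%:R)^-1).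
Hypothesis bounded : forall n m w t, (0 < n)%N -> good n m w -> `|U n w t| <= c * (2 ^+ m + 1).
Hypothesis fdd : forall l, exists2 s : R, 0 <= s & forall (g : R -> R) L M, 0 <= L ->
  (forall y z, `|g y - g z| <= L * `|y - z|) -> (forall y, `|g y| <= M) ->
  Ex P (fun w => g (lin l (U n w))) @[n --> \oo] --> gexp s g.

Lemma empirical_limit :
  exists (dQ : measure_display) (Om : measurableType dQ) (Q : probability Om R)
         (W : ('I_d -> \bar R) -> Om -> R),
    [/\ centered_gaussian_process Q W,
        {ae Q, forall w, path_continuous (fun t => W t w)} &
        forall h, D_test_function h ->
          (fun n : nat => \int[P]_w (h (Un P X n w))%:E)%E
            @ \oo --> (\int[Q]_w (h (fun t => W t w))%:E)%E].
Proof.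
have [V [UV oV]] := ultraFilterLemma (eventually_filter : ProperFilter \oo).
have mU n t : measurable_fun setT (fun w => U n w t).
  rewrite (funext (fun w => Un_emp P mX n w t)).
  by have [] := bmeas_emp P n (obs_ind mX t).
have U0 w t : U 0%N w t = 0 by rewrite /Un big_geq// mulr0.
pose Q := loeb_prob P UV oV.
pose Y := @W R dT T d V UV U good.
have mY t : measurable_fun setT (Y t) by exact: measurable_W bounded t.
have cY w : path_continuous (fun t => Y t w) by exact: (W_path_continuous mX cF oV U0 c0 x0 x1 equic bounded).
(* Along [V] the same sequence of expectations has two limits, the Gaussian one and the one computed
   on the Loeb space; hence they are equal. *)
have lawY l s g L M : 0 <= L -> (forall y z, `|g y - g z| <= L * `|y - z|) ->
    (forall y, `|g y| <= M) -> Ex P (fun w => g (lin l (U n w))) @[n --> \oo] --> gexp s g ->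
    Ex Q (fun w => g (lin l (fun t => Y t w))) = gexp s g.
  move=> L0 gL gM h.
  have h1 : Ex P (fun w => g (lin l (U n w))) @[n --> V] --> gexp s g.
    by move=> A /h /oV.
  have h2 : Ex P (fun w => g (lin l (U n w))) @[n --> V] --> Ex Q (fun w => g (lin l (fun t => Y t w))).
    by apply: (Ex_W mU U0 mgood ndgood pgood eta0 c0 bounded (lipschitz_continuous gL) gM).
  by rewrite -(ulimE h1) (ulimE h2).
exists _, (@loebT _ T V UV), Q, Y; split.
- split=> // k t a; pose l := [seq (a j, t j) | j <- enum 'I_k].
  have [s s0 hs] := fdd l; exists s => // A mA.
  have linE w : \sum_(j < k) a j * Y (t j) w = lin l (fun t => Y t w).
    by rewrite /lin big_map big_enum.
  rewrite (_ : (fun w => _) = (fun w => lin l (fun t => Y t w))); last first.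
    by apply/funext => w; rewrite linE.
  apply: gaussian_law => //; first exact: measurable_lin.
  move=> g L M L0 gL gM; apply: (lawY l s g L M L0 gL gM).
  exact: hs L0 gL gM.
- exact: aeW.
move=> h hh; have [[M hM] _] := hh.
have cos_cvg l b : Ex P (fun w => cos (lin l (U n w) + b)) @[n --> \oo] -->
    Ex Q (fun w => cos (lin l (fun t => Y t w) + b)).
  have [s s0 hs] := fdd l.
  have lipc (y z : R) : `|cos (y + b) - cos (z + b)| <= 1 * `|y - z|.
    rewrite -!sinDpihalf mul1r (le_trans (sin_lip _ _))//.
    by rewrite (_ : y + b + pi / 2 - (z + b + pi / 2) = y - z)//; ring.
  have bndc (y : R) : `|cos (y + b)| <= 1 by rewrite ler_norml cos_geN1 cos_le1.
  have hc := hs (fun y => cos (y + b)) 1 1 ler01 lipc bndc.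
  by rewrite (lawY l s (fun y => cos (y + b)) 1 1).
apply: (integral_test_cvg (Y := fun w t => Y t w) mU mY cos_cvg hM) => e e0.
have [m hm] := eta0 e0.
(* For one fixed [m] the bound and the modulus of paths on good events no longer depend on n, so a
   single equicontinuous family serves both [U] and the limit. *)
pose B := c * (2 ^+ m + 1); pose om k := c * (2 ^+ m * x ^+ k).
have B0 : 0 <= B by rewrite mulr_ge0// addr_ge0// exprn_ge0.
have om0 e' : 0 < e' -> exists k, om k <= e'.
  move=> e'0; have [|k hk] := @geo_lt _ x x0 x1 (c * 2 ^+ m) e' _ e'0.
    by rewrite mulr_ge0// exprn_ge0.
  by exists k; rewrite /om mulrA ltW.
have [f [tf fM [N hN]]] := trig_approx mX cF om0 hh hM e0 B0.
exists f, (fun n => good n m), (ugood good m); split=> //.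
- split; first exact: measurable_ugood.
    exact: le_trans (prob_ugood UV oV mgood pgood m) hm.
  move=> w gw; apply: hN; split.
  + exact/path_continuous_cadlag/cY.
  + by move=> t; exact: (W_bounded U0 c0 bounded).
  + move=> k s t _ st; rewrite ler_wpDr//.
    exact: (W_equicont oV U0 c0 equic bounded gw st).
- by move=> n; split=> //; exact: le_trans (pgood n m) hm.
(* For large n the error of order 1 / sqrt n falls below the slack 1/(N+1) of [eqfam]. *)
have : c * (Num.sqrt n%:R)^-1 @[n --> \oo] --> c * 0 by apply: cvgM; [exact: cvg_cst|exact: inv_sqrt_cvg].
rewrite mulr0 => /cvgr_lt/(_ N.+1%:R^-1)[|N' _ hN']; first by rewrite invr_gt0.
exists (maxn (2 ^ N) N') => n w; rewrite geq_max => /andP[Nn N'n] gw; apply: hN; split.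
- exact: Un_cadlag.
- by move=> t; apply: bounded gw; rewrite (leq_trans _ Nn)// expn_gt0.
move=> k s t kN st; rewrite (le_trans (equic _ gw st))//.
  by rewrite (leq_trans _ Nn)// leq_pexp2l.
by rewrite mulrDr lerD2l; apply/ltW/hN'.
Qed.

End EmpiricalLimit.

Theorem theorem2 (R : realType) (dT : measure_display) (T : measurableType dT)
  (P : probability T R) (d : nat) (X : nat -> T -> 'I_d -> R)
  (G : set (('I_d -> R) -> R)) (nG : (('I_d -> R) -> R) -> R)
  (r : R) (Theta : nat -> R) (p : nat) (Psi : R -> R) (gamma : R) :
  (0 < d)%N ->
  (forall i j, measurable_fun setT (fun w => X i w j)) ->
  stationary P X ->
  distF_continuous P X ->
  function_space G nG ->
  (* (i) central limit theorem for bounded centered f in G *)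
  (forall f, G f -> (exists M : R, forall x, `|f x| <= M) ->
     (\int[P]_w (f (X 0%N w))%:E = 0)%E ->
     exists2 sigma2 : R, 0 <= sigma2 &
       forall h : R -> R, continuous h -> (exists M : R, forall y, `|h y| <= M) ->
         (fun n : nat => \int[P]_w
             (h ((Num.sqrt n%:R)^-1 * \sum_(1 <= i < n.+1) f (X i w)))%:E)%E
           @ \oo --> gauss_expect (Num.sqrt sigma2) h) ->
  (* (ii) multiple mixing and summability *)
  multiple_mixing P X G nG Theta r ->
  d%:R * r < p%:R ->
  (\sum_(0 <= i <oo) (((i ^ (2 * p - 2))%N)%:R * Theta i)%:E < +oo)%E ->
  (* (iii) control function *)
  control_function P X G nG Psi ->
  (exists C z0 : R, forall z, z0 <= z -> Psi z <= C * z `^ gamma^-1) ->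
  r * p%:R / (p%:R - r * d%:R) < gamma ->
  (* conclusion *)
  exists (dQ : measure_display) (Om : measurableType dQ) (Q : probability Om R)
         (W : ('I_d -> \bar R) -> Om -> R),
    [/\ centered_gaussian_process Q W,
        {ae Q, forall w, path_continuous (fun t => W t w)} &
        forall h, D_test_function h ->
          (fun n : nat => \int[P]_w (h (Un P X n w))%:E)%E
            @ \oo --> (\int[Q]_w (h (fun t => W t w))%:E)%E].
Proof.
move=> d0 mX sX cF hG hclt hmix dr hsum hctrl hPsi hgam.
have r1 : 1 <= r by case: hmix.
have dr0 : 0 <= d%:R * r :> R by rewrite mulr_ge0//; lra.
have p0 : (0 < p)%N by rewrite -(ltr0n R) (le_lt_trans dr0).
have gamma0 : 0 < gamma.
  apply: le_lt_trans hgam; rewrite divr_ge0//; first by rewrite mulr_ge0//; lra.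
  by rewrite subr_ge0 mulrC ltW.
have [C1 C10 hC1] := approximant_ex mX cF hG hctrl hPsi gamma0.
(* The range condition is placed under the existential so that a choice is possible for all pairs;
   outside the range the value 0 is arbitrary. *)
have /choice[phi' hphi'] (ki : nat * ('I_d -> nat)) : exists f, (forall j, (ki.2 j <= 2 ^ ki.1)%N) ->
    [/\ G f, bracket P X (fun j => ((ki.2 j)%:R - 1) / 2 ^+ ki.1) (fun j => (ki.2 j)%:R / 2 ^+ ki.1) f &
      nG f <= C1 * (2 `^ gamma^-1) ^+ ki.1].
  have [h|nh] := pselect (forall j, (ki.2 j <= 2 ^ ki.1)%N); last by exists (fun=> 0).
  by have [f [Gf lf fu nf]] := hC1 _ _ h; exists f.
pose phi k i := phi' (k, i).
have hphi k i : (forall j, (i j <= 2 ^ k)%N) ->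
  [/\ G (phi k i), bracket P X (fun j => ((i j)%:R - 1) / 2 ^+ k) (fun j => (i j)%:R / 2 ^+ k) (phi k i) &
      nG (phi k i) <= C1 * (2 `^ gamma^-1 : R) ^+ k] by exact: (hphi' (k, i)).
have [x [x0 x1 hx]] := rate_exists p0 gamma0 r1 dr hgam.
have [C C0 pgood] := prob_good mX cF hG gamma0 C10 hphi x0 sX hmix p0 hsum hx.
have mgood := measurable_good mX cF hG gamma0 C10 hphi x0.
have ndgood n m : good P X phi x n m `<=` good P X phi x n m.+1.
  move=> w gw k kn l; rewrite (le_trans (gw k kn l))// ler_wpM2r ?exprn_ge0 ?(ltW x0)//.
  by rewrite ler_weXn2l// ler1n.
have eta0 e : 0 < e -> exists m, C / 4 ^+ (m * p) <= e.
  move=> e0; have [||k hk] := @geo_lt R (4^-1) _ _ C e C0 e0; [lra|lra|].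
  exists k; rewrite (le_trans _ (ltW hk))// -exprVn ler_wpM2l//.
  by apply: ler_wiXn2l; [lra|lra|rewrite leq_pmulr].
have [c1 c10 happ] := emp_approx mX cF hG gamma0 C10 hphi x0 x1.
have [c2 c20 heq] := emp_equicont d0 mX cF hG gamma0 C10 hphi x0 x1.
have [c3 c30 hbnd] := emp_bounded d0 mX cF hG gamma0 C10 hphi x0 x1.
have hphi01 k i : (forall j, (i j <= 2 ^ k)%N) -> G (phi k i) /\ forall y, 0 <= phi k i y <= 1.
  by move=> /hphi[Gf bf _]; split=> // y; exact: bracket_itv bf.
apply: (empirical_limit mX cF (c := c2 + c3) mgood ndgood pgood eta0 _ x0 x1).
- exact: addr_ge0.
- move=> n m k w s t kn gw st; rewrite !(Un_emp P mX) (le_trans (heq _ _ _ _ _ _ kn gw st))//.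
  by rewrite ler_wpM2r ?lerDl// addr_ge0 ?invr_ge0 ?sqrtr_ge0// mulr_ge0 ?exprn_ge0// ltW.
- move=> n m w t n0 gw; rewrite (Un_emp P mX) (le_trans (hbnd _ _ _ _ n0 gw))//.
  by rewrite ler_wpM2r ?lerDr// addr_ge0// exprn_ge0.
move=> l; have [s s0 hs] := fdd_emp mX hG hclt hphi01 x0 x1 c10 mgood pgood eta0 happ hbnd
  (fun i : 'I_(size l) => (tnth (in_tuple l) i).2) (fun i => (tnth (in_tuple l) i).1).
exists s => // g L M L0 gL gM; have := hs g L M L0 gL gM.
rewrite (_ : (fun n => Ex P (fun w => g (lin l (Un P X n w)))) = (fun n => Ex P (fun w => g
  (\sum_(j < size l) (tnth (in_tuple l) j).1 * emp P X n (ind (tnth (in_tuple l) j).2) w))))//.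
apply/funext => n; congr Ex; apply/funext => w; congr g; rewrite /lin big_tnth.
by apply: eq_bigr => i _; rewrite (Un_emp P mX).
Qed.
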